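(* Let $\mathcal H$ be a separable complex Hilbert space, let $X$ and $\Omega$ be Hausdorff spaces with $\Omega$ locally compact, and let $p:\Omega\times X\times X\to\mathbb C$ be a bounded continuous function such that the kernel $p_w(x,y):=p(w,x,y)$ on $X$ is positive definite for every $w\in\Omega$. Let $\Lambda:\mathscr B(\Omega)\to\mathcal L(\mathcal H)$ be a Radon nonnegative finite operator valued measure that admits a Radon-Nikodym decomposition $d\Lambda=G\,d\lambda$. Consider $$P:X\times X\to\mathcal L(\mathcal H),\quad P(x,y)=\int_\Omega p_w(x,y)\,d\Lambda(w),$$ and for every $v\in\mathcal H\setminus\{0\}$ the scalar kernel $P_v(x,y)=\langle P(x,y)v,v\rangle_{\mathcal H}$ and the scalar nonnegative finite Radon measure $\Lambda_v(A)=\langle\Lambda(A)v,v\rangle_{\mathcal H}$. Then: (i) The operator valued kernel $P$ and the scalar valued kernels $P_v$ are well defined and positive definite. (ii) The function $P:X\times X\to\mathcal L(\mathcal H)$ is bounded and continuous in the norm topology of $\mathcal L(\mathcal H)$. In particular, $\mathcal H_P\subset C(X,\mathcal H)$. (iii) If $p_w$ is strictly positive definite for every $w\in\Omega$, then $P$ is strictly positive definite if and only if all scalar valued projections $P_v$, $v\in\mathcal H\setminus\{0\}$, are strictly positive definite. (iv) If $p_w$ is universal for every $w\in\Omega$, then $P$ is universal if and only if all the kernels $P_v$, $v\in\mathcal H\setminus\{0\}$, are universal. (v) If $X$ is locally compact and $p_w$ is integrally strictly positive definite for every $w\in\Omega$, then $P$ is integrally strictly positive definite if and only if all the kernels $P_v$,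 $v\in\mathcal H\setminus\{0\}$, are integrally strictly positive definite. Additionally, in each of (iii), (iv) and (v) (under the respective hypothesis) the two equivalent conditions are also equivalent to $\Lambda(\Omega)$ being a positive definite operator.
   Context: Inner products are linear in the first argument. A bounded operator $T$ on $\mathcal H$ is positive semidefinite if $\langle Tv,v\rangle\ge0$ for all $v$, and positive definite if $\langle Tv,v\rangle>0$ for all $v\ne0$. A kernel $K:X\times X\to\mathcal L(\mathcal H)$ is positive definite if for all finitely many distinct $x_1,\dots,x_n\in X$ and $v_1,\dots,v_n\in\mathcal H$, $\sum_{\mu,\nu}\langle K(x_\mu,x_\nu)v_\nu,v_\mu\rangle_{\mathcal H}\ge 0$, and strictly positive definite if moreover the sum vanishes only when all $v_\mu=0$. Scalar kernels are the case $\mathcal H=\mathbb C$. The RKHS $\mathcal H_K$ is the Hilbert space of functions $X\to\mathcal H$ in which the span of the functions $K_xv:z\mapsto K(z,x)v$ is dense and $\langle K_xv,F\rangle_{\mathcal H_K}=\langle v,F(x)\rangle_{\mathcal H}$. $K$ is universal if $\mathcal H_K\subset C(X,\mathcal H)$ and for every compact $\mathcal A\subset X$, continuous $g:\mathcal A\to\mathcal H$ and $\epsilon>0$ there is $f\in\mathcal H_K$ with $\sup_{x\in\mathcal A}\|f(x)-g(x)\|_{\mathcal H}<\epsilon$. For $X$ locally compact Hausdorff, a bounded positive definite kernel $K$ with $\mathcal H_K\subset C(X,\mathcal H)$ is integrally strictly positive definite if $\int_X\langle\int_XK(x,y)\,d\eta(x),d\eta(y)\rangle>0$ for every nonzero $\eta\in\mathfrak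 M(X,\mathcal H)$. Here $\mathfrak M(X,\mathcal H)$ is the set of $\mathcal H$-valued Borel measures of bounded variation that are Radon (variation outer regular on Borel sets, inner regular by compact sets on open sets); $\int\langle F,d\eta\rangle$ equals $\sum_i\langle v_i,\eta(A_i)\rangle$ for simple $F=\sum_iv_i\chi_{A_i}$ and is extended by $L^1(|\eta|)$-limits to Bochner integrable $F$; $\int_XK(x,y)\,d\eta(x)\in\mathcal H$ is the vector with $\langle v,\int_XK(x,y)\,d\eta(x)\rangle_{\mathcal H}=\int_X\langle K(x,y)v,d\eta(x)\rangle$ for all $v\in\mathcal H$. $\mathscr B(\Omega)$ is the Borel $\sigma$-algebra. A Radon nonnegative finite operator valued measure with Radon-Nikodym decomposition $d\Lambda=G\,d\lambda$ is a (norm) countably additive $\Lambda:\mathscr B(\Omega)\to\mathcal L(\mathcal H)$ of bounded variation, with $\Lambda(A)$ positive semidefinite for all $A$, whose variation $|\Lambda|$ is outer regular on all Borel subsets of $\Omega$ and inner regular by compact sets on all open subsets of $\Omega$, such that $\Lambda(A)=\int_AG\,d\lambda$ for a finite nonnegative scalar measure $\lambda$ and a Bochner $\lambda$-integrable $G:\Omega\to\mathcal L(\mathcal H)$. For bounded measurable $g:\Omega\to\mathbb C$, $\int g\,d\Lambda=\int gG\,d\lambda$ (Bochner integral). *)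

(* Defs.v *)
From HB Require Import structures.
From mathcomp Require Import all_boot all_order all_algebra.
From mathcomp Require Import sesquilinear complex.
From mathcomp Require Import all_classical all_reals all_analysis.

Set Implicit Arguments.
Unset Strict Implicit.
Unset Printing Implicit Defensive.

Import Order.TTheory GRing.Theory Num.Def Num.Theory.
Import numFieldNormedType.Exports.
Local Open Scope classical_set_scope.
Local Open Scope ring_scope.
Local Open Scope complex_scope.

HB.mixin Record CompleteNormedModule_isHilbert (K : numClosedFieldType) H
    & CompleteNormedModule K H := {
  inner : {dot H for (@Num.conj K)} ;
  inner_norm : forall x : H, `|x| ^+ 2 = inner x x
}.

#[short(type="hilbertType")]
HB.structure Definition Hilbert (K : numClosedFieldType) :=
  {H of CompleteNormedModule K H & CompleteNormedModule_isHilbert K H}.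

HB.instance Definition _ (R : realType) := NormedModule.copy R[i] (R[i])^o.

(* In a normed module over [R[i]] the library's norm [`|x|] is an element of
   [R[i]] (with zero imaginary part); [nrm x] is the same number in [R]. *)
Definition nrm {R : realType} {V : normedModType R[i]} (x : V) : R :=
  complex.Re `|x|.

Section nrm_theory.
Variables (R : realType) (V : normedModType R[i]).
Implicit Types x y : V.

Lemma nrmE x : (nrm x)%:C = `|x|.
Proof. by rewrite /nrm RRe_real// realE normr_ge0. Qed.

Lemma nrm_ge0 x : 0 <= nrm x.
Proof. by rewrite -ler0c nrmE. Qed.

Lemma nrm0 : nrm (0 : V) = 0.
Proof. by apply: complexI; rewrite nrmE normr0. Qed.

Lemma nrm0_eq0 x : nrm x = 0 -> x = 0.
Proof. by move=> x0; apply/normr0_eq0; rewrite -nrmE x0. Qed.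

Lemma nrm_normD x y : nrm (x + y) <= nrm x + nrm y.
Proof. by rewrite -lecR rmorphD/= !nrmE ler_normD. Qed.

Lemma nrmZ (a : R[i]) x : nrm (a *: x) = nrm a * nrm x.
Proof. by apply: complexI; rewrite rmorphM/= !nrmE normrZ. Qed.

End nrm_theory.

Section C_hilbert.
Variable R : realType.
Local Notation C := R[i].

Definition cinner (x y : C) : C := x * y^*.

Lemma cinner_bilinear : bilinear_for *%R (Num.conj \; *%R) cinner.
Proof.
split => [u a x y|u a x y]; rewrite /cinner /=.
  by rewrite mulrDl -mulrA.
by rewrite rmorphD rmorphM mulrDr mulrCA.
Qed.

HB.instance Definition _ := bilinear_isBilinear.Build C C C C
  *%R (Num.conj \; *%R) cinner cinner_bilinear.

Lemma cinner_herm (x y : C) :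
  cinner x y = (-1) ^+ false * Num.conj (cinner y x).
Proof. by rewrite /cinner expr0 mul1r rmorphM/= conjCK mulrC. Qed.

HB.instance Definition _ := isHermitianSesquilinear.Build C C
  false Num.conj cinner cinner_herm.

Lemma cinner_gt0 (x : C) : x != 0 -> 0 < cinner x x.
Proof. by move=> x0; rewrite /cinner -normCK exprn_gt0// normr_gt0. Qed.

HB.instance Definition _ := isDotProduct.Build C C cinner cinner_gt0.

Let cvg_C (F : set_system C) (FF : Filter F) (a b : R) :
  (@complex.Re R) @ F --> a -> (@complex.Im R) @ F --> b ->
  F --> (a +i* b : C).
Proof.
move=> Fa Fb; apply/cvgrPdist_lt => e e0.
have eR : (complex.Re e)%:C = e by rewrite RRe_real// realE ltW.
have e20 : 0 < complex.Re e / 2 by rewrite divr_gt0// -ltcR eR.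
near=> z.
have -> : (a +i* b : C) - z =
    (a - complex.Re z)%:C + 'i * (b - complex.Im z)%:C.
  by rewrite -complexiE [LHS]complexE !raddfB.
rewrite (le_lt_trans (ler_normD _ _))// normrM normCi mul1r.
rewrite -eR [ltRHS](_ : _ = (complex.Re e / 2)%:C + (complex.Re e / 2)%:C); last first.
  by rewrite -raddfD -splitr.
rewrite ltrD//.
  rewrite normc_def/= expr0n addr0 sqrtr_sqr ltcR.
  by near: z; move/cvgrPdist_lt : Fa; exact.
rewrite normc_def/= expr0n addr0 sqrtr_sqr ltcR.
by near: z; move/cvgrPdist_lt : Fb; exact.
Unshelve. all: by end_near. Qed.

Let complex_le_norm (z : C) :
  `|complex.Re z|%:C <= `|z| /\ `|complex.Im z|%:C <= `|z|.
Proof.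
split; first exact: normc_ge_Re.
by rewrite normc_def lecR -sqrtr_sqr ler_wsqrtr// lerDr sqr_ge0.
Qed.

Let cauchy_part (f : {additive C -> R}) (F : set_system C) :
  (forall z, `|f z|%:C <= `|z|) ->
  ProperFilter F -> cauchy F -> cauchy (f @ F).
Proof.
move=> f_le FF /cauchy_ballP Fc; apply/cauchy_ballP => e e0.
have eC0 : 0 < e%:C :> C by rewrite ltcR.
have [[A B] [FA FB] AB] := Fc _ eC0.
exists (f @` A, f @` B) => /=.
  by split; [apply: filterS FA|apply: filterS FB] => z Az; exists z.
move=> [_ _] /= [[x Ax <-] [y By <-]].
have := AB (x, y) (conj Ax By).
rewrite /ball/= /ball_/= => xy; rewrite -ltcR (le_lt_trans _ xy)//.
by rewrite -raddfB.
Qed.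

Lemma C_complete (F : set_system C) :
  ProperFilter F -> cauchy F -> cvg F.
Proof.
move=> FF Fc; apply/cvg_ex.
have /cauchy_cvg/cvg_ex[a Fa] :=
  cauchy_part (fun z => (complex_le_norm z).1) FF Fc.
have /cauchy_cvg/cvg_ex[b Fb] :=
  cauchy_part (fun z => (complex_le_norm z).2) FF Fc.
by exists (a +i* b : C); exact: cvg_C.
Qed.

HB.instance Definition _ := Uniform_isComplete.Build C C_complete.

Lemma cinner_norm (x : C) : `|x| ^+ 2 = cinner x x.
Proof. exact: normCK. Qed.

HB.instance Definition _ :=
  CompleteNormedModule_isHilbert.Build C C cinner_norm.

End C_hilbert.

Section bounded_operators.
Variables (R : realType) (V : normedModType R[i]).

Definition bounded_linear : {pred V -> V} := fun T =>
  `[< linear T /\ exists M : R, forall v, nrm (T v) <= M * nrm v >].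

Record bop := BOp { bop_fun :> V -> V ; _ : bop_fun \in bounded_linear }.

HB.instance Definition _ := [isSub for bop_fun].
HB.instance Definition _ := [Choice of bop by <:].

Lemma bopP (T : bop) :
  linear T /\ exists M : R, forall v, nrm (T v) <= M * nrm v.
Proof. by case: T => f /= /asboolP. Qed.

HB.instance Definition _ (T : bop) :=
  GRing.isLinear.Build R[i] V V *:%R (T : V -> V) (bopP T).1.

Lemma bounded_linear_submod : subsemimod_closed bounded_linear.
Proof.
split; [split|].
- apply/asboolP; split=> [a u v|]; first by rewrite /= scaler0 addr0.
  by exists 0 => v; rewrite mul0r nrm0.
- move=> S T /asboolP[lS [M SM]] /asboolP[lT [N TN]]; apply/asboolP; split.
    move=> a u v; rewrite !addrfctE lS lT scalerDr.
    by rewrite addrACA.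
  exists (M + N) => v; rewrite (le_trans (nrm_normD _ _))// mulrDl.
  exact: lerD.
- move=> a T /asboolP[lT [M TM]]; apply/asboolP; split.
    move=> b u v; rewrite !scalrfctE lT scalerDr !scalerA.
    by rewrite [a * b]mulrC.
  exists (nrm a * M) => v; rewrite scalrfctE nrmZ -mulrA.
  by rewrite ler_wpM2l// nrm_ge0.
Qed.

HB.instance Definition _ :=
  GRing.isSubmodClosed.Build R[i] (V -> V) bounded_linear bounded_linear_submod.
HB.instance Definition _ := [SubChoice_isSubLmodule of bop by <:].


Definition opnorm (T : bop) : R :=
  sup [set nrm (T v) | v in [set v | nrm v <= 1]].

Lemma opnorm_has_sup (T : bop) :
  has_sup [set nrm (T v) | v in [set v | nrm v <= 1]].
Proof.
split; first by exists (nrm (T 0)), 0 => //=; rewrite nrm0.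
have [_ [M TM]] := bopP T; exists `|M| => _ [v /= v1 <-].
rewrite (le_trans (TM v))// (le_trans (ler_norm _))// normrM.
by rewrite ler_piMr// ger0_norm// nrm_ge0.
Qed.

Lemma opnorm_ge0 (T : bop) : 0 <= opnorm T.
Proof.
have := sup_upper_bound (opnorm_has_sup T); apply; exists 0 => /=.
  by rewrite nrm0.
by rewrite linear0 nrm0.
Qed.

Lemma le_opnorm (T : bop) v : nrm (T v) <= opnorm T * nrm v.
Proof.
have [->|v0] := eqVneq v 0; first by rewrite linear0 nrm0 mulr0.
have nv0 : 0 < nrm v.
  by rewrite lt_def nrm_ge0 andbT; apply: contra v0 => /eqP/nrm0_eq0/eqP.
have nV : nrm ((nrm v)^-1%:C : R[i]) = (nrm v)^-1.
  by apply: complexI; rewrite nrmE ger0_norm// ler0c invr_ge0 nrm_ge0.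
rewrite -ler_pdivrMr// mulrC -nV -nrmZ -linearZ.
apply: (sup_upper_bound (opnorm_has_sup T)); exists ((nrm v)^-1%:C *: v) => //=.
by rewrite nrmZ nV mulVf// gt_eqF.
Qed.

Lemma opnorm_le (T : bop) (M : R) :
  (forall v, nrm v <= 1 -> nrm (T v) <= M) -> opnorm T <= M.
Proof.
move=> TM; apply: ge_sup; first by case: (opnorm_has_sup T).
by move=> _ [v /= v1 <-]; exact: TM.
Qed.

Lemma opnormD (S T : bop) :
  (opnorm (S + T))%:C <= (opnorm S)%:C + (opnorm T)%:C :> R[i].
Proof.
rewrite -rmorphD lecR; apply: opnorm_le => v v1.
rewrite (le_trans (nrm_normD _ _))// lerD//.
  by rewrite (le_trans (le_opnorm _ _))// ler_piMr// opnorm_ge0.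
by rewrite (le_trans (le_opnorm _ _))// ler_piMr// opnorm_ge0.
Qed.

Let opnormZ_le (a : R[i]) (T : bop) : opnorm (a *: T) <= nrm a * opnorm T.
Proof.
apply: opnorm_le => v v1; rewrite nrmZ ler_wpM2l ?nrm_ge0//.
by rewrite (le_trans (le_opnorm _ _))// ler_piMr// opnorm_ge0.
Qed.

Lemma opnormZ (a : R[i]) (T : bop) :
  (opnorm (a *: T))%:C = `|a| * (opnorm T)%:C.
Proof.
rewrite -[`|a|]nrmE -rmorphM; congr (_%:C); apply/eqP; rewrite eq_le opnormZ_le/=.
have [->|a0] := eqVneq a 0; first by rewrite nrm0 mul0r opnorm_ge0.
have na0 : 0 < nrm a.
  by rewrite lt_def nrm_ge0 andbT; apply: contra a0 => /eqP/nrm0_eq0/eqP.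
have nV : nrm a^-1 = (nrm a)^-1.
  by apply: complexI; rewrite nrmE normfV -[`|a|]nrmE fmorphV.
rewrite -ler_pdivlMl// -nV (le_trans _ (opnormZ_le _ _))//.
by rewrite scalerA mulVf// scale1r.
Qed.

Lemma opnorm0_eq0 (T : bop) : (opnorm T)%:C = 0 :> R[i] -> T = 0.
Proof.
move=> /complexI T0; apply/val_inj/funext => v; apply: nrm0_eq0.
apply/eqP; rewrite eq_le nrm_ge0 andbT.
by rewrite (le_trans (le_opnorm _ _))// T0 mul0r.
Qed.

HB.instance Definition _ := Lmodule_isNormed.Build R[i] bop
  opnormD opnormZ opnorm0_eq0.

End bounded_operators.

Section mulop.
Variable R : realType.

Lemma mulop_subproof (c : R[i]) : ( *%R c : R[i] -> R[i]) \in @bounded_linear R R[i].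
Proof.
apply/asboolP; split=> [a u v|]; first by rewrite mulrDr mulrCA.
by exists (nrm c) => v; rewrite -nrmZ.
Qed.

Definition mulop (c : R[i]) : bop R[i] := BOp (mulop_subproof c).

End mulop.

Section operators.
Variables (R : realType) (H : hilbertType R[i]).

Definition psd_op (T : bop H) := forall v, 0 <= inner (T v) v.

Definition pd_op (T : bop H) := forall v, v != 0 -> 0 < inner (T v) v.

Definition separable_space := exists2 D : set H, countable D & dense D.

End operators.

(* Vector measures, as countably additive set functions on the measurable sets
   (their values elsewhere are irrelevant). *)
Section vector_measure.
Variables (R : realType) (d : measure_display) (T : measurableType d).
Variable B : normedModType R[i].
Implicit Types (nu : set T -> B) (A : set T).

Definition countably_additive nu :=
  forall F : (set T)^nat, (forall n, measurable (F n)) -> trivIset setT F ->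
    (fun n => \sum_(0 <= i < n) nu (F i)) @ \oo --> nu (\bigcup_n F n).

Definition variation nu A : \bar R :=
  ereal_sup [set s | exists n (F : 'I_n -> set T),
    [/\ forall i, measurable (F i), trivIset setT F, \bigcup_i F i = A &
        s = (\sum_(i < n) (nrm (nu (F i)))%:E)%E] ].

End vector_measure.

(* Bochner integral with respect to a finite measure [mu]; [mu] is only assumed
   to be a set function so that it can be the variation of a vector measure. *)
Section bochner.
Variables (R : realType) (d : measure_display) (T : measurableType d).
Variable B : normedModType R[i].
Implicit Types (mu : set T -> \bar R) (f s : T -> B).

Definition simple_fun s :=
  finite_set (range s) /\ forall b, measurable (s @^-1` [set b]).

Definition L1_approx mu f (s : (T -> B)^nat) :=
  [/\ forall n, simple_fun (s n),
      {ae mu, forall t, s ^~ t @ \oo --> f t} &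
      (fun n => \int[mu]_t (nrm (f t - s n t))%:E)%E @ \oo --> 0%E].

Definition simple_integral mu s : B :=
  \sum_(b \in range s) (fine (mu (s @^-1` [set b])))%:C *: b.

Definition bochner_integrable mu f := exists s : (T -> B)^nat, L1_approx mu f s.

Definition is_bochner_integral mu f (I : B) :=
  exists2 s : (T -> B)^nat, L1_approx mu f s & (fun n => simple_integral mu (s n)) @ \oo --> I.

Definition bochner_integral mu f : B := xget 0 (is_bochner_integral mu f).

End bochner.

(* Integral of [inner F] against an [H]-valued measure [eta]. *)
Section pairing.
Variables (R : realType) (d : measure_display) (T : measurableType d).
Variable H : hilbertType R[i].
Implicit Types (eta : set T -> H) (F s : T -> H).

Definition simple_pairing s eta : R[i] :=
  \sum_(v \in range s) inner v (eta (s @^-1` [set v])).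

Definition is_pairing F eta (z : R[i]) :=
  exists2 s : (T -> H)^nat, L1_approx (variation eta) F s &
    (fun n => simple_pairing (s n) eta) @ \oo --> z.

Definition pairing F eta : R[i] := xget 0 (is_pairing F eta).

End pairing.

Notation borel T := (g_sigma_algebraType (@open T)).

Section radon.
Variables (R : realType) (X : ptopologicalType).

Definition radon (mu : set (borel X) -> \bar R) :=
  (forall A : set (borel X), measurable A ->
    mu A = ereal_inf [set mu U | U in [set U : set X | open U /\ A `<=` U]]) /\
  (forall U : set X, open U ->
    mu U = ereal_sup [set mu K | K in [set K : set X | compact K /\ K `<=` U]]).

(* The set M(X, H) of Radon vector measures of bounded variation. *)
Definition radon_vector_measure (H : hilbertType R[i])
    (eta : set (borel X) -> H) :=
  [/\ countably_additive eta, (variation eta setT < +oo)%E &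
      radon (variation eta)].

Definition radon_nonneg_opmeasure (H : hilbertType R[i])
    (Lam : set (borel X) -> bop H) :=
  [/\ countably_additive Lam, (variation Lam setT < +oo)%E,
      forall A, measurable A -> psd_op (Lam A) &
      radon (variation Lam)].

Definition RN_decomposition (H : hilbertType R[i])
    (Lam : set (borel X) -> bop H)
    (lam : {finite_measure set (borel X) -> \bar R}) (G : X -> bop H) :=
  bochner_integrable lam (G : borel X -> bop H) /\
  forall A : set (borel X), measurable A ->
    Lam A = bochner_integral lam
      (fun w => (\1_A w : R[i]) *: G w).

End radon.

Section kernels.
Variables (R : realType) (X : Type) (H : hilbertType R[i]).
Implicit Type K : X -> X -> bop H.

Definition kernel_form K n (x : 'I_n -> X) (v : 'I_n -> H) : R[i] :=
  \sum_(mu < n) \sum_(nu < n) inner (K (x mu) (x nu) (v nu)) (v mu).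

Definition pd_kernel K :=
  forall n (x : 'I_n -> X) (v : 'I_n -> H), injective x ->
    0 <= kernel_form K x v.

Definition strictly_pd_kernel K :=
  pd_kernel K /\
  forall n (x : 'I_n -> X) (v : 'I_n -> H), injective x ->
    kernel_form K x v = 0 -> forall mu, v mu = 0.

Definition bounded_kernel K := exists M : R, forall x y, nrm (K x y) <= M.

(* A Hilbert space of functions [X -> H] is a Hilbert space together with an
   injective linear map to the space of all functions [X -> H]. *)
Record RKHS K := {
  rkhs_space :> hilbertType R[i] ;
  rkhs_fun : {linear rkhs_space -> (X -> H)} ;
  rkhs_fun_inj : injective rkhs_fun ;
  rkhs_section : X -> H -> rkhs_space ;
  rkhs_sectionE : forall x v, rkhs_fun (rkhs_section x v) = fun z => K z x v ;
  rkhs_dense : dense [set f : rkhs_space |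
    exists n (a : 'I_n -> R[i]) (x : 'I_n -> X) (v : 'I_n -> H),
      f = \sum_(i < n) a i *: rkhs_section (x i) (v i)] ;
  rkhs_reproducing : forall x v F,
    inner (rkhs_section x v) F = inner v (rkhs_fun F x)
}.

(* The set H_K of functions; the RKHS of a kernel is unique. *)
Definition in_RKHS K : set (X -> H) :=
  [set f | exists (E : RKHS K) (F : E), rkhs_fun E F = f].

End kernels.

Section topological_kernels.
Variables (R : realType) (H : hilbertType R[i]).

Definition RKHS_continuous (X : topologicalType) (K : X -> X -> bop H) :=
  in_RKHS K `<=` [set f | continuous f].

Definition universal (X : topologicalType) (K : X -> X -> bop H) :=
  RKHS_continuous K /\
  forall (A : set X) (g : X -> H) (e : R),
    compact A -> {within A, continuous g} -> 0 < e ->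
    exists2 f, in_RKHS K f &
      (ereal_sup [set (nrm (f x - g x))%:E | x in A] < e%:E)%E.

Variable X : ptopologicalType.
Implicit Type K : X -> X -> bop H.

(* y |-> \int K(x, y) d eta(x) *)
Definition kernel_mean K (eta : set (borel X) -> H) (y : X) : H :=
  xget 0 [set u | forall v, inner v u = pairing (fun x : borel X => K x y v) eta].

Definition integrally_strictly_pd K :=
  [/\ bounded_kernel K, pd_kernel K, RKHS_continuous K &
      forall eta : set (borel X) -> H, radon_vector_measure eta ->
        (exists2 A, measurable A & eta A != 0) ->
        0 < pairing (kernel_mean K eta : borel X -> H) eta].

End topological_kernels.

(* Scalar kernels are operator valued kernels over the Hilbert space R[i]. *)
Definition scalar_kernel (R : realType) (X : Type) (k : X -> X -> R[i]) :
  X -> X -> bop R[i] := fun x y => mulop (k x y).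

Section mixture.
Variables (R : realType) (H : hilbertType R[i]) (X : Type).

Definition proj_kernel (P : X -> X -> bop H) (v : H) : X -> X -> bop R[i] :=
  scalar_kernel (fun x y => inner (P x y v) v).

Variable Omega : ptopologicalType.

(* With d Lambda = G d lambda, this is \int_Omega p_w(x, y) d Lambda(w). *)
Definition mixture (p : Omega -> X -> X -> R[i])
    (lam : {finite_measure set (borel Omega) -> \bar R}) (G : Omega -> bop H) :
    X -> X -> bop H :=
  fun x y => bochner_integral lam
    (fun w : borel Omega => p w x y *: G w).

End mixture.

(* Main.v *)
From HB Require Import structures.
Require Import Defs.
From mathcomp Require Import all_boot all_order all_algebra.
From mathcomp Require Import sesquilinear complex spectral finmap ring lra.
From mathcomp Require Import all_classical all_reals all_analysis measurable_realfun.

Set Implicit Arguments.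
Unset Strict Implicit.
Unset Printing Implicit Defensive.

Import Order.TTheory GRing.Theory Num.Def Num.Theory.
Import numFieldNormedType.Exports.
Local Open Scope classical_set_scope.
Local Open Scope ring_scope.
Local Open Scope complex_scope.

(** The three equivalences hinge on the operator [Lam Omega].

    For a Borel set [A] of parameters let [P_A(x, y)] be the integral of [p_w(x, y)] over
    [A] against [Lam] ([mixture_on]). By regularity [Lam] lives, up to a small error, on a
    compact set of parameters, where [P_A] is approximated by finite sums of kernels
    [p_(w_k) Lam(D_k)]. A scalar positive definite kernel times a positive semidefinite
    operator is positive definite by the Schur product theorem ([schur_kernel]), so every
    [P_A] is positive definite ([mixture_on_pd]), and [P] is the sum of the positive
    definite kernels [P_A] and [P_(Omega minus A)]. The same uniformity on compact sets
    gives the continuity of [P], and hence of the functions of its space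
    ([mixture_on_continuous], [bounded_continuous_RKHS]).

    Necessity. If [<Lam(Omega) v, v> = 0], then [Lam(A) v = 0] for all [A] and so
    [P(x, y) v = 0] ([mixture_on_null]). But each of the three properties forbids
    [<K(x, x) v, v> = 0] for [v != 0]: take the one point configuration [x], approximate the
    constant [v] at [x], or use the Dirac measure at [x] with value [v]
    ([strictly_pd_diag], [universal_diag], [integrally_spd_diag]).

    Sufficiency for universality ([mixture_universal]). A continuous function with values
    in [H] is close to a sum of functions [f v] with [f] scalar, and [v] is close to some
    [Lam(Omega) u] because a positive definite operator has dense range. Near each parameter
    one combination of sections of [p_w] approximates [f]; integrating these combinations
    over a partition of the parameters against [Lam u] approximates [f Lam(Omega) u]. The
    result lies in the space of [P], since [P_A] is dominated by [P].

    Sufficiency for the two strict properties ([mixture_vanishing]). The quadratic form of a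
    kernel at given points and vectors [v_i], and its double integral against a vector
    measure [eta], are real linear functionals [Q] of the kernel, nonnegative on positive
    definite kernels and nearly concentrated on a compact set ([kernel_functional]). If
    [Q(P) = 0], then [Q(P_A) = 0] for all [A]. Almost every parameter [w] is a density point
    of [G], with sets [A] close to [w] for which [P_A] divided by [lam A] is close to
    [p_w G(w)]; so [Q(p_w G(w)) = 0]. For [a = G(w) u], a multiple of the operator [G(w)]
    dominates the rank one operator [v |-> <v, a> a], so [Q] also vanishes at the product of
    [p_w] with this operator. There [Q] is the functional of the scalar kernel [p_w] with
    data [<v_i, a>] or [<eta, a>], and strictness of [p_w] makes these data vanish. Thus
    [G(w)] kills every [v_i], or every [eta(A)], for almost all [w]; so does [Lam(Omega)],
    and positive definiteness of [Lam(Omega)] gives the conclusion.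

    Projections. [P_v] is the mixture of the same kernels [p_w] for the scalar measure
    [<Lam v, v>] ([proj_kernelE]), so the equivalences above, over [H] and over the complex
    numbers, yield all the stated ones.

    Three kinds of integral occur: Bochner integrals, pairings with a vector measure, and
    integrals of scalar functions against [Lam]. All are integrals of vector valued functions
    against an additive set function whose values are linear maps ([is_int]). The reproducing
    kernel Hilbert space is built as the dual of the span of the sections
    ([canonical_RKHS]), which makes membership a norm estimate ([in_RKHS_bound]). *)

(** * Norms *)

Section norm_toolkit.
Variables (R : realType) (V : normedModType R[i]).
Implicit Types (x y z : V).

Lemma nrmN x : nrm (- x) = nrm x.
Proof. by rewrite /nrm normrN. Qed.

Lemma nrmBC x y : nrm (x - y) = nrm (y - x).
Proof. by rewrite -nrmN opprB. Qed.

Lemma nrm_gt0 x : x != 0 -> 0 < nrm x.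
Proof.
by move=> x0; rewrite lt_def nrm_ge0 andbT; apply: contra x0 => /eqP/nrm0_eq0/eqP.
Qed.

Lemma nrm_triangle y x z : nrm (x - z) <= nrm (x - y) + nrm (y - z).
Proof. by rewrite (le_trans _ (nrm_normD _ _))// addrA subrK. Qed.

Lemma nrm_leD x y : nrm x <= nrm (x - y) + nrm y.
Proof. by rewrite (le_trans _ (nrm_normD _ _))// subrK. Qed.

Lemma nrm_dist_abs x y : `|nrm x - nrm y| <= nrm (x - y).
Proof.
rewrite ler_norml lerBlDr; apply/andP; split; last exact: nrm_leD.
by rewrite lerBrDr addrC lerBlDr addrC nrmBC nrm_leD.
Qed.

Lemma nrm_sum (I : Type) (r : seq I) (P : pred I) (F : I -> V) :
  nrm (\sum_(i <- r | P i) F i) <= \sum_(i <- r | P i) nrm (F i).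
Proof.
elim/big_ind2 : _ => //; first by rewrite nrm0.
by move=> x a y b xa yb; rewrite (le_trans (nrm_normD _ _))// lerD.
Qed.

Lemma nrmZr (a : R) x : 0 <= a -> nrm (a%:C *: x) = a * nrm x.
Proof.
move=> a0; rewrite nrmZ; congr (_ * _).
by apply: complexI; rewrite nrmE ger0_norm// ler0c.
Qed.

Lemma ltc_nrm (e : R) x : (`|x| < e%:C) = (nrm x < e).
Proof. by rewrite -nrmE ltcR. Qed.

Lemma cvg_nrmP (T : Type) (F : set_system T) (FF : Filter F) (f : T -> V) (a : V) :
  f @ F --> a <-> forall e : R, 0 < e -> \forall t \near F, nrm (a - f t) < e.
Proof.
split=> [/cvgrPdist_lt Fa e e0|Fa].
  by apply: filterS (Fa e%:C _) => [t|]; rewrite ?ltc_nrm// ltcR.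
apply/cvgrPdist_lt => e e0.
have eR : (complex.Re e)%:C = e by rewrite RRe_real// realE ltW.
by rewrite -eR; apply: filterS (Fa (complex.Re e) _) => [t|]; rewrite ?ltc_nrm// -ltcR eR.
Qed.

Lemma cvg_nrm_le (T : Type) (F : set_system T) (FF : Filter F) (f : T -> V)
    (a : V) (g : T -> R) :
  (forall t, nrm (a - f t) <= g t) -> g @ F --> (0 : R) -> f @ F --> a.
Proof.
move=> ag /cvgrPdist_lt g0; apply/cvg_nrmP => e e0.
apply: filterS (g0 e e0) => t; rewrite sub0r normrN.
by move=> /(le_lt_trans (ler_norm _)); exact: le_lt_trans.
Qed.

Lemma cvg_nrm (T : Type) (F : set_system T) (FF : Filter F) (f : T -> V) (a : V) :
  f @ F --> a -> nrm (f t) @[t --> F] --> nrm a.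
Proof.
move=> /cvg_nrmP fa; apply/cvgrPdist_lt => e e0.
by apply: filterS (fa e e0) => t; exact/le_lt_trans/nrm_dist_abs.
Qed.

Lemma cvg_dist0 (T : Type) (F : set_system T) (FF : Filter F) (f : T -> V) (a : V) :
  f @ F --> a -> nrm (a - f t) @[t --> F] --> (0 : R).
Proof.
move=> /cvg_nrmP fa; apply/cvgrPdist_lt => e e0.
by apply: filterS (fa e e0) => t; rewrite sub0r normrN ger0_norm// nrm_ge0.
Qed.

Lemma nrm_eq0_small x : (forall e : R, 0 < e -> nrm x <= e) -> x = 0.
Proof.
move=> xe; apply: nrm0_eq0; apply/eqP; rewrite eq_le nrm_ge0 andbT.
by apply/ler_addgt0Pl => e e0; rewrite addr0 xe.
Qed.

Lemma nrm_cvg_le (T : Type) (F : set_system T) (FF : ProperFilter F) (f : T -> V)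
    (a b : V) (e : R) :
  f @ F --> a -> (\forall t \near F, nrm (b - f t) <= e) -> nrm (b - a) <= e.
Proof.
move=> /cvg_nrmP fa fe; apply/ler_addgt0Pl => d d0.
have [t [/= fat fet]] := filter_ex (filterI (fa d d0) fe).
rewrite (le_trans (nrm_triangle (f t) _ _))// addrC lerD// nrmBC; exact: ltW.
Qed.

End norm_toolkit.

Section scalar_norm.
Variable R : realType.
Implicit Types z : R[i].

Lemma nrm_normc z : (nrm z)%:C = `|z|. Proof. exact: nrmE. Qed.

Lemma nrmM z1 z2 : nrm (z1 * z2) = nrm z1 * nrm z2.
Proof. exact: (@nrmZ R R[i]). Qed.

Lemma nrm_real (a : R) : nrm (a%:C : R[i]) = `|a|.
Proof. by apply: complexI; rewrite nrm_normc normc_def/= expr0n addr0 sqrtr_sqr. Qed.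

Lemma nrm_conj z : nrm (Num.conj z) = nrm z.
Proof. by apply: complexI; rewrite !nrm_normc norm_conjC. Qed.

Lemma Re_le_nrm z : complex.Re z <= nrm z.
Proof.
rewrite -lecR nrm_normc (le_trans _ (normc_ge_Re z))// lecR; exact: ler_norm.
Qed.

Lemma Re_abs_nrm z : `|complex.Re z| <= nrm z.
Proof. by rewrite -lecR nrm_normc normc_ge_Re. Qed.

Lemma Im_abs_nrm z : `|complex.Im z| <= nrm z.
Proof.
rewrite -lecR nrm_normc normc_def lecR -sqrtr_sqr ler_wsqrtr// lerDr sqr_ge0//.
Qed.

Lemma nrm_sqr z : (nrm z ^+ 2)%:C = z * Num.conj z.
Proof. by rewrite rmorphXn/= nrm_normc normCK. Qed.

Lemma ge0_Re z : 0 <= z -> z = (complex.Re z)%:C.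
Proof. by move=> z0; rewrite RRe_real// realE z0. Qed.

Lemma ReE_mulr (a : R) z : complex.Re (a%:C * z) = a * complex.Re z.
Proof. by case: z => x y /=; rewrite mul0r subr0. Qed.

End scalar_norm.

(** * Hilbert spaces: Cauchy-Schwarz, Riesz representation, dense ranges *)

Section hilbert_toolkit.
Variables (R : realType) (H : hilbertType R[i]).
Implicit Types x y z : H.
Local Notation C := R[i].

Lemma innerDl x y z : inner (x + y) z = inner x z + inner y z.
Proof. exact: (linearDl inner). Qed.
Lemma innerDr x y z : inner x (y + z) = inner x y + inner x z.
Proof. exact: (linearDr inner). Qed.
Lemma innerNl x z : inner (- x) z = - inner x z.
Proof. exact: (linearNl inner). Qed.
Lemma innerNr x z : inner x (- z) = - inner x z.
Proof. exact: (linearNr inner). Qed.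
Lemma innerBl x y z : inner (x - y) z = inner x z - inner y z.
Proof. by rewrite innerDl innerNl. Qed.
Lemma innerBr x y z : inner x (y - z) = inner x y - inner x z.
Proof. by rewrite innerDr innerNr. Qed.
Lemma innerZl (a : C) x z : inner (a *: x) z = a * inner x z.
Proof. exact: (linearZl_LR inner). Qed.
Lemma innerZr (a : C) x z : inner x (a *: z) = Num.conj a * inner x z.
Proof. exact: (linearZr_LR inner). Qed.
Lemma inner0l z : inner (0 : H) z = 0. Proof. exact: (linear0l inner). Qed.
Lemma inner0r z : inner z (0 : H) = 0. Proof. exact: (linear0r inner). Qed.
Lemma innerC x y : inner x y = Num.conj (inner y x).
Proof. by rewrite [LHS](hermC inner) expr0 mul1r. Qed.
Lemma inner_suml (I : Type) (r : seq I) (P : pred I) (F : I -> H) z :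
  inner (\sum_(i <- r | P i) F i) z = \sum_(i <- r | P i) inner (F i) z.
Proof. exact: (linear_sumlz inner). Qed.
Lemma inner_sumr (I : Type) (r : seq I) (P : pred I) (F : I -> H) z :
  inner z (\sum_(i <- r | P i) F i) = \sum_(i <- r | P i) inner z (F i).
Proof. exact: (linear_sumr inner). Qed.
Lemma inner_nrm x : inner x x = (nrm x ^+ 2)%:C.
Proof. by rewrite -inner_norm rmorphXn/= nrmE. Qed.
Lemma inner_ge0 x : 0 <= inner x x.
Proof. by rewrite inner_nrm ler0c sqr_ge0. Qed.
Lemma inner_eq0 x : inner x x = 0 -> x = 0.
Proof.
by rewrite inner_nrm => /complexI/eqP; rewrite sqrf_eq0 => /eqP/nrm0_eq0.
Qed.

End hilbert_toolkit.

(** The right-hand side of the hypothesis is least at [x = 1 / q]. *)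
Lemma quad_nonneg (R : realType) (m q e : R) : 0 <= m -> 0 <= q -> 0 <= e ->
  (forall x : R, 0 <= x ^+ 2 * m * q - 2 * x * m + e) -> m <= e * q.
Proof.
move=> m0 q0 e0 h.
have [qe|q_neq0] := eqVneq q 0.
  rewrite qe mulr0; case: (leP m 0) => // mgt0.
  have := h ((e + 1) / m); rewrite qe mulr0 sub0r.
  by rewrite -mulrA divfK ?gt_eqF//; lra.
have qgt0 : 0 < q by rewrite lt_def q_neq0.
have := h (q^-1); rewrite -mulrA expr2.
have -> : q^-1 * q^-1 * (m * q) - 2 * q^-1 * m + e = e - m / q by field.
by rewrite subr_ge0 ler_pdivrMr.
Qed.

(** Only the operation [comb a s t = a s + t] of the space [V] matters below, so that
    [V] can be a Hilbert space as well as a type of finite formal sums on which no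
    linear structure is defined. *)
Section sesquilinear_form.
Variables (R : realType) (V : Type).
Local Notation C := R[i].
Variables (comb : C -> V -> V -> V) (B : V -> V -> C).
Hypothesis Bl : forall a s t u, B (comb a s t) u = a * B s u + B t u.
Hypothesis B0 : forall s, 0 <= B s s.
Hypothesis Bh : forall s t, B s t = Num.conj (B t s).
Let q s := complex.Re (B s s).

Let q_ge0 s : 0 <= q s.
Proof. by rewrite -ler0c -ge0_Re. Qed.

Let q_comb a s t :
  q (comb a s t) = nrm a ^+ 2 * q s + 2 * complex.Re (a * B s t) + q t.
Proof.
rewrite /q Bl [B s (comb _ _ _)]Bh [B t (comb _ _ _)]Bh !Bl.
rewrite !rmorphD !rmorphM/= -!Bh mulrDr mulrA -nrm_sqr.
rewrite !raddfD/= ReE_mulr -!addrA; congr (_ + _).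
rewrite addrA; congr (_ + _).
rewrite [B t s]Bh -rmorphM/= mulrC.
by case: (B s t * a) => x y; rewrite /= mulrDl mul1r.
Qed.

Let q_opt (x : R) (D : C) :
  complex.Re (- x%:C * Num.conj D * D) = - (x * nrm D ^+ 2).
Proof. by rewrite !mulNr raddfN/= -mulrA [_ * D]mulrC -nrm_sqr ReE_mulr. Qed.

Let nrm_opt (x : R) (D : C) : nrm (- x%:C * Num.conj D) ^+ 2 = x ^+ 2 * nrm D ^+ 2.
Proof.
by rewrite nrmM nrmN nrm_real nrm_conj exprMn real_normK// num_real.
Qed.

(** The usual step size [B s t / B t t] is unavailable when [B t t = 0]; [quad_nonneg]
    covers this case. *)
Lemma form_cauchy_schwarz s t : nrm (B s t) ^+ 2 <= complex.Re (B s s) * complex.Re (B t t).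
Proof.
rewrite [leRHS]mulrC; apply: quad_nonneg; rewrite ?sqr_ge0 ?q_ge0// => x.
have := q_ge0 (comb (- x%:C * Num.conj (B s t)) s t).
rewrite q_comb nrm_opt q_opt//; rewrite -/(q s) -/(q t); lra.
Qed.

(** Minimise the energy [B u u - 2 Re (L u)]; the infimum need not be attained, whence
    the error [e]. *)
Lemma form_approx_riesz (L : V -> C) (c : R) (v0 : V) :
  (forall a s t, L (comb a s t) = a * L s + L t) ->
  (forall s, nrm (L s) ^+ 2 <= c * complex.Re (B s s)) ->
  forall e : R, 0 < e -> exists u, forall s,
    nrm (L s - B s u) ^+ 2 <= e * complex.Re (B s s).
Proof.
move=> Ll Lc e e0; pose J u := q u - 2 * complex.Re (L u).
have JB u : - `|c| <= J u.
  rewrite /J; have := Lc u; rewrite -/(q u) => Lcu.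
  have h1 : nrm (L u) ^+ 2 <= `|c| * q u.
    by rewrite (le_trans Lcu)// ler_wpM2r// ?q_ge0// ler_norm.
  have h2 := Re_le_nrm (L u).
  have h3 := q_ge0 u; have h4 := normr_ge0 c; have h5 := nrm_ge0 (L u).
  suff : 2 * nrm (L u) <= `|c| + q u by lra.
  rewrite -(@ler_pXn2r _ 2) ?nnegrE//; last 2 first.
    by rewrite mulr_ge0.
    by rewrite addr_ge0.
  have := sqr_ge0 (`|c| - q u); rewrite !expr2 in h1 *; nra.
have hi : has_inf (range J).
  by split; [exists (J v0), v0|exists (- `|c|) => _ [u _ <-]].
have [_ [u _ <-] Ju] := inf_adherent e0 hi.
(* An [e]-minimiser satisfies the Euler equation of the energy up to [e]. *)
exists u => s; apply: quad_nonneg; rewrite ?sqr_ge0 ?q_ge0// ?ltW// => x.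
rewrite nrmBC; set E := B s u - L s.
have JJ : J u - e <= J (comb (- x%:C * Num.conj E) s u).
  rewrite lerBlDr (le_trans (ltW Ju))// lerD2r.
  by apply: ge_inf; [case: hi|exists (comb (- x%:C * Num.conj E) s u)].
have BsuE : B s u = E + L s by rewrite /E subrK.
clearbody E; move: JJ; rewrite /J q_comb Ll nrm_opt BsuE.
rewrite mulrDr !raddfD/= q_opt//; lra.
Qed.

End sesquilinear_form.

Section hilbert_theorems.
Variables (R : realType) (H : hilbertType R[i]).
Local Notation C := R[i].

Lemma cauchy_schwarz (x y : H) : nrm (inner x y) <= nrm x * nrm y.
Proof.
rewrite -(@ler_pXn2r _ 2) ?nnegrE ?mulr_ge0 ?nrm_ge0// exprMn.
have := @form_cauchy_schwarz R H (fun a x y => a *: x + y) (@inner _ H).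
rewrite -/(is_true _) => /(_ _ _ _ x y); rewrite !inner_nrm/=; apply.
- by move=> a s t u; rewrite innerDl innerZl.
- exact: inner_ge0.
- exact: innerC.
Qed.

Lemma nrm_le_inner (x : H) (c : R) : 0 <= c ->
  (forall y, nrm (inner y x) <= c * nrm y) -> nrm x <= c.
Proof.
move=> c0 h; have := h x; rewrite inner_nrm nrm_real ger0_norm ?sqr_ge0// expr2.
have [->|x0] := eqVneq (nrm x) 0 => //.
by rewrite ler_pM2r// lt_def x0 nrm_ge0.
Qed.

Lemma inner_cvgr (T : Type) (F : set_system T) (FF : Filter F) (f : T -> H)
    (a x : H) : f @ F --> a -> inner x (f t) @[t --> F] --> (inner x a : C).
Proof.
move=> /cvg_dist0 fa; apply: (@cvg_nrm_le R C _ F FF _ _ (fun t => nrm x * nrm (a - f t))).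
  by move=> t; rewrite -innerBr cauchy_schwarz.
by rewrite -(mulr0 (nrm x)); exact: cvgMr.
Qed.

Lemma inner_cvgl (T : Type) (F : set_system T) (FF : Filter F) (f : T -> H)
    (a x : H) : f @ F --> a -> inner (f t) x @[t --> F] --> (inner a x : C).
Proof.
move=> /cvg_dist0 fa; apply: (@cvg_nrm_le R C _ F FF _ _ (fun t => nrm (a - f t) * nrm x)).
  by move=> t; rewrite -innerBl cauchy_schwarz.
by rewrite -(mul0r (nrm x)); exact: cvgMl.
Qed.

End hilbert_theorems.

Lemma harmonic_small (R : realType) (e : R) : 0 < e ->
  \forall n \near \oo, (n.+1%:R^-1 : R) < e.
Proof.
move=> e0; have /cvgrPdist_lt/(_ e e0) := @cvg_harmonic R.
by apply: filterS => n; rewrite sub0r normrN /harmonic/= ger0_norm ?invr_ge0//.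
Qed.

Lemma ex_harmonic_small (R : realType) (e : R) : 0 < e ->
  exists n, (n.+1%:R^-1 : R) < e.
Proof.
by move=> /harmonic_small h; have [n] := filter_ex h; exists n.
Qed.

Lemma cauchy_seq_cvg (R : realType) (V : completeNormedModType R[i])
    (u : nat -> V) (e : nat -> R) :
  (forall n m, nrm (u n - u m) <= e n + e m) -> e @ \oo --> (0 : R) ->
  cvgn u.
Proof.
move=> ue e0; apply/cauchy_cvgP/cauchy_ballP => d d0.
have dR : (complex.Re d)%:C = d by rewrite RRe_real// realE ltW.
have d20 : 0 < complex.Re d / 2 by rewrite divr_gt0// -ltcR dR.
move/cvgrPdist_lt : e0 => /(_ _ d20) [N _ Ne].
exists (u @` [set n | (N <= n)%N], u @` [set n | (N <= n)%N]) => /=.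
  by split; exists N => // n Nn; exists n.
move=> [_ _] /= [[n Nn <-] [m Nm <-]]; rewrite -ball_normE /=.
rewrite -[d]dR ltc_nrm (le_lt_trans (ue _ _))//.
rewrite [ltRHS](splitr) ltrD//.
  by have := Ne n Nn; rewrite /= sub0r normrN; exact/le_lt_trans/ler_norm.
by have := Ne m Nm; rewrite /= sub0r normrN; exact/le_lt_trans/ler_norm.
Qed.

Section riesz.
Variables (R : realType) (H : hilbertType R[i]).
Local Notation C := R[i].

(** The approximate representers of [form_approx_riesz] form a Cauchy sequence. *)
Theorem riesz (L : H -> C) (c : R) :
  (forall a x y, L (a *: x + y) = a * L x + L y) ->
  (forall x, nrm (L x) <= c * nrm x) -> exists y, forall x, L x = inner x y.
Proof.
move=> Ll Lc.
have h n : exists u, forall s, nrm (L s - inner s u) <= n.+1%:R^-1 * nrm s.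
  have := @form_approx_riesz R H (fun a x y => a *: x + y) (@inner _ H).
  case/(_ _ _ _ L (c ^+ 2) 0 Ll _ (n.+1%:R^-1 ^+ 2)).
  - by move=> a s t u; rewrite innerDl innerZl.
  - exact: inner_ge0.
  - exact: innerC.
  - move=> s; rewrite inner_nrm/= -exprMn lerXn2r// ?nnegrE ?nrm_ge0//.
    by rewrite (le_trans _ (Lc s))// nrm_ge0.
  - by rewrite exprn_gt0// invr_gt0.
  - move=> u hu; exists u => s; have := hu s; rewrite inner_nrm/= -exprMn.
    by rewrite ler_pXn2r// ?nnegrE ?mulr_ge0 ?nrm_ge0.
have [u hu] := choice h.
have cu : cvgn u.
  apply: (@cauchy_seq_cvg R H u (fun n => n.+1%:R^-1)); last exact: cvg_harmonic.
  move=> n m; apply: nrm_le_inner => [|y]; first by rewrite addr_ge0.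
  rewrite innerBr mulrDl (le_trans (nrm_triangle (L y) _ _))//.
  by rewrite lerD// nrmBC hu.
exists (limn u) => x; apply/eqP; rewrite -subr_eq0; apply/eqP/nrm_eq0_small => e e0.
apply: (@nrm_cvg_le R C _ \oo _ (fun n => inner x (u n))); first exact: inner_cvgr.
have [x0|x0] := eqVneq x 0.
  by near=> n; rewrite (le_trans (hu n x))// x0 nrm0 mulr0 ltW.
near=> n; rewrite (le_trans (hu n x))// -ler_pdivlMr ?nrm_gt0// ltW//.
by near: n; apply: harmonic_small; rewrite divr_gt0// nrm_gt0.
Unshelve. all: by end_near. Qed.

(** The orthogonal projection of [v] onto the closure of the range is the limit of the
    approximate Riesz representers for the form [<T s, T t>]. What it misses of [v] is
    orthogonal to its own image under [T], hence 0. *)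
Lemma pd_op_dense_range (T : bop H) : pd_op T -> forall v (e : R), 0 < e ->
  exists u, nrm (v - T u) < e.
Proof.
move=> Tpd v e e0.
have h n : exists u, forall s,
    nrm (inner (T s) v - inner (T s) (T u)) <= n.+1%:R^-1 * nrm (T s).
  have := @form_approx_riesz R H (fun a x y => a *: x + y)
    (fun s t => inner (T s) (T t)).
  case/(_ _ _ _ (fun s => inner (T s) v) (nrm v ^+ 2) 0 _ _ (n.+1%:R^-1 ^+ 2)).
  - by move=> a s t u; rewrite linearP innerDl innerZl.
  - by move=> s; exact: inner_ge0.
  - by move=> s t; exact: innerC.
  - by move=> a s t; rewrite linearP innerDl innerZl.
  - move=> s; rewrite inner_nrm/= -exprMn lerXn2r// ?nnegrE ?mulr_ge0 ?nrm_ge0//.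
    by rewrite mulrC cauchy_schwarz.
  - by rewrite exprn_gt0// invr_gt0.
  - move=> u hu; exists u => s; have := hu s; rewrite inner_nrm/= -exprMn.
    by rewrite ler_pXn2r// ?nnegrE ?mulr_ge0 ?nrm_ge0.
have [u hu] := choice h.
have cu : cvgn (fun n => T (u n)).
  apply: (@cauchy_seq_cvg R H _ (fun n => n.+1%:R^-1)); last exact: cvg_harmonic.
  move=> n m; set w := T (u n) - T (u m).
  have wT : w = T (u n - u m) by rewrite linearB.
  have : nrm w ^+ 2 <= (n.+1%:R^-1 + m.+1%:R^-1) * nrm w.
    rewrite -[leLHS]ger0_norm ?sqr_ge0// -nrm_real -inner_nrm {2}/w innerBr.
    rewrite mulrDl (le_trans (nrm_triangle (inner w v) _ _))//.
    by rewrite lerD// wT// nrmBC hu.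
  have [->|w0] := eqVneq (nrm w) 0; first by rewrite addr_ge0.
  by rewrite expr2 ler_pM2r// lt_def w0 nrm_ge0.
set z := limn (fun n => T (u n)).
have zE s : inner (T s) (v - z) = 0.
  rewrite innerBr; apply/nrm_eq0_small => d d0.
  apply: (@nrm_cvg_le R C _ \oo _ (fun n => inner (T s) (T (u n)))).
    exact: inner_cvgr.
  have [x0|x0] := eqVneq (T s) 0.
    by near=> n; rewrite (le_trans (hu n s))// x0 nrm0 mulr0 ltW.
  near=> n; rewrite (le_trans (hu n s))// -ler_pdivlMr ?nrm_gt0// ltW//.
  by near: n; apply: harmonic_small; rewrite divr_gt0// nrm_gt0.
have /eqP : v - z = 0.
  apply/eqP/negP => /negP /Tpd; by rewrite zE ltxx.
rewrite subr_eq0 => /eqP vz.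
move/cvg_nrmP : cu => /(_ e e0) cu; have [n un] := filter_ex cu.
by exists (u n); rewrite vz.
Unshelve. all: by end_near. Qed.

End riesz.

(** * Simple functions and additive operator valued set functions *)

Section finitely_valued.
Context d (T : measurableType d).

(** Simple functions with values in an arbitrary type, so that several functions can be
    read off one finite partition. *)
Definition finitely_valued (I : Type) (r : T -> I) :=
  finite_set (range r) /\ forall i, measurable (r @^-1` [set i]).

Lemma finitely_valued_preimage (I : Type) (r : T -> I) (S : set I) :
  finitely_valued r -> measurable (r @^-1` S).
Proof.
move=> [fr mr]; rewrite [X in measurable X](_ : _ = \bigcup_(i in range r `&` S) r @^-1` [set i]).
  by apply: fin_bigcup_measurable; [exact: finite_setIl|move=> i _; exact: mr].
by apply/seteqP; split=> [t St|t [i [_ Si] ti]]; [exists (r t)|rewrite /preimage/= ti].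
Qed.

Lemma finitely_valued_comp (I J : Type) (g : I -> J) (r : T -> I) :
  finitely_valued r -> finitely_valued (g \o r).
Proof.
move=> fr; split; last by move=> j; rewrite comp_preimage; exact: finitely_valued_preimage.
by rewrite -(image_comp r g); apply: finite_image; case: fr.
Qed.

Lemma finitely_valued_pair (I J : Type) (r : T -> I) (s : T -> J) :
  finitely_valued r -> finitely_valued s -> finitely_valued (fun t => (r t, s t)).
Proof.
move=> [fr mr] [fs ms]; split.
  apply: (@sub_finite_set _ _ (range r `*` range s)); last exact: finite_setX.
  by move=> _ [t _ <-]; split; exists t.
move=> [i j]; rewrite [X in measurable X](_ : _ = r @^-1` [set i] `&` s @^-1` [set j]).
  exact: measurableI.
by apply/seteqP; split=> [t [<- <-]|t [/= <- <-]].
Qed.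

Lemma finitely_valued_cst (I : Type) (i : I) : finitely_valued (fun _ : T => i).
Proof.
split; first by apply: (@sub_finite_set _ _ [set i]); [move=> _ [t _ <-]|exact: finite_set1].
move=> j; have [->|ij] := pselect (i = j).
  by rewrite preimage_cst mem_set//; exact: measurableT.
rewrite [X in measurable X](_ : _ = set0); first exact: measurable0.
by rewrite -subset0 => t /= /ij.
Qed.

Lemma finitely_valued_mem (A : set T) : measurable A ->
  finitely_valued (fun t => t \in A).
Proof.
move=> mA; split.
  by apply: (@sub_finite_set _ _ [set: bool]); last exact: finite_finset.
case.
  have -> : (fun t => t \in A) @^-1` [set true] = A; last by [].
  by apply/seteqP; split=> t /= => [/set_mem|/mem_set].
have -> : (fun t => t \in A) @^-1` [set false] = ~` A; last exact: measurableC.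
apply/seteqP; split=> t /= => [|At]; first by move/negbT/negP => h /mem_set.
by apply/negbTE/negP => /set_mem.
Qed.

Lemma finitely_valued_if (I : Type) (A : set T) (r s : T -> I) : measurable A ->
  finitely_valued r -> finitely_valued s ->
  finitely_valued (fun t => if t \in A then r t else s t).
Proof.
move=> mA fr fs.
exact: (@finitely_valued_comp _ _ (fun z : bool * (I * I) => if z.1 then z.2.1 else z.2.2)
  _ (finitely_valued_pair (finitely_valued_mem mA) (finitely_valued_pair fr fs))).
Qed.

Lemma finitely_valued_measurable (R : realType) (I : Type) (g : I -> R) (r : T -> I) :
  finitely_valued r -> measurable_fun setT (g \o r).
Proof.
by move=> fr _ Y mY; rewrite setTI comp_preimage; exact: finitely_valued_preimage.
Qed.

End finitely_valued.

(** Bochner integrals, the pairing with a vector measure and integrals against [Lam] are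
    all integrals of [B]-valued functions against an additive set function [Phi] whose
    values are linear maps from [B] to [B'] dominated by a scalar measure. *)
Section simple_integral.
Context d (T : measurableType d) (R : realType).
Variables (B B' : normedModType R[i]).

Definition simple_int (Phi : set T -> B -> B') (s : T -> B) : B' :=
  \sum_(b \in range s) Phi (s @^-1` [set b]) b.

Record additive_op (Phi : set T -> B -> B') : Prop := AdditiveOp {
  additive_op_linear : forall A, measurable A -> linear (Phi A) ;
  additive_opU : forall A A' b, measurable A -> measurable A' ->
    A `&` A' = set0 -> Phi (A `|` A') b = Phi A b + Phi A' b }.

Variables (Phi : set T -> B -> B') (addPhi : additive_op Phi).

Lemma additive_op0 b : Phi set0 b = 0.
Proof.
have := additive_opU addPhi b (@measurable0 _ T) (@measurable0 _ T) (setI0 _).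
by rewrite setU0 => /eqP; rewrite addrC -subr_eq subrr eq_sym => /eqP.
Qed.

Let Phi_zmod A : measurable A -> zmod_morphism (Phi A).
Proof. by move=> mA; exact/zmod_morphism_linear/(additive_op_linear addPhi). Qed.

Lemma additive_op_val0 A : measurable A -> Phi A 0 = 0.
Proof. by move=> /Phi_zmod h; have := h 0 0; rewrite !subrr. Qed.

Lemma additive_op_seq (I : choiceType) (r : T -> I) (E : seq I) A b :
  measurable A -> (forall i, measurable (r @^-1` [set i])) -> uniq E ->
  Phi (A `&` r @^-1` [set` E]) b = \sum_(i <- E) Phi (A `&` r @^-1` [set i]) b.
Proof.
move=> mA mr; elim: E => [_|i E ih /= /andP[iE uE]].
  rewrite big_nil (_ : _ `&` _ = set0) ?additive_op0//.
  by rewrite -subset0 => t [_] /=; rewrite in_nil.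
have mE : measurable (r @^-1` [set` E]).
  rewrite (_ : _ @^-1` _ = \big[setU/set0]_(j <- E) r @^-1` [set j]).
    by apply: bigsetU_measurable => j _; exact: mr.
  rewrite -bigcup_seq; by apply/seteqP; split=> [t /= rt|t [j /= jE ->//]]; exists (r t).
rewrite big_cons -ih// -additive_opU//; last 3 first.
- exact: measurableI.
- exact: measurableI.
- rewrite -subset0 => t [[_ /= ->] [_ /=]]; exact/negP.
rewrite -setIUr; congr (Phi (_ `&` _) _); apply/seteqP; split=> t /=.
  by rewrite in_cons => /orP[/eqP|]; [left|right].
by rewrite in_cons => -[->|->]; rewrite ?eqxx ?orbT.
Qed.

(** Summing over the finer partition [r] rather than over the values of [g o r] is what
    makes the integral of simple functions additive. *)
Lemma simple_int_factor (I : choiceType) (r : T -> I) (g : I -> B) :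
  finitely_valued r ->
  simple_int Phi (g \o r) = \sum_(i \in range r) Phi (r @^-1` [set i]) (g i).
Proof.
move=> fr; have [fr1 mr] := fr; have [fs1 ms] := finitely_valued_comp g fr.
rewrite /simple_int !fsbig_finite//=.
set S := fset_set (range (g \o r)); set E := fset_set (range r).
have rE t : r t \in E by rewrite in_fset_set// mem_set.
have gS i : i \in E -> g i \in S.
  by rewrite in_fset_set// => /set_mem[t _ <-]; rewrite in_fset_set// mem_set//; exists t.
transitivity (\sum_(b <- S) \sum_(i <- E) if g i == b then Phi (r @^-1` [set i]) (g i) else 0).
  apply: eq_bigr => b _.
  have -> : (g \o r) @^-1` [set b] = (g \o r) @^-1` [set b] `&` r @^-1` [set` E].
    by apply/seteqP; split=> [t /= gb|t []//]; split => //=.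
  rewrite additive_op_seq ?fset_uniq//.
  apply: eq_bigr => i _; case: eqP => [gb|gb].
    congr (Phi _ _); last by [].
    by apply/seteqP; split=> [t []//|t /= rt]; split => //=; rewrite rt.
  rewrite (_ : _ `&` _ = set0) ?additive_op0//.
  by rewrite -subset0 => t [/= gt rt]; apply: gb; rewrite -gt -rt.
rewrite exchange_big/=; apply: eq_big_seq => i iE.
rewrite (bigD1_seq (g i)) ?fset_uniq//=; last exact: gS.
rewrite eqxx big1 ?addr0// => b; rewrite eq_sym => /negbTE -> //.
Qed.

Lemma simple_intP a (s t : T -> B) : simple_fun s -> simple_fun t ->
  simple_int Phi (fun x => a *: s x + t x) = a *: simple_int Phi s + simple_int Phi t.
Proof.
move=> fs ft; have fst_ := finitely_valued_pair fs ft; have [fr mr] := fst_.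
rewrite (@simple_int_factor _ _ (fun z => a *: z.1 + z.2) fst_).
rewrite (@simple_int_factor _ _ (fun z : B * B => z.1) fst_).
rewrite (@simple_int_factor _ _ (fun z : B * B => z.2) fst_).
rewrite !fsbig_finite//= scaler_sumr -big_split/=; apply: eq_bigr => z _.
exact: (additive_op_linear addPhi).
Qed.

Lemma simple_intB (s t : T -> B) : simple_fun s -> simple_fun t ->
  simple_int Phi (fun x => s x - t x) = simple_int Phi s - simple_int Phi t.
Proof.
move=> fs ft; have := simple_intP (-1) ft fs; rewrite !scaleN1r addrC => <-.
by congr simple_int; apply/funext => x; rewrite scaleN1r addrC.
Qed.

End simple_integral.

Section simple_norm.
Context d (T : measurableType d) (R : realType).
Variables (mu : {finite_measure set T -> \bar R}).
Local Notation measure_fin := (fun A => fin_num_measure mu A).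

Lemma measure_fineK A : measurable A -> (fine (mu A))%:E = mu A.
Proof. by move=> mA; rewrite fineK// fin_num_measure. Qed.

Lemma integral_finitely_valued (I : choiceType) (r : T -> I) (g : I -> R) :
  finitely_valued r -> (forall i, 0 <= g i) ->
  (\int[mu]_t (g (r t))%:E = (\sum_(i \in range r) g i * fine (mu (r @^-1` [set i])))%:E)%E.
Proof.
move=> fr g0; have [fr1 mr] := fr.
rewrite fsbig_finite//=; set E := fset_set _.
transitivity (\int[mu]_t (\sum_(i <- E) (g i)%:E * (\1_(r @^-1` [set i]) t)%:E)%E)%E.
  apply: eq_integral => t _.
  have rE : r t \in E by rewrite in_fset_set// mem_set.
  rewrite (bigD1_seq (r t)) ?fset_uniq//= indicE mem_set//= mule1 big1 ?adde0// => i /eqP ri.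
  by rewrite indicE memNset ?mule0//= => /esym.
rewrite ge0_integral_sum//=; last 2 first.
- by move=> i; apply: measurable_funeM; exact/measurable_EFinP/measurable_indic.
- by move=> i t _; rewrite mule_ge0// lee_fin.
rewrite -sumEFin; apply: eq_bigr => i _.
rewrite ge0_integralZl_EFin//=; last exact/measurable_EFinP/measurable_indic.
rewrite integral_indic// setIT EFinM measure_fineK//.
Qed.

End simple_norm.

Section dominated_simple.
Context d (T : measurableType d) (R : realType).
Variables (mu : {finite_measure set T -> \bar R}).
Variables (B B' : normedModType R[i]).

Definition dominated_op (Phi : set T -> B -> B') := additive_op Phi /\
  forall A b, measurable A -> nrm (Phi A b) <= fine (mu A) * nrm b.

Lemma simple_int_le (Phi : set T -> B -> B') (s : T -> B) : dominated_op Phi ->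
  simple_fun s -> ((nrm (simple_int Phi s))%:E <= \int[mu]_t (nrm (s t))%:E)%E.
Proof.
move=> [_ dPhi] fs; rewrite (@integral_finitely_valued _ _ _ _ _ s)//; last first.
  by move=> i; exact: nrm_ge0.
have [fs1 ms] := fs; rewrite lee_fin /simple_int !fsbig_finite//=.
rewrite (le_trans (nrm_sum _ _ _))//; apply: ler_sum => b _.
by rewrite mulrC dPhi.
Qed.

Lemma bochner_dominated_op (B1 : normedModType R[i]) :
  @additive_op _ T R B1 B1 (fun A b => (fine (mu A))%:C *: b) /\
  forall A (b : B1), measurable A ->
    nrm ((fine (mu A))%:C *: b) <= fine (mu A) * nrm b.
Proof.
split; last by move=> A b mA; rewrite nrmZr// fine_ge0.
split=> [A mA a u v|A A' b mA mA' AA'].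
  by rewrite scalerDr !scalerA mulrC.
by rewrite measureU// fineD ?fin_num_measure// rmorphD scalerDl.
Qed.

End dominated_simple.

(** * Lower integrals and approximation by simple functions *)

Lemma ereal_small (R : realType) (e : nat -> \bar R) (d : R) :
  e @ \oo --> 0%E -> 0 < d -> \forall n \near \oo, (e n < d%:E)%E.
Proof.
move=> /fine_cvgP[ef /cvgrPdist_lt e0] d0; near=> n.
have fn : e n \is a fin_num by near: n.
rewrite -(fineK fn) lte_fin (le_lt_trans (ler_norm _))//.
rewrite -normrN -[X in `|X|]add0r; near: n; exact: e0.
Unshelve. all: by end_near. Qed.

Lemma cauchy_seq_cvgE (R : realType) (V : completeNormedModType R[i])
    (u : nat -> V) (e : nat -> \bar R) :
  (forall n m, ((nrm (u n - u m))%:E <= e n + e m)%E) -> e @ \oo --> 0%E ->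
  cvgn u.
Proof.
move=> ue e0; apply/cauchy_cvgP/cauchy_ballP => d d0.
have dR : (complex.Re d)%:C = d by rewrite RRe_real// realE ltW.
have d20 : 0 < complex.Re d / 2 by rewrite divr_gt0// -ltcR dR.
have [N _ Ne] := ereal_small e0 d20.
exists (u @` [set n | (N <= n)%N], u @` [set n | (N <= n)%N]) => /=.
  by split; exists N => // n Nn; exists n.
move=> [_ _] /= [[n Nn <-] [m Nm <-]]; rewrite -ball_normE /=.
rewrite -[d]dR ltc_nrm -lte_fin (le_lt_trans (ue _ _))//.
by rewrite [complex.Re d]splitr EFinD lteD// ; [exact: Ne|exact: Ne].
Qed.

Section lower_integral.
Context d (T : measurableType d) (R : realType).
Variables (mu : {measure set T -> \bar R}).
Import HBNNSimple.

(** The integral of a nonnegative function is a supremum over simple functions, so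
    it is monotone up to a null set even for nonmeasurable integrands. *)
Lemma lower_integral_ae_le (f g : T -> \bar R) (N : set T) :
  (forall t, 0 <= f t)%E -> (forall t, 0 <= g t)%E ->
  measurable N -> mu N = 0%E -> (forall t, ~ N t -> f t <= g t)%E ->
  (\int[mu]_t f t <= \int[mu]_t g t)%E.
Proof.
move=> f0 g0 mN muN fg.
rewrite !ge0_integralTE// ge_ereal_sup// => _ [h/= hf <-].
apply: le_ereal_sup_tmp.
pose h' := proj_nnsfun h (measurableC mN).
exists (sintegral mu h').
  exists h' => //= t; rewrite mindicE.
  have [|tN] := boolP (t \in ~` N); last by rewrite mulr0.
  by move=> /set_mem/= Nt; rewrite mulr1 (le_trans (hf t))// fg.
rewrite -!integralT_nnsfun le_eqVlt; apply/orP; left; apply/eqP.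
apply: ge0_ae_eq_integral => //.
- exact/measurable_EFinP.
- exact/measurable_EFinP.
- by move=> x _; rewrite lee_fin.
- by move=> x _; rewrite lee_fin.
- exists N; split => // t /= tN; apply: contrapT => Nt; apply: tN => _.
  by rewrite mindicE mem_set//= mulr1.
Qed.

(** The integral only sees the values of the measure on measurable sets. *)
Lemma eq_measure_lower_integral (m : set T -> \bar R) (f : T -> \bar R) :
  (forall A, measurable A -> m A = mu A) -> (\int[m]_t f t = \int[mu]_t f t)%E.
Proof.
move=> mmu; rewrite /integral.
have sE (h : {nnsfun T >-> R}) : sintegral m h = sintegral mu h.
  by apply: eq_fsbigr => x _; rewrite mmu.
by congr (ereal_sup _ - ereal_sup _)%E; apply/seteqP; split=> _ [h hf <-];
  exists h => //; rewrite sE.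
Qed.

(** The distance from an integrable function to a simple one is measurable in this sense
    only: the function itself is unrestricted on a null set. *)
Definition ae_measurable (u : T -> R) := exists N, [/\ measurable N, mu N = 0%E &
  measurable_fun setT (fun t => \1_(~` N) t * u t)].

Lemma measurable_ae_measurable u : measurable_fun setT u -> ae_measurable u.
Proof.
move=> mf; exists set0; split => //; rewrite setC0.
by apply: measurable_funM => //; exact: measurable_indic.
Qed.

(** The lower integral is subadditive as soon as the two majorants are measurable off a
    null set, whatever the function [h] below. *)
Lemma lower_integral_comb (a b : R) (u v h : T -> R) :
  0 <= a -> 0 <= b -> (forall t, 0 <= u t) -> (forall t, 0 <= v t) ->
  (forall t, 0 <= h t) -> ae_measurable u -> ae_measurable v ->
  (forall t, h t <= a * u t + b * v t) ->
  (\int[mu]_t (h t)%:E <= a%:E * \int[mu]_t (u t)%:E + b%:E * \int[mu]_t (v t)%:E)%E.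
Proof.
move=> a0 b0 u0 v0 h0 [N [mN N0 mu_]] [N' [mN' N'0 mv_]] huv.
pose M := N `|` N'; have mM : measurable M by exact: measurableU.
have M0 : mu M = 0%E by rewrite null_set_setU.
have CM (w : T -> R) K : K `<=` M -> (fun t => \1_(~` M) t * w t) =
    (fun t => \1_(~` M) t * (\1_(~` K) t * w t)).
  move=> KM; apply/funext => t; rewrite !indicE.
  have [tM|] := boolP (t \in ~` M); last by rewrite !mul0r.
  by rewrite mem_set ?mul1r//= => /KM; exact: (set_mem tM).
pose u' t := \1_(~` M) t * u t; pose v' t := \1_(~` M) t * v t.
have mu' : measurable_fun setT u'.
  rewrite /u' (CM _ N); last by move=> ?; left.
  by apply: measurable_funM => //; apply: measurable_indic; exact: measurableC.
have mv' : measurable_fun setT v'.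
  rewrite /v' (CM _ N'); last by move=> ?; right.
  by apply: measurable_funM => //; apply: measurable_indic; exact: measurableC.
have w'le (w : T -> R) t : 0 <= w t -> \1_(~` M) t * w t <= w t.
  by move=> w0; rewrite indicE; case: (_ \in _); rewrite ?mul1r// mul0r.
have w'ge0 (w : T -> R) t : 0 <= w t -> 0 <= \1_(~` M) t * w t.
  by move=> w0; rewrite mulr_ge0.
apply: (@le_trans _ _ (\int[mu]_t (a%:E * (u' t)%:E + b%:E * (v' t)%:E))%E).
  apply: (@lower_integral_ae_le _ _ M) => //.
  - by move=> t; rewrite adde_ge0// mule_ge0// lee_fin ?w'ge0.
  - by move=> t Mt; rewrite lee_fin /u' /v' indicE mem_set//= !mul1r.
rewrite ge0_integralD//=; last 4 first.
- by move=> t _; rewrite lee_fin mulr_ge0// w'ge0.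
- by apply: measurable_funeM; exact/measurable_EFinP.
- by move=> t _; rewrite lee_fin mulr_ge0// w'ge0.
- by apply: measurable_funeM; exact/measurable_EFinP.
rewrite !ge0_integralZl_EFin//=; last 4 first.
- by move=> t _; rewrite lee_fin w'ge0.
- exact/measurable_EFinP.
- by move=> t _; rewrite lee_fin w'ge0.
- exact/measurable_EFinP.
by apply: leeD; apply: lee_wpmul2l; rewrite ?lee_fin//;
  apply: (@lower_integral_ae_le _ _ set0) => // t; rewrite ?lee_fin ?w'ge0 ?w'le.
Qed.

Lemma lower_integral_le (u h : T -> R) : (forall t, 0 <= h t) ->
  (forall t, h t <= u t) -> (\int[mu]_t (h t)%:E <= \int[mu]_t (u t)%:E)%E.
Proof.
move=> h0 hu; apply: (@lower_integral_ae_le _ _ set0) => // t; rewrite lee_fin//.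
by rewrite (le_trans (h0 t)).
Qed.

Lemma lower_integralD (u v h : T -> R) :
  (forall t, 0 <= u t) -> (forall t, 0 <= v t) ->
  (forall t, 0 <= h t) -> ae_measurable u -> ae_measurable v ->
  (forall t, h t <= u t + v t) ->
  (\int[mu]_t (h t)%:E <= \int[mu]_t (u t)%:E + \int[mu]_t (v t)%:E)%E.
Proof.
move=> u0 v0 h0 mu_ mv huv.
have := lower_integral_comb ler01 ler01 u0 v0 h0 mu_ mv; rewrite !mul1e; apply.
by move=> t; rewrite !mul1r.
Qed.

End lower_integral.

Section L1_approximation.
Context d (T : measurableType d) (R : realType).
Variables (mu : {finite_measure set T -> \bar R}).
Variables (B : normedModType R[i]).
Implicit Types (f g : T -> B) (s t : (T -> B)^nat).

Lemma eq_measure_L1_approx (m : set T -> \bar R) f s :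
  (forall A, measurable A -> m A = mu A) -> L1_approx m f s <-> L1_approx mu f s.
Proof.
move=> mmu; rewrite /L1_approx.
have aeE (P : T -> Prop) : almost_everywhere m P <-> almost_everywhere mu P.
  by split=> -[N [mN N0 PN]]; exists N; split => //; rewrite -?mmu// mmu.
have iE : (fun n => \int[m]_t (nrm (f t - s n t))%:E)%E =
          (fun n => \int[mu]_t (nrm (f t - s n t))%:E)%E.
  by apply/funext => n; exact: eq_measure_lower_integral.
by rewrite iE; split=> -[? /aeE ? ?]; split.
Qed.

Lemma L1_approx_ae_measurable f s (b : T -> B) : finitely_valued b ->
  L1_approx mu f s -> ae_measurable mu (fun x => nrm (f x - b x)).
Proof.
move=> fb [fs [N [mN N0 Nf]] _]; exists N; split => //.
apply: (@measurable_fun_cvg _ _ _ _ (fun m x => \1_(~` N) x * nrm (s m x - b x))).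
  move=> m; apply: measurable_funM; first by apply: measurable_indic; exact: measurableC.
  exact: (@finitely_valued_measurable _ _ _ _ (fun z : B * B => nrm (z.1 - z.2)) _
    (finitely_valued_pair (fs m) fb)).
move=> x _; rewrite /= indicE; have [xN|xN] := boolP (x \in ~` N); last first.
  by under eq_fun do rewrite mul0r; rewrite mul0r; exact: cvg_cst.
under eq_fun do rewrite mul1r; rewrite mul1r.
apply: cvg_nrm; apply: cvgB; last exact: cvg_cst.
by apply: contrapT => /Nf; exact: (set_mem xN).
Qed.

Lemma L1_approx_comb f g s t (a : R[i]) : L1_approx mu f s -> L1_approx mu g t ->
  L1_approx mu (fun x => a *: f x + g x) (fun n x => a *: s n x + t n x).
Proof.
move=> fs gt; have [sf sf_ fs0] := fs; have [tg tg_ gt0] := gt; split.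
- move=> n; exact: (@finitely_valued_comp _ _ _ _ (fun z : B * B => a *: z.1 + z.2) _
    (finitely_valued_pair (sf n) (tg n))).
- apply: filterS2 sf_ tg_ => x sx tx.
  by apply: cvgD => //; apply: cvgZr.
- apply: (@squeeze_cvge _ _ _ _ (cst 0%E) _ (fun n => (nrm a)%:E *
      \int[mu]_x (nrm (f x - s n x))%:E + 1%:E * \int[mu]_x (nrm (g x - t n x))%:E)%E).
  + apply: nearW => n; rewrite integral_ge0 => [|x _]; last by rewrite lee_fin nrm_ge0.
    apply: lower_integral_comb => //.
    * exact: nrm_ge0.
    * by move=> x; exact: nrm_ge0.
    * by move=> x; exact: nrm_ge0.
    * by move=> x; exact: nrm_ge0.
    * exact: L1_approx_ae_measurable (sf n) fs.
    * exact: L1_approx_ae_measurable (tg n) gt.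
    * move=> x; rewrite mul1r -nrmZ (le_trans _ (nrm_normD _ _))//.
      by rewrite scalerBr opprD addrACA.
  + exact: cvg_cst.
  + rewrite -[0%E]adde0; apply: cvgeD => //.
      by rewrite -(mule0 (nrm a)%:E); exact: cvgeZl.
    by rewrite -(mule0 1%:E); exact: cvgeZl.
Qed.

Lemma L1_approx_simple (b : T -> B) : simple_fun b -> L1_approx mu b (fun=> b).
Proof.
move=> fs; split => //; first by apply: aeW => x; exact: cvg_cst.
rewrite (_ : (fun n => _) = cst 0%E); first exact: cvg_cst.
by apply/funext => n; rewrite integral0_eq// => x _; rewrite subrr nrm0.
Qed.

(** Dominated convergence for approximations by simple functions. *)
Lemma L1_approx_dominated f s (g : T -> R) :
  (forall n, simple_fun (s n)) -> (forall x, s ^~ x @ \oo --> f x) ->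
  mu.-integrable setT (EFin \o g) ->
  (forall n x, nrm (f x - s n x) <= g x) -> L1_approx mu f s.
Proof.
move=> fs sf ig fg; split => //; first by apply: aeW.
have mh n : measurable_fun setT (fun x => nrm (f x - s n x)).
  apply: (@measurable_fun_cvg _ _ _ _ (fun m x => nrm (s m x - s n x))).
    move=> m; exact: (@finitely_valued_measurable _ _ _ _ (fun z : B * B => nrm (z.1 - z.2)) _
      (finitely_valued_pair (fs m) (fs n))).
  by move=> x _; apply: cvg_nrm; apply: cvgB => //; exact: cvg_cst.
have [] := @dominated_convergence _ T R mu setT measurableT
  (fun n x => (nrm (f x - s n x))%:E) (cst 0%E) (EFin \o g).
- by move=> n; exact/measurable_EFinP.
- exact: measurable_cst.
- apply: aeW => x _; apply: cvg_EFin; first exact: nearW.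
  by apply: cvg_dist0.
- exact: ig.
- by apply: aeW => x n _; rewrite /= lee_fin ger0_norm ?nrm_ge0.
by move=> _ _; rewrite integral0.
Qed.

End L1_approximation.

(** * Integration against an additive operator valued set function *)

Section operator_integral.
Context d (T : measurableType d) (R : realType).

Definition is_int (B B' : normedModType R[i]) (m : set T -> \bar R)
    (Phi : set T -> B -> B') (f : T -> B) (I : B') :=
  exists2 s : (T -> B)^nat, L1_approx m f s &
    (fun n => simple_int Phi (s n)) @ \oo --> I.

(** Uniqueness, additivity and continuity of the integral all come from this comparison
    of two approximating sequences through [f] and [g]. *)
Lemma simple_int_dist (mu : {finite_measure set T -> \bar R})
    (B B' : normedModType R[i]) (Phi : set T -> B -> B') (f g : T -> B)
    (s t : (T -> B)^nat) n m :
  dominated_op mu Phi -> L1_approx mu f s -> L1_approx mu g t ->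
  ((nrm (simple_int Phi (s n) - simple_int Phi (t m)))%:E <=
   \int[mu]_x (nrm (f x - s n x))%:E + \int[mu]_x (nrm (g x - t m x))%:E +
   \int[mu]_x (nrm (f x - g x))%:E)%E.
Proof.
move=> dPhi fs gt; have [sf _ _] := fs; have [tg _ _] := gt.
rewrite -(simple_intB dPhi.1)//.
apply: le_trans (simple_int_le dPhi _) _.
  exact: (@finitely_valued_comp _ _ _ _ (fun z : B * B => z.1 - z.2) _
    (finitely_valued_pair (sf n) (tg m))).
have afg : ae_measurable mu (fun x => nrm (f x - g x)).
  have := L1_approx_ae_measurable (finitely_valued_cst T (0 : B)) (L1_approx_comb (-1) gt fs).
  rewrite (_ : (fun x => _) = (fun x => nrm (f x - g x)))//.
  by apply/funext => x; rewrite scaleN1r subr0 addrC.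
apply: (@le_trans _ _ ((\int[mu]_x (nrm (f x - s n x) + nrm (g x - t m x))%:E +
   \int[mu]_x (nrm (f x - g x))%:E))%E).
  apply: lower_integralD => //.
  - by move=> x; rewrite addr_ge0 ?nrm_ge0.
  - by move=> x; exact: nrm_ge0.
  - by move=> x; exact: nrm_ge0.
  - have [N [mN N0 mf]] := L1_approx_ae_measurable (sf n) fs.
    have [N' [mN' N'0 mg]] := L1_approx_ae_measurable (tg m) gt.
    exists (N `|` N'); split; first exact: measurableU.
      by rewrite null_set_setU.
    pose i := fun (K : set T) x => \1_(~` K) x : R.
    have -> : (fun x => \1_(~` (N `|` N')) x * (nrm (f x - s n x) + nrm (g x - t m x))) =
      (fun x => i N' x * (i N x * nrm (f x - s n x)) + i N x * (i N' x * nrm (g x - t m x))).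
      apply/funext => x; rewrite setCU indicI /i mulrDr.
      by congr (_ + _); rewrite mulrA//; congr (_ * _); rewrite mulrC.
    have mi K : measurable K -> measurable_fun setT (i K).
      by move=> mK; apply: measurable_indic; exact: measurableC.
    by apply: measurable_funD; apply: measurable_funM => //; exact: mi.
  - move=> x; rewrite (le_trans (nrm_triangle (f x) _ _))// -addrA lerD//.
      by rewrite nrmBC.
    by rewrite addrC (le_trans (nrm_triangle (g x) _ _)).
rewrite leeD2r//; apply: lower_integralD => //.
- by move=> x; exact: nrm_ge0.
- by move=> x; exact: nrm_ge0.
- by move=> x; rewrite addr_ge0 ?nrm_ge0.
- exact: L1_approx_ae_measurable (sf n) fs.
- exact: L1_approx_ae_measurable (tg m) gt.
Qed.

Variables (mu : {finite_measure set T -> \bar R}).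
Variables (B B' : normedModType R[i]) (Phi : set T -> B -> B').
Hypothesis dPhi : dominated_op mu Phi.
Implicit Types (f g : T -> B) (I J : B').

Let int_dist_self f : (\int[mu]_x (nrm (f x - f x))%:E = 0)%E.
Proof. by rewrite integral0_eq// => x _; rewrite subrr nrm0. Qed.

Lemma is_int_dist f g I J : is_int mu Phi f I -> is_int mu Phi g J ->
  ((nrm (I - J))%:E <= \int[mu]_x (nrm (f x - g x))%:E)%E.
Proof.
move=> [s fs sI] [t gt tJ]; apply/lee_addgt0Pr => e e0.
have e40 : 0 < e / 4 by lra.
have [_ _ fs0] := fs; have [_ _ gt0] := gt.
have [n [[[/= h1 h2] h3] h4]] := filter_ex (filterI (filterI (filterI
  (ereal_small fs0 e40) (ereal_small gt0 e40))
  ((cvg_nrmP _ _ _).1 sI _ e40)) ((cvg_nrmP _ _ _).1 tJ _ e40)).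
have h5 := simple_int_dist n n dPhi fs gt.
have : ((nrm (I - J))%:E <= (e / 4)%:E + (nrm (simple_int Phi (s n) - simple_int Phi (t n)))%:E
    + (e / 4)%:E)%E.
  rewrite -!EFinD lee_fin (le_trans (nrm_triangle (simple_int Phi (t n)) _ _))//.
  rewrite lerD//; last by rewrite nrmBC ltW.
  by rewrite (le_trans (nrm_triangle (simple_int Phi (s n)) _ _))// lerD2r ltW.
move=> /le_trans; apply.
apply: (@le_trans _ _ ((e / 4)%:E + ((e / 4)%:E + (e / 4)%:E +
   \int[mu]_x (nrm (f x - g x))%:E) + (e / 4)%:E)%E).
  rewrite leeD2r// leeD2l// (le_trans h5)// leeD2r//.
  by apply: leeD; exact: ltW.
case: (integral _ _ _) => [x||] //; rewrite -!EFinD lee_fin; lra.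
Qed.

Lemma is_int_unique f I J : is_int mu Phi f I -> is_int mu Phi f J -> I = J.
Proof.
move=> fI fJ; have := is_int_dist fI fJ; rewrite int_dist_self lee_fin => IJ.
apply/eqP; rewrite -subr_eq0; apply/eqP/nrm0_eq0/eqP.
by rewrite eq_le IJ nrm_ge0.
Qed.

Lemma is_int_simple (s : T -> B) : simple_fun s -> is_int mu Phi s (simple_int Phi s).
Proof. by move=> fs; exists (fun=> s); [exact: L1_approx_simple|exact: cvg_cst]. Qed.

Lemma is_intP (a : R[i]) f g I J : is_int mu Phi f I -> is_int mu Phi g J ->
  is_int mu Phi (fun x => a *: f x + g x) (a *: I + J).
Proof.
move=> [s fs sI] [t gt tJ]; exists (fun n x => a *: s n x + t n x).
  exact: L1_approx_comb.
rewrite (_ : (fun n => _) = (fun n => a *: simple_int Phi (s n) + simple_int Phi (t n))).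
  by apply: cvgD => //; exact: cvgZr.
by apply/funext => n; rewrite (simple_intP dPhi.1)//; [case: fs|case: gt].
Qed.

Lemma is_int0 : is_int mu Phi (fun=> 0) 0.
Proof.
have := is_int_simple (finitely_valued_cst T (0 : B)).
rewrite [simple_int _ _](_ : _ = 0)//.
have := simple_intB dPhi.1 (finitely_valued_cst T (0 : B)) (finitely_valued_cst T (0 : B)).
by rewrite !subrr.
Qed.

Lemma is_intZ (a : R[i]) f I : is_int mu Phi f I ->
  is_int mu Phi (fun x => a *: f x) (a *: I).
Proof.
move=> fI; have := is_intP a fI is_int0; rewrite addr0.
by rewrite (_ : (fun x => _) = (fun x => a *: f x))//; apply/funext => x; rewrite addr0.
Qed.

Lemma is_intD f g I J : is_int mu Phi f I -> is_int mu Phi g J ->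
  is_int mu Phi (fun x => f x + g x) (I + J).
Proof.
move=> fI gJ; have := is_intP 1 fI gJ; rewrite scale1r.
by rewrite (_ : (fun x => _) = (fun x => f x + g x))//; apply/funext => x; rewrite scale1r.
Qed.

Lemma is_intB f g I J : is_int mu Phi f I -> is_int mu Phi g J ->
  is_int mu Phi (fun x => f x - g x) (I - J).
Proof.
move=> fI gJ; have := is_intP (-1) gJ fI; rewrite scaleN1r addrC.
by rewrite (_ : (fun x => _) = (fun x => f x - g x))//; apply/funext => x; rewrite scaleN1r addrC.
Qed.

Lemma is_int_sum (K : Type) (r : seq K) (F : K -> T -> B) (J : K -> B') :
  (forall k, is_int mu Phi (F k) (J k)) ->
  is_int mu Phi (fun x => \sum_(k <- r) F k x) (\sum_(k <- r) J k).
Proof.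
move=> FJ; elim: r => [|k r ih].
  by under eq_fun do rewrite big_nil; rewrite big_nil; exact: is_int0.
by under eq_fun do rewrite big_cons; rewrite big_cons; exact: is_intD.
Qed.

Lemma is_int_le f I : is_int mu Phi f I ->
  ((nrm I)%:E <= \int[mu]_x (nrm (f x))%:E)%E.
Proof.
by move=> fI; have := is_int_dist fI is_int0; under eq_integral do rewrite subr0; rewrite subr0.
Qed.

(** The form in which tightness is used: [f] is small on the large set [S] and merely
    bounded on its small complement. *)
Lemma is_int_bound f I (S : set T) (M M' : R) : 0 <= M -> 0 <= M' -> measurable S ->
  (forall x, S x -> nrm (f x) <= M) -> (forall x, ~ S x -> nrm (f x) <= M') ->
  is_int mu Phi f I -> nrm I <= M * fine (mu S) + M' * fine (mu (~` S)).
Proof.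
move=> M0 M'0 mS fM fM' /is_int_le fI; rewrite -lee_fin (le_trans fI)//.
have mCS := measurableC mS.
apply: (@le_trans _ _ (\int[mu]_x (M%:E * (\1_S x)%:E + M'%:E * (\1_(~` S) x)%:E))%E).
  apply: (@lower_integral_ae_le _ _ _ _ _ _ set0) => // x.
  - by rewrite lee_fin nrm_ge0.
  - by rewrite adde_ge0// mule_ge0// lee_fin.
  - move=> _; rewrite lee_fin !indicE; have [Sx|Sx] := pselect (S x).
      by rewrite mem_set// memNset//= mulr1 mulr0 addr0 fM.
    by rewrite memNset// mem_set//= mulr1 mulr0 add0r fM'.
rewrite ge0_integralD//=; last 4 first.
- by move=> t _; rewrite lee_fin mulr_ge0.
- by apply: measurable_funeM; exact/measurable_EFinP/measurable_indic.
- by move=> t _; rewrite lee_fin mulr_ge0.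
- by apply: measurable_funeM; exact/measurable_EFinP/measurable_indic.
rewrite !ge0_integralZl_EFin//=; last 2 first.
- exact/measurable_EFinP/measurable_indic.
- exact/measurable_EFinP/measurable_indic.
by rewrite !integral_indic// !setIT EFinD !EFinM !measure_fineK.
Qed.

Lemma is_int_bounded f I (M : R) : 0 <= M -> (forall x, nrm (f x) <= M) ->
  is_int mu Phi f I -> nrm I <= M * fine (mu setT).
Proof.
move=> M0 fM fI; have := is_int_bound M0 (lexx 0) measurableT (fun x _ => fM x) _ fI.
by rewrite mul0r addr0; apply => x /(_ Logic.I).
Qed.

Lemma is_int_cvg (F : nat -> T -> B) f (J : nat -> B') I :
  (forall n, is_int mu Phi (F n) (J n)) -> is_int mu Phi f I ->
  (fun n => \int[mu]_x (nrm (f x - F n x))%:E)%E @ \oo --> 0%E -> J @ \oo --> I.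
Proof.
move=> FJ fI fF; apply/cvg_nrmP => e e0; have := ereal_small fF e0.
apply: filterS => n; rewrite -lte_fin; apply: le_lt_trans.
exact: is_int_dist.
Qed.

Lemma is_int_L1_approx f I s : is_int mu Phi f I -> L1_approx mu f s ->
  (fun n => simple_int Phi (s n)) @ \oo --> I.
Proof.
move=> fI fs; apply: (@is_int_cvg s f _ I _ fI); last by case: fs.
by move=> n; apply: is_int_simple; case: fs.
Qed.

Lemma L1_approx_ae_eq f g s (N : set T) : measurable N -> mu N = 0%E ->
  (forall x, ~ N x -> f x = g x) -> L1_approx mu f s -> L1_approx mu g s.
Proof.
move=> mN N0 fg [fs fs_ fs0]; split => //.
- have : \forall x \ae mu, ~ N x by exists N; split => // x /= /contrapT.
  by move: fs_; apply: filterS2 => x sx /fg <-.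
- rewrite (_ : (fun n => _) = (fun n => \int[mu]_t (nrm (f t - s n t))%:E)%E)//.
  apply/funext => n; apply/eqP; rewrite eq_le; apply/andP.
  by split; apply: (@lower_integral_ae_le _ _ _ _ _ _ N) => // t;
    rewrite ?lee_fin ?nrm_ge0// => /fg ->.
Qed.

Lemma is_int_ae_eq f g I (N : set T) : measurable N -> mu N = 0%E ->
  (forall x, ~ N x -> f x = g x) -> is_int mu Phi f I -> is_int mu Phi g I.
Proof. by move=> mN N0 fg [s fs sI]; exists s => //; exact: L1_approx_ae_eq mN N0 fg fs. Qed.

End operator_integral.

Section integral_existence.
Context d (T : measurableType d) (R : realType).
Variables (mu : {finite_measure set T -> \bar R}).
Variables (B : normedModType R[i]) (B' : completeNormedModType R[i]).
Variables (Phi : set T -> B -> B').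

Lemma is_int_exists f s : dominated_op mu Phi -> L1_approx mu f s ->
  exists I, is_int mu Phi f I.
Proof.
move=> dPhi fs.
suff : cvgn (fun n => simple_int Phi (s n)) by move=> cs; eexists; exists s; last exact: cs.
apply: (@cauchy_seq_cvgE _ _ _ (fun n => \int[mu]_x (nrm (f x - s n x))%:E)%E).
  move=> n m; have := simple_int_dist n m dPhi fs fs.
  rewrite (_ : (\int[mu]_x (nrm (f x - f x))%:E = 0)%E) ?adde0//.
  by rewrite integral0_eq// => x _; rewrite subrr nrm0.
by case: fs.
Qed.

End integral_existence.

Section indicator_integral.
Context d (T : measurableType d) (R : realType).
Variables (mu : {finite_measure set T -> \bar R}) (B B' : normedModType R[i]).
Variables (Phi : set T -> B -> B') (dPhi : dominated_op mu Phi).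

Lemma is_int_indic A b : measurable A ->
  is_int mu Phi (fun t => (\1_A t : R[i]) *: b) (Phi A b).
Proof.
move=> mA; pose g (q : bool) : B := (q%:R : R[i]) *: b.
have -> : (fun t => (\1_A t : R[i]) *: b) = g \o (fun t => t \in A).
  by apply/funext => t; rewrite /= indicE.
have fA := finitely_valued_mem mA.
suff -> : Phi A b = simple_int Phi (g \o (fun t => t \in A)).
  by apply: is_int_simple; exact: finitely_valued_comp.
rewrite (simple_int_factor dPhi.1 _ fA) (fsbig_widen _ [set true; false])//=; last 2 first.
- by move=> [] _ /=; [left|right].
- move=> q [_ /= nq]; rewrite (_ : _ @^-1` _ = set0) ?(additive_op0 dPhi.1)//.
  by rewrite -subset0 => t /= tq; apply: nq; exists t.
rewrite fsbigU//=; last by move=> q [-> //].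
rewrite !fsbig_set1 /g scale1r scale0r (additive_op_val0 dPhi.1) ?addr0; last first.
  have := finitely_valued_preimage [set false] fA; exact.
congr (Phi _ _); by apply/seteqP; split=> t /= => [/mem_set|/set_mem].
Qed.

End indicator_integral.

Section integral_map.
Context d (T : measurableType d) (R : realType).
Variables (mu : {finite_measure set T -> \bar R}).
Variables (B1 B1' B2 B2' : normedModType R[i]).
Variables (Phi1 : set T -> B1 -> B1') (Phi2 : set T -> B2 -> B2').
Variables (a : B1 -> B2) (b : B1' -> B2') (c : R).
Hypotheses (dPhi1 : additive_op Phi1) (dPhi2 : additive_op Phi2).
Hypothesis ac : forall x y, nrm (a x - a y) <= c * nrm (x - y).
Hypothesis bD : zmod_morphism b.
Hypothesis bc : continuous b.
Hypothesis ab : forall A x, measurable A -> Phi2 A (a x) = b (Phi1 A x).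

Let b0 : b 0 = 0. Proof. by have := bD 0 0; rewrite !subrr. Qed.
Let bDD x y : b (x + y) = b x + b y.
Proof. by rewrite -[y in LHS]opprK bD -[- y]sub0r bD b0 sub0r opprK. Qed.

Lemma simple_int_map s : simple_fun s -> simple_int Phi2 (a \o s) = b (simple_int Phi1 s).
Proof.
move=> fs; rewrite (simple_int_factor dPhi2 a fs) /simple_int.
have [fr mr] := fs; rewrite !fsbig_finite//= (big_morph b bDD b0).
by apply: eq_bigr => x _; rewrite ab.
Qed.

Lemma L1_approx_map f s : L1_approx mu f s -> L1_approx mu (a \o f) (fun n => a \o s n).
Proof.
move=> fs; have [sf sf_ fs0] := fs.
have c0 : 0 <= `|c| by [].
have ac' x y : nrm (a x - a y) <= `|c| * nrm (x - y).
  by rewrite (le_trans (ac _ _))// ler_wpM2r ?nrm_ge0// ler_norm.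
split.
- by move=> n; apply: finitely_valued_comp; exact: sf.
- move: sf_; apply: filterS => x sx.
  apply: (@cvg_nrm_le _ _ _ _ _ _ _ (fun n => `|c| * nrm (f x - s n x))).
    by move=> n; exact: ac'.
  by rewrite -(mulr0 `|c|); apply: cvgMr; exact: cvg_dist0.
- apply: (@squeeze_cvge _ _ _ _ (cst 0%E) _ (fun n => (`|c|)%:E *
      \int[mu]_x (nrm (f x - s n x))%:E + 0%:E * \int[mu]_x (nrm (f x - s n x))%:E)%E).
  + apply: nearW => n; rewrite integral_ge0 => [|x _]; last by rewrite lee_fin nrm_ge0.
    apply: lower_integral_comb => //.
    * by move=> x; exact: nrm_ge0.
    * by move=> x; exact: nrm_ge0.
    * by move=> x; exact: nrm_ge0.
    * exact: L1_approx_ae_measurable (sf n) fs.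
    * exact: L1_approx_ae_measurable (sf n) fs.
    * by move=> x; rewrite mul0r addr0 ac'.
  + exact: cvg_cst.
  + under eq_fun do rewrite mul0e adde0.
    by rewrite -(mule0 (`|c|)%:E); exact: cvgeZl.
Qed.

(** Instances are the evaluation of operators at a vector and the compression
    [T |-> <T v, v>]. *)
Lemma is_int_map f I : is_int mu Phi1 f I -> is_int mu Phi2 (a \o f) (b I).
Proof.
move=> [s fs sI]; exists (fun n => a \o s n); first exact: L1_approx_map.
rewrite (_ : (fun n => _) = b \o (fun n => simple_int Phi1 (s n))).
  by apply: continuous_cvg => //; exact: bc.
by apply/funext => n; rewrite /= simple_int_map//; case: fs.
Qed.

End integral_map.

(** * Measurability, bounded approximation, completeness of the space of operators *)

Section dense_sequences.
Variable R : realType.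

Definition dense_seq (B : normedModType R[i]) (u : nat -> B) :=
  forall b (e : R), 0 < e -> exists n, nrm (b - u n) < e.

Lemma separable_dense_seq (H : hilbertType R[i]) :
  separable_space H -> exists u : nat -> H, dense_seq u.
Proof.
move=> [D /countable_injP[f finj] dD].
pose u n := xget (0 : H) [set x | D x /\ f x = n].
exists u => b e e0.
have eC0 : 0 < e%:C :> R[i] by rewrite ltcR.
have [x [bx Dx]] : (ball b e%:C) `&` D !=set0.
  by apply: dD; [exists b; exact: ballxx|exact: ball_open].
exists (f x); have -> : u (f x) = x.
  rewrite /u; case: xgetP => [y _ [Dy fy]|/(_ x)]; last by case.
  by apply: finj => //; exact: mem_set.
by move: bx; rewrite -ball_normE /= ltc_nrm.
Qed.

Lemma complex_dense_seq : exists u : nat -> R[i], dense_seq u.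
Proof.
pose u n : R[i] := if @choice.unpickle (rat * rat)%type n is Some z
  then (ratr z.1 +i* ratr z.2 : R[i]) else 0.
exists u => b e e0; have e20 : 0 < e / 2 by lra.
have key (x : R) : exists q : rat, `|x - ratr q| < e / 2.
  have [|q qx] := @rat_in_itvoo R (x - e / 2) (x + e / 2); first by lra.
  exists q; by move: qx; rewrite in_itv/= distrC ltr_distl.
have [q1 h1] := key (complex.Re b); have [q2 h2] := key (complex.Im b).
exists (choice.pickle (q1, q2)); rewrite /u choice.pickleK/=.
have -> : b - (ratr q1 +i* ratr q2) =
    (complex.Re b - ratr q1)%:C + 'i * (complex.Im b - ratr q2)%:C.
  by rewrite -complexiE [LHS]complexE !raddfB.
rewrite (le_lt_trans (nrm_normD _ _))// nrmM !nrm_real [ltRHS]splitr.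
have -> : nrm ('i : R[i]) = 1 by rewrite /nrm normCi.
by rewrite mul1r ltrD.
Qed.

End dense_sequences.

Section simple_limits.
Context d (T : measurableType d) (R : realType).

Lemma measurable_set_lt (g h : T -> R) :
  measurable_fun setT g -> measurable_fun setT h ->
  measurable [set x | g x < h x].
Proof.
move=> mg mh; have mt : measurable [set true] by [].
by have := measurable_fun_ltr mg mh measurableT mt; rewrite setTI.
Qed.

(** Pointwise convergence with a uniform bound, so that one sequence approximates [F] in
    [L1] for all finite measures at once. *)
Definition simple_limit (B : normedModType R[i]) (F : T -> B) (s : nat -> T -> B) (c : R) :=
  [/\ forall n, simple_fun (s n), forall x, s ^~ x @ \oo --> F x &
      forall n x, nrm (F x - s n x) <= c].

(** The approximants pick, among the first [n] points of a dense sequence, one that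
    is nearest to the value. *)
Lemma separable_simple_limit (B : normedModType R[i]) (F : T -> B) (M : R) :
  (exists u : nat -> B, dense_seq u) ->
  (forall b, measurable_fun setT (fun x => nrm (F x - b))) ->
  (forall x, nrm (F x) <= M) -> exists s c, simple_limit F s c.
Proof.
move=> [u du] mF FM.
pose near n (s : T -> B) x :=
  if x \in [set x | nrm (F x - u n) < nrm (F x - s x)] then u n else s x.
pose s := fix s n : T -> B := if n is m.+1 then near n (s m) else fun=> u 0%N.
have sS n : s n.+1 = near n.+1 (s n) by [].
have nearE n x : nrm (F x - s n.+1 x) =
    Num.min (nrm (F x - u n.+1)) (nrm (F x - s n x)).
  rewrite sS /near; case: ifPn => [/set_mem/= h|].
    by rewrite min_l// ltW.
  by move=> /negP h; rewrite min_r// leNgt; apply/negP => h'; apply: h; exact/mem_set.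
have sm n : simple_fun (s n) /\ measurable_fun setT (fun x => nrm (F x - s n x)).
  elim: n => [|n [fs ms]]; first by split; [exact: finitely_valued_cst|exact: mF].
  split.
    rewrite sS /near; apply: finitely_valued_if => //; last exact: finitely_valued_cst.
    exact: measurable_set_lt.
  under eq_fun do rewrite nearE.
  exact: measurable_minr.
have s0 n x : nrm (F x - s n x) <= nrm (F x - u 0%N).
  elim: n => //= n; apply: le_trans; rewrite nearE ge_min lexx orbT//.
have sle n k x : (k <= n)%N -> nrm (F x - s n x) <= nrm (F x - u k).
  elim: n => [|n ih]; first by rewrite leqn0 => /eqP ->.
  rewrite leq_eqVlt => /orP[/eqP ->|]; rewrite nearE ge_min ?lexx// => kn.
  by rewrite ih ?orbT.
exists s, (M + nrm (u 0%N)); split=> [n|x|n x].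
- by case: (sm n).
- apply/cvg_nrmP => e e0; have [k ke] := du (F x) e e0.
  by exists k => // n /= kn; exact: le_lt_trans (sle _ _ _ kn) ke.
- by rewrite (le_trans (s0 _ _))// (le_trans (nrm_normD _ _))// nrmN lerD2r.
Qed.

Lemma simple_cvg_measurable (B : normedModType R[i]) (G : T -> B) (s : nat -> T -> B) b :
  (forall n, simple_fun (s n)) -> (forall t, s ^~ t @ \oo --> G t) ->
  measurable_fun setT (fun t => nrm (G t - b)).
Proof.
move=> fs sG; apply: (@measurable_fun_cvg _ _ _ _ (fun m t => nrm (s m t - b))).
  by move=> m; exact: (@finitely_valued_measurable _ _ _ _ (fun z => nrm (z - b)) _ (fs m)).
by move=> t _; apply: cvg_nrm; apply: cvgB => //; exact: cvg_cst.
Qed.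

Lemma simple_limit_L1 (mu : {finite_measure set T -> \bar R})
    (B : normedModType R[i]) (F : T -> B) s c : simple_limit F s c -> L1_approx mu F s.
Proof.
move=> [fs sF sc]; apply: (@L1_approx_dominated _ _ _ _ _ _ _ (cst c)) => //.
apply/integrableP; split; first exact/measurable_EFinP/measurable_cst.
rewrite (eq_integral (cst (`|c|)%:E))// integral_cst//.
by rewrite lte_mul_pinfty// ?ltey_eq ?fin_num_measure// ?lee_fin.
Qed.

End simple_limits.

Section simple_indicators.
Context d (T : measurableType d) (R : realType).
Implicit Type A : set T.

Lemma nrm_indic A t : nrm (\1_A t : R[i]) = \1_A t.
Proof. by rewrite !indicE; case: (_ \in _) => /=; [rewrite /nrm normr1|rewrite nrm0]. Qed.

Lemma nrm_indic_le1 A t : nrm (\1_A t : R[i]) <= 1.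
Proof. by rewrite nrm_indic indicE; case: (_ \in _). Qed.

Lemma simple_limit_indic1 A : measurable A ->
  simple_limit (fun t => \1_A t : R[i]) (fun=> (fun t => \1_A t : R[i])) 0.
Proof.
move=> mA; split=> [_|t|_ t]; last by rewrite subrr nrm0.
  have := finitely_valued_comp (fun b : bool => b%:R : R[i]) (finitely_valued_mem mA).
  by congr finitely_valued; apply/funext => t; rewrite indicE.
exact: cvg_cst.
Qed.

End simple_indicators.

Section continuous_measurable.
Variables (R : realType) (X : ptopologicalType).

Lemma open_borel (U : set X) : open U -> measurable (U : set (borel X)).
Proof. exact: sub_sigma_algebra. Qed.

Lemma closed_borel (U : set X) : closed U -> measurable (U : set (borel X)).
Proof.
move=> cU; rewrite -[U]setCK; apply: measurableC; apply: open_borel.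
exact: closed_openC.
Qed.

Lemma compact_borel (K : set X) : hausdorff_space X -> compact K ->
  measurable (K : set (borel X)).
Proof. by move=> hX cK; apply: closed_borel; exact: compact_closed. Qed.

Lemma continuous_borel (f : X -> R) : continuous f ->
  measurable_fun setT (f : borel X -> R).
Proof.
move=> /continuousP cf; apply: (measurability _ (RGenOpens.measurableE R)).
move=> _ [_ [a [b ->] <-]]; rewrite setTI; apply: open_borel.
exact/cf/interval_open.
Qed.

Lemma continuous_nrm (B : normedModType R[i]) (Y : topologicalType) (F : Y -> B) (b : Y -> B) :
  continuous F -> continuous b -> continuous (fun x => nrm (F x - b x)).
Proof.
by move=> cF cb x; apply: cvg_nrm; apply: cvgB; [exact: cF|exact: cb].
Qed.

Lemma continuous_simple_limit (B : normedModType R[i]) (F : X -> B) (M : R) :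
  (exists u : nat -> B, dense_seq u) -> continuous F -> (forall x, nrm (F x) <= M) ->
  exists s c, simple_limit (F : borel X -> B) s c.
Proof.
move=> du cF; apply: (@separable_simple_limit _ (borel X)) => // b.
by apply: continuous_borel; apply: continuous_nrm => // x; exact: cvg_cst.
Qed.

End continuous_measurable.

Section L1_scaling.
Context d (T : measurableType d) (R : realType).
Variables (mu : {finite_measure set T -> \bar R}) (B : normedModType R[i]).
Implicit Types (G : T -> B) (s : nat -> T -> B).

Lemma L1_approx_finite G s : L1_approx mu G s -> (\int[mu]_x (nrm (G x))%:E < +oo)%E.
Proof.
move=> Gs; have [fs _ s0] := Gs.
have [n hn] := filter_ex (ereal_small s0 (@ltr01 R)).
apply: (@le_lt_trans _ _ (\int[mu]_x (nrm (G x - s n x))%:E + \int[mu]_x (nrm (s n x))%:E)%E).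
  apply: lower_integralD.
  - by move=> x; exact: nrm_ge0.
  - by move=> x; exact: nrm_ge0.
  - by move=> x; exact: nrm_ge0.
  - exact: L1_approx_ae_measurable (fs n) Gs.
  - apply: measurable_ae_measurable; exact: (@finitely_valued_measurable _ _ _ _ (@nrm R B) _ (fs n)).
  - by move=> x; exact: nrm_leD.
rewrite (integral_finitely_valued mu (fs n) (@nrm_ge0 R B)).
by apply: lte_add_pinfty; [exact: lt_trans hn (ltry _)|exact: ltry].
Qed.

(** Cutting off a null set turns convergence almost everywhere into convergence
    everywhere. *)
Lemma L1_approx_everywhere G s : L1_approx mu G s -> exists G' s' N,
  [/\ measurable N, mu N = 0%E, (forall x, ~ N x -> G' x = G x),
      (forall n, simple_fun (s' n)) /\ (forall x, s' ^~ x @ \oo --> G' x) &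
      L1_approx mu G' s'].
Proof.
move=> [fs [N [mN N0 Ns]] s0].
pose cut (F : T -> B) x := if x \in N then 0 else F x.
have fs' n : simple_fun (cut (s n)).
  by apply: finitely_valued_if => //; [exact: finitely_valued_cst|exact: fs].
have ss' x : (fun n => cut (s n) x) @ \oo --> cut G x.
  rewrite /cut; case: ifPn => xN; first exact: cvg_cst.
  by apply: contrapT => /Ns Nx; move: xN; rewrite mem_set.
exists (cut G), (fun n => cut (s n)), N; split => //.
  by move=> x Nx; rewrite /cut memNset.
split => //; first by apply: aeW.
apply: (@squeeze_cvge _ _ _ _ (cst 0%E) _ (fun n => \int[mu]_t (nrm (G t - s n t))%:E)%E) => //.
  apply: nearW => n; rewrite integral_ge0 => [|x _]; last by rewrite lee_fin nrm_ge0.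
  apply: lower_integral_le => t; first exact: nrm_ge0.
  by rewrite /cut; case: ifPn => // _; rewrite subrr nrm0 nrm_ge0.
exact: cvg_cst.
Qed.

(** Dominated convergence with a multiple of [nrm G] as majorant; [G] is first replaced
    by a function that is measurable, being an everywhere limit of simple functions. *)
Lemma L1_approx_scale (phi : T -> R[i]) (phin : nat -> T -> R[i]) (c M : R) G s :
  simple_limit phi phin c -> (forall x, nrm (phi x) <= M) -> L1_approx mu G s ->
  (fun n => \int[mu]_x (nrm (phi x *: G x - phin n x *: G x))%:E)%E @ \oo --> 0%E /\
  L1_approx mu (fun x => phi x *: G x) (fun n x => phin n x *: s n x).
Proof.
move=> [fphi phil phic] phiM /[dup] Gs0 /L1_approx_everywhere[G' [s' [N [mN N0 GG' [fs' ss'] Gs]]]].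
have mG : measurable_fun setT (fun x => nrm (G' x)).
  by have := simple_cvg_measurable 0 fs' ss'; under eq_fun do rewrite subr0.
have mphi n : measurable_fun setT (fun x => nrm (phi x - phin n x)).
  apply: (@measurable_fun_cvg _ _ _ _ (fun m x => nrm (phin m x - phin n x))).
    move=> m; exact: (@finitely_valued_measurable _ _ _ _ (fun z : R[i] * R[i] => nrm (z.1 - z.2)) _
      (finitely_valued_pair (fphi m) (fphi n))).
  by move=> x _; apply: cvg_nrm; apply: cvgB => //; exact: cvg_cst.
have intE n : (\int[mu]_x (nrm (phi x *: G x - phin n x *: G x))%:E =
    \int[mu]_x (nrm (phi x - phin n x) * nrm (G' x))%:E)%E.
  apply/eqP; rewrite eq_le; apply/andP; split;
    apply: (@lower_integral_ae_le _ _ _ _ _ _ N) => // t; rewrite lee_fin ?nrm_ge0//.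
  - by rewrite mulr_ge0// nrm_ge0.
  - by move=> /GG' ->; rewrite -scalerBl nrmZ.
  - by rewrite mulr_ge0// nrm_ge0.
  - by move=> /GG' ->; rewrite -scalerBl nrmZ.
have c0 : 0 <= c by rewrite (le_trans _ (phic 0%N point))// nrm_ge0.
have scal0 : (fun n => \int[mu]_x (nrm (phi x *: G x - phin n x *: G x))%:E)%E @ \oo --> 0%E.
  under eq_fun do rewrite intE.
  have [] := @dominated_convergence _ T R mu setT measurableT
    (fun n x => (nrm (phi x - phin n x) * nrm (G' x))%:E) (cst 0%E)
    (fun x => (c * nrm (G' x))%:E).
  - by move=> n; apply/measurable_EFinP; exact: measurable_funM.
  - exact: measurable_cst.
  - apply: aeW => x _; apply: cvg_EFin; first exact: nearW.
    by rewrite -(mul0r (nrm (G' x))); apply: cvgMl; exact: cvg_dist0.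
  - apply/integrableP; split.
      by apply/measurable_EFinP; apply: measurable_funM => //; exact: measurable_cst.
    under eq_integral do rewrite /= ger0_norm ?mulr_ge0 ?nrm_ge0//.
    under eq_integral do rewrite EFinM.
    rewrite ge0_integralZl_EFin//=.
    + by rewrite lte_mul_pinfty// ?lee_fin//; exact: L1_approx_finite Gs.
    + by move=> x _; rewrite lee_fin nrm_ge0.
    + exact/measurable_EFinP.
  - apply: aeW => x n _; rewrite /= lee_fin ger0_norm ?mulr_ge0 ?nrm_ge0//.
    by rewrite ler_wpM2r// nrm_ge0.
  move=> _ h _; move: h; apply: cvg_trans; apply: near_eq_cvg; apply: nearW => n /=.
  by apply: eq_integral => x _; rewrite subr0 ger0_norm// mulr_ge0 ?nrm_ge0.
split => //.
have [sf sf_ _] := Gs0; have [_ _ fs0] := Gs0; have Mc0 : 0 <= M + c.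
  by rewrite addr_ge0// (le_trans _ (phiM point))// nrm_ge0.
have phinM n x : nrm (phin n x) <= M + c.
  by rewrite addrC (le_trans (nrm_leD _ (phi x)))// nrmBC lerD.
split.
- move=> n; exact: (@finitely_valued_comp _ _ _ _ (fun z : R[i] * B => z.1 *: z.2) _
    (finitely_valued_pair (fphi n) (sf n))).
- by move: sf_; apply: filterS => x sx; apply: cvgZ => //; exact: phil.
- apply: (@squeeze_cvge _ _ _ _ (cst 0%E) _ (fun n =>
     (M + c)%:E * \int[mu]_x (nrm (G x - s n x))%:E +
     1%:E * \int[mu]_x (nrm (phi x *: G x - phin n x *: G x))%:E)%E).
  + apply: nearW => n; rewrite integral_ge0 => [|x _]; last by rewrite lee_fin nrm_ge0.
    apply: lower_integral_comb => //.
    * by move=> x; exact: nrm_ge0.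
    * by move=> x; exact: nrm_ge0.
    * by move=> x; exact: nrm_ge0.
    * exact: L1_approx_ae_measurable (sf n) Gs0.
    * exists N; split => //.
      rewrite (_ : (fun t => _) = (fun t => \1_(~` N) t * (nrm (phi t - phin n t) * nrm (G' t)))).
        apply: measurable_funM; last exact: measurable_funM.
        by apply: measurable_indic; exact: measurableC.
      apply/funext => t; rewrite indicE; case: (boolP (t \in ~` N)) => [/set_mem/GG' ->|].
        by rewrite -scalerBl nrmZ.
      by rewrite !mul0r.
    * move=> x; rewrite mul1r (le_trans (nrm_triangle (phin n x *: G x) _ _))// addrC lerD//.
      by rewrite -scalerBr nrmZ ler_wpM2r// nrm_ge0.
  + exact: cvg_cst.
  + rewrite -[0%E]adde0; apply: cvgeD => //.
      by rewrite -(mule0 (M + c)%:E); exact: cvgeZl.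
    by rewrite -(mule0 1%:E); exact: cvgeZl.
Qed.

End L1_scaling.

Section cauchy_filters.
Variables (R : realType) (V : normedModType R[i]).

Lemma cauchy_nrmP (F : set_system V) : Filter F -> cauchy F ->
  forall e : R, 0 < e -> exists2 A, F A & forall x y, A x -> A y -> nrm (x - y) < e.
Proof.
move=> FF /cauchy_ballP Fc e e0.
have eC0 : 0 < e%:C :> R[i] by rewrite ltcR.
have [[A B] /= [FA FB] AB] := Fc _ eC0.
exists (A `&` B); first exact: filterI.
move=> x y [Ax _] [_ By]; have := AB (x, y) (conj Ax By).
by rewrite -ball_normE /= ltc_nrm.
Qed.

Lemma nrm_cauchy (F : set_system V) : Filter F ->
  (forall e : R, 0 < e -> exists2 A, F A & forall x y, A x -> A y -> nrm (x - y) < e) ->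
  cauchy F.
Proof.
move=> FF h; apply/cauchy_ballP => e e0.
have eR : (complex.Re e)%:C = e by rewrite RRe_real// realE ltW.
have [|A FA Ae] := h (complex.Re e); first by rewrite -ltcR eR.
exists (A, A) => //= -[x y] [/= Ax Ay]; rewrite -ball_normE /= -[e]eR ltc_nrm.
exact: Ae.
Qed.

End cauchy_filters.

Section bop_complete.
Variables (R : realType) (H : completeNormedModType R[i]).

Lemma nrm_bop_le (T : bop H) v : nrm (T v) <= nrm T * nrm v.
Proof. exact: le_opnorm. Qed.

Lemma bop_nrm_le (T : bop H) (M : R) : 0 <= M -> (forall v, nrm (T v) <= M * nrm v) ->
  nrm T <= M.
Proof.
by move=> M0 h; apply: opnorm_le => v v1; rewrite (le_trans (h v))// ler_piMr.
Qed.

Lemma bopB (S T : bop H) v : (S - T) v = S v - T v. Proof. by []. Qed.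
Lemma bopD (S T : bop H) v : (S + T) v = S v + T v. Proof. by []. Qed.
Lemma bopZ (a : R[i]) (T : bop H) v : (a *: T) v = a *: T v. Proof. by []. Qed.
Lemma bop0 v : (0 : bop H) v = 0. Proof. by []. Qed.
Lemma bop_sum (I : Type) (r : seq I) (P : pred I) (F : I -> bop H) v :
  (\sum_(i <- r | P i) F i) v = \sum_(i <- r | P i) F i v.
Proof. by elim/big_rec2 : _ => // i x y _ <-. Qed.

Lemma bop_complete (F : set_system (bop H)) : ProperFilter F -> cauchy F -> cvg F.
Proof.
move=> FF Fc.
have evc v : cvg ((fun T : bop H => T v) @ F).
  apply/cauchy_cvgP; apply: nrm_cauchy => e e0.
  have [|A FA Ae] := cauchy_nrmP FF Fc (e := e / (nrm v + 1)).
    by rewrite divr_gt0// ltr_wpDl// nrm_ge0.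
  exists ((fun T : bop H => T v) @` A).
    by apply: (@filterS _ F _ _ _ _ FA) => T AT; exists T.
  move=> _ _ [S AS <-] [T AT <-]; rewrite -bopB (le_lt_trans (nrm_bop_le _ _))//.
  have v1 : 0 < nrm v + 1 by rewrite ltr_wpDl// nrm_ge0.
  rewrite (@le_lt_trans _ _ (nrm (S - T) * (nrm v + 1)))//.
    by rewrite ler_wpM2l ?nrm_ge0// lerDl.
  by rewrite -ltr_pdivlMr// Ae.
pose L v := lim ((fun T : bop H => T v) @ F).
have Ll : linear L.
  move=> a u v; apply/cvg_lim => //.
  rewrite (_ : (fun T : bop H => _) = (fun T : bop H => a *: T u + T v)).
    by apply: cvgD; [apply: cvgZr|]; exact: evc.
  by apply/funext => T; rewrite linearP.
have [A FA A1] := cauchy_nrmP FF Fc (@ltr01 R).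
have [T0 AT0] := filter_ex FA.
have LB v : nrm (L v) <= (1 + nrm T0) * nrm v.
  rewrite -nrmN -sub0r; apply: nrm_cvg_le (evc v) _.
  apply: filterS FA => T AT; rewrite sub0r nrmN.
  rewrite (le_trans (nrm_bop_le _ _))// ler_wpM2r ?nrm_ge0//.
  by rewrite (le_trans (nrm_leD _ T0))// lerD2r ltW// A1.
have Lb : L \in @bounded_linear R H by apply/asboolP; split => //; exists (1 + nrm T0).
apply/cvg_ex; exists (BOp Lb); apply/(@cvg_nrmP R (bop H) _ F _ id) => e e0.
have e20 : 0 < e / 2 by lra.
have [C FC Ce] := cauchy_nrmP FF Fc e20.
apply: (@filterS _ F _ _ _ _ FC) => S CS; rewrite (@le_lt_trans _ _ (e / 2))//; last by lra.
rewrite nrmBC; apply: bop_nrm_le => [|v]; first exact: ltW.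
rewrite -[nrm _]/(nrm (S v - L v)).
apply: (@nrm_cvg_le R H _ F FF (fun T : bop H => T v) (L v) _ _ (evc v)).
apply: (@filterS _ F _ _ _ _ FC) => T CT.
by rewrite -bopB (le_trans (nrm_bop_le _ _))// ler_wpM2r ?nrm_ge0// ltW// Ce.
Qed.

HB.instance Definition _ := Uniform_isComplete.Build (bop H) bop_complete.

End bop_complete.

(** * The variation of a vector measure *)

Section measure_of_function.
Context d (T : measurableType d) (R : realType) (m : set T -> \bar R).

(** The axioms on [m] only concern measurable sets; elsewhere the measure is set to 0. *)
Lemma finite_measure_of : m set0 = 0%E -> (forall A, measurable A -> 0 <= m A)%E ->
  (forall A, measurable A -> m A \is a fin_num) ->
  (forall F : (set T)^nat, (forall n, measurable (F n)) -> trivIset setT F ->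
    (fun n => \sum_(0 <= i < n) m (F i))%E @ \oo --> m (\bigcup_n F n)) ->
  exists mu : {finite_measure set T -> \bar R}, forall A, measurable A -> mu A = m A.
Proof.
move=> m0 m_ge0 m_fin m_sigma.
pose f A := if pselect (measurable A) then m A else 0%E.
have fE A : measurable A -> f A = m A by rewrite /f; case: pselect.
have f0 : f set0 = 0%E by rewrite fE.
have f_ge0 A : (0 <= f A)%E by rewrite /f; case: pselect => // ?; exact: m_ge0.
have f_sigma : semi_sigma_additive f.
  move=> F mF tF mUF; rewrite fE// (_ : (fun n => _) = (fun n => \sum_(0 <= i < n) m (F i))%E).
    exact: m_sigma.
  by apply/funext => n; apply: eq_bigr => i _; rewrite fE.
have f_fin : fin_num_fun f by move=> A mA; rewrite fE// m_fin.
pose mM := isMeasure.Build d T R f f0 f_ge0 f_sigma.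
pose M : {measure set T -> \bar R} := HB.pack f mM.
pose mF := Measure_isFinite.Build d T R M f_fin.
pose Fm : {finite_measure set T -> \bar R} := HB.pack f mM mF.
by exists Fm => A mA; rewrite /= fE.
Qed.

End measure_of_function.

Lemma ereal_sup_addP (R : realType) (S S' : set (\bar R)) (c : \bar R) :
  S !=set0 -> S' !=set0 ->
  (forall a b, S a -> S' b -> [/\ 0 <= a, 0 <= b & a + b <= c])%E ->
  (ereal_sup S + ereal_sup S' <= c)%E.
Proof.
move=> [a0 Sa0] [b0 Sb0] h.
case: c h => [c||] h; last 2 first.
- exact: leey.
- have [h1 h2 h3] := h _ _ Sa0 Sb0.
  by move: h3; rewrite leNgt (lt_le_trans _ (adde_ge0 h1 h2))// ltNy0.
have fb b : S' b -> b \is a fin_num.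
  move=> Sb; have [h1 h2 h3] := h _ _ Sa0 Sb; rewrite ge0_fin_numE//.
  by rewrite (le_lt_trans _ (ltry c))// (le_trans _ h3)// leeDr.
have fa a : S a -> a \is a fin_num.
  move=> Sa; have [h1 h2 h3] := h _ _ Sa Sb0; rewrite ge0_fin_numE//.
  by rewrite (le_lt_trans _ (ltry c))// (le_trans _ h3)// leeDl.
have fS' : ereal_sup S' \is a fin_num.
  have [h1 h2 h3] := h _ _ Sa0 Sb0; rewrite ge0_fin_numE//; last first.
    by rewrite (le_trans h2)//; exact: ereal_sup_ubound.
  rewrite (le_lt_trans _ (ltry c))//; apply: ge_ereal_sup => b Sb.
  by have [h1' h2' h3'] := h _ _ Sa0 Sb; rewrite (le_trans _ h3')// leeDr.
rewrite -leeBrDr//; apply: ge_ereal_sup => a Sa.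
rewrite leeBrDr// addeC -leeBrDr ?fa//; apply: ge_ereal_sup => b Sb.
by rewrite leeBrDr ?fa// addeC; have [] := h _ _ Sa Sb.
Qed.

Section vector_measures.
Context d (T : measurableType d) (R : realType) (B : normedModType R[i]).
Variables (nu : set T -> B).
Hypothesis nu_ca : countably_additive nu.

Lemma vector_measure0 : nu set0 = 0.
Proof.
have := nu_ca (fun=> @measurable0 _ T) (@trivIset_set0 _ _ _).
rewrite bigcup0// => h; have h1 : (fun n => \sum_(0 <= i < n.+1) nu set0) @ \oo --> nu set0.
  by rewrite (@cvg_shiftS _ (fun n => \sum_(0 <= i < n) nu set0)).
have h2 : (fun n => \sum_(0 <= i < n.+1) nu set0 - \sum_(0 <= i < n) nu set0) @ \oo --> (0 : B).
  suff : (fun n => \sum_(0 <= i < n.+1) nu set0 - \sum_(0 <= i < n) nu set0) @ \oo -->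
    nu set0 - nu set0 by rewrite subrr.
  exact: cvgB.
rewrite -(@cvg_lim _ (@norm_hausdorff _ B) _ _ _ _ _ h2) //.
apply/esym/(@cvg_lim _ (@norm_hausdorff _ B)) => //.
rewrite (_ : (fun n => _) = cst (nu set0)); first exact: cvg_cst.
by apply/funext => n; rewrite /= big_nat_recr//= addrAC subrr add0r.
Qed.

Lemma vector_measureU A A' : measurable A -> measurable A' -> A `&` A' = set0 ->
  nu (A `|` A') = nu A + nu A'.
Proof.
move=> mA mA' AA'.
have h : trivIset setT (bigcup2 A A') by rewrite -trivIset_bigcup2.
have mb n : measurable (bigcup2 A A' n) by case: n => [|[|n]] //=.
have := nu_ca mb h; rewrite bigcup2E => hc.
rewrite -(@cvg_lim _ (@norm_hausdorff _ B) _ _ _ _ _ hc)//.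
apply/(@cvg_lim _ (@norm_hausdorff _ B)) => //.
apply: cvg_near_cst; exists 2%N => // n /= n2.
rewrite -(subnKC n2) /index_iota subn0 iotaD big_cat/= !big_cons big_nil/=.
rewrite addr0 big1_seq ?addr0// => i /andP[_]; rewrite mem_iota => /andP[+ _].
by case: i => [|[|i]] //= _; rewrite vector_measure0.
Qed.

Lemma vector_measureD A A' : measurable A -> measurable A' -> A `<=` A' ->
  nu (A' `\` A) = nu A' - nu A.
Proof.
move=> mA mA' AA'; rewrite -[in RHS](setDUK AA') vector_measureU//.
- by rewrite addrAC subrr add0r.
- exact: measurableD.
- by rewrite setIDA setIC -setIDA setDv setI0.
Qed.

Lemma variation_ge A n (F : 'I_n -> set T) : (forall i, measurable (F i)) ->
  trivIset setT F -> \bigcup_i F i = A ->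
  ((\sum_(i < n) nrm (nu (F i)))%:E <= Defs.variation nu A)%E.
Proof.
move=> mF tF FA; apply: ereal_sup_ubound; exists n, F; split => //.
by rewrite sumEFin.
Qed.

Lemma variation_nrm A : measurable A -> ((nrm (nu A))%:E <= Defs.variation nu A)%E.
Proof.
move=> mA; have := @variation_ge A 1 (fun=> A) (fun=> mA).
rewrite big_ord1; apply; first by move=> i j _ _ _; rewrite (ord1 i) (ord1 j).
by apply/seteqP; split=> [t [i _]//|t At]; exists ord0.
Qed.

Let cover1 (A : set T) : trivIset setT (fun _ : 'I_1 => A) /\ \bigcup_(i : 'I_1) A = A.
Proof.
split; first by move=> i j _ _ _; rewrite (ord1 i) (ord1 j).
by apply/seteqP; split=> [t [i _]//|t At]; exists ord0.
Qed.

Lemma variation_ge0 A : measurable A -> (0 <= Defs.variation nu A)%E.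
Proof. by move=> mA; apply: le_trans (variation_nrm mA); rewrite lee_fin nrm_ge0. Qed.

(** A partition of [A] and one of [A'] together partition the union. *)
Lemma variation_superadd A A' : measurable A -> measurable A' -> A `&` A' = set0 ->
  (Defs.variation nu A + Defs.variation nu A' <= Defs.variation nu (A `|` A'))%E.
Proof.
move=> mA mA' AA'.
have key n (F : 'I_n -> set T) n' (F' : 'I_n' -> set T) :
    (forall i, measurable (F i)) -> trivIset setT F -> \bigcup_i F i = A ->
    (forall i, measurable (F' i)) -> trivIset setT F' -> \bigcup_i F' i = A' ->
    ((\sum_(i < n) nrm (nu (F i)))%:E + (\sum_(i < n') nrm (nu (F' i)))%:E <=
     Defs.variation nu (A `|` A'))%E.
  move=> mF tF FA mF' tF' FA'.
  pose K (k : 'I_(n + n')) := match fintype.split k with inl i => F i | inr i => F' i end.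
  have -> : (\sum_(i < n) nrm (nu (F i)))%:E + (\sum_(i < n') nrm (nu (F' i)))%:E =
      (\sum_(k < n + n') nrm (nu (K k)))%:E :> \bar R.
    rewrite -EFinD; congr _%:E; rewrite big_split_ord /K; congr (_ + _).
      apply: eq_bigr => i _; case: split_ordP => j /eqP; first by rewrite eq_lshift => /eqP ->.
      by rewrite eq_lrshift.
    apply: eq_bigr => i _; case: split_ordP => j /eqP; first by rewrite eq_rlshift.
    by rewrite eq_rshift => /eqP ->.
  have FAi i : F i `<=` A by rewrite -FA => t Fit; exists i.
  have FAi' i : F' i `<=` A' by rewrite -FA' => t Fit; exists i.
  have dis t : A t -> A' t -> False by move=> h h'; rewrite -[False]/(set0 t) -AA'.
  apply: variation_ge.
  - by move=> k; rewrite /K; case: fintype.split.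
  - move=> k l _ _; rewrite /K; case: split_ordP => i ->; case: split_ordP => j -> [t [ti tj]].
    + by congr lshift; apply: tF => //; exists t.
    + by case: (dis t (FAi _ _ ti) (FAi' _ _ tj)).
    + by case: (dis t (FAi _ _ tj) (FAi' _ _ ti)).
    + by congr rshift; apply: tF' => //; exists t.
  - rewrite -FA -FA'; apply/seteqP; split=> [t [k _]|t [[i _ ti]|[i _ ti]]].
    + by rewrite /K; case: fintype.split => i ti; [left|right]; exists i.
    + exists (lshift n' i) => //; rewrite /K; case: split_ordP => j /eqP.
        by rewrite eq_lshift => /eqP <-.
      by rewrite eq_lrshift.
    + exists (rshift n i) => //; rewrite /K; case: split_ordP => j /eqP.
        by rewrite eq_rlshift.
      by rewrite eq_rshift => /eqP <-.
rewrite /Defs.variation; apply: ereal_sup_addP.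
- by exists (nrm (nu A))%:E, 1%N, (fun=> A); have [h1 h2] := cover1 A; split=> //; rewrite big_ord1.
- by exists (nrm (nu A'))%:E, 1%N, (fun=> A'); have [h1 h2] := cover1 A'; split=> //; rewrite big_ord1.
- move=> _ _ [n [F [mF tF FA ->]]] [n' [F' [mF' tF' FA' ->]]]; rewrite !sumEFin.
  split; last exact: key.
  - by rewrite lee_fin sumr_ge0// => i _; rewrite nrm_ge0.
  - by rewrite lee_fin sumr_ge0// => i _; rewrite nrm_ge0.
Qed.

Lemma variation_le A A' : measurable A -> measurable A' -> A `<=` A' ->
  (Defs.variation nu A <= Defs.variation nu A')%E.
Proof.
move=> mA mA' AA'; rewrite -(setDUK AA').
have mD := measurableD mA' mA.
apply: le_trans (variation_superadd mA mD _).
  by rewrite leeDl// variation_ge0.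
by rewrite setIDA setIC -setIDA setDv setI0.
Qed.

Lemma variation0 : Defs.variation nu set0 = 0%E.
Proof.
apply/eqP; rewrite eq_le variation_ge0// andbT.
apply: ge_ereal_sup => _ [n [F [mF tF F0 ->]]]; rewrite sumEFin lee_fin big1// => i _.
rewrite (_ : F i = set0) ?vector_measure0 ?nrm0//.
by rewrite -subset0 -F0 => t Fit; exists i.
Qed.

(** Each piece of a finite partition of the union is cut by the [A n], and the norm of
    its measure is at most the sum of the norms of the parts. *)
Lemma variation_sigma_sub (A : (set T)^nat) : (forall n, measurable (A n)) ->
  trivIset setT A ->
  (Defs.variation nu (\bigcup_n A n) <= \sum_(n <oo) Defs.variation nu (A n))%E.
Proof.
move=> mA tA; apply: ge_ereal_sup => _ [k [F [mF tF FA ->]]].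
have FE i : F i = \bigcup_n (F i `&` A n).
  rewrite -setI_bigcupr; apply/esym/setIidPl; rewrite -FA => t Fit; by exists i.
have tFA i : trivIset setT (fun n => F i `&` A n) by exact: trivIset_setIl.
have mFA i n : measurable (F i `&` A n) by exact: measurableI.
apply: (@le_trans _ _ (\sum_(i < k) \sum_(n <oo) (nrm (nu (F i `&` A n)))%:E)%E).
  apply: lee_sum => i _; rewrite [in leLHS]FE.
  have h := nu_ca (mFA i) (tFA i).
  have hn : (fun n => (nrm (\sum_(0 <= j < n) nu (F i `&` A j)))%:E) @ \oo -->
      (nrm (nu (\bigcup_n (F i `&` A n))))%:E.
    apply: cvg_EFin; first exact: nearW.
    exact: (@cvg_nrm R B _ _ _ (fun n => \sum_(0 <= j < n) nu (F i `&` A j)) _ h).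
  rewrite -(cvg_lim (@ereal_hausdorff _) hn)//.
  apply: lee_lim.
  - by apply/cvg_ex; eexists; exact: hn.
  - by apply: is_cvg_nneseries => n _ _; rewrite lee_fin nrm_ge0.
  - by apply: nearW => n; rewrite /= sumEFin lee_fin nrm_sum.
rewrite -nneseries_sum; last by move=> i j _; rewrite lee_fin nrm_ge0.
apply: lee_nneseries => [n _ _|n _]; first by rewrite sume_ge0// => i _; rewrite lee_fin nrm_ge0.
rewrite sumEFin; apply: variation_ge => //.
- by move=> i j _ _ [t [[ti _] [tj _]]]; apply: tF => //; exists t.
- rewrite -setI_bigcupl FA; apply/setIidPr => t At; by exists n.
Qed.

Lemma variation_measure : (Defs.variation nu setT < +oo)%E ->
  exists mu : {finite_measure set T -> \bar R},
    forall A, measurable A -> mu A = Defs.variation nu A.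
Proof.
move=> vfin; apply: finite_measure_of.
- exact: variation0.
- exact: variation_ge0.
- move=> A mA; rewrite ge0_fin_numE ?variation_ge0//.
  by rewrite (le_lt_trans _ vfin)// variation_le.
- move=> F mF tF; have V0 n : (0 <= Defs.variation nu (F n))%E by exact: variation_ge0.
  have cv := @is_cvg_nneseries _ (fun n => Defs.variation nu (F n)) xpredT 0%N (fun n _ _ => V0 n).
  suff <- : (\sum_(n <oo) Defs.variation nu (F n) = Defs.variation nu (\bigcup_n F n))%E by exact: cv.
  apply/eqP; rewrite eq_le variation_sigma_sub// andbT.
  apply: lime_le => //; apply: nearW => n.
  have mb k : measurable (\big[setU/set0]_(i < k) F i) by exact: bigsetU_measurable.
  apply: (@le_trans _ _ (Defs.variation nu (\big[setU/set0]_(i < n) F i))).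
    elim: n => [|n ih]; first by rewrite big_geq// big_ord0 variation0.
    rewrite big_nat_recr//= big_ord_recr/=.
    apply: le_trans (variation_superadd (mb n) (mF n) _); first by rewrite leeD2r.
    rewrite -subset0 => t [+ Fnt]; rewrite -bigcup_mkord => -[i /= iN Fit].
    have := tF i n Logic.I Logic.I (ex_intro _ t (conj Fit Fnt)) => ii.
    by move: iN; rewrite ii ltnn.
  apply: variation_le => //; first exact: bigcup_measurable.
  by rewrite -bigcup_mkord => t [i _ Fit]; exists i.
Qed.

Lemma variation_dominated (mu : {finite_measure set T -> \bar R}) (c : R) : 0 <= c ->
  (forall A, measurable A -> nrm (nu A) <= c * fine (mu A)) ->
  forall A, measurable A -> (Defs.variation nu A <= (c * fine (mu A))%:E)%E.
Proof.
move=> c0 h A mA; apply: ge_ereal_sup => _ [n [F [mF tF FA ->]]].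
rewrite sumEFin lee_fin (@le_trans _ _ (\sum_(i < n) c * fine (mu (F i))))//.
  by apply: ler_sum => i _; exact: h.
rewrite -mulr_sumr ler_wpM2l// -lee_fin -sumEFin measure_fineK//.
under eq_bigr do rewrite measure_fineK//.
rewrite -FA measure_fin_bigcup//; last exact: finite_finset.
rewrite -big_enum fsbig_seq ?enum_uniq// (_ : [set` enum 'I_n] = setT)//.
by apply/seteqP; split=> i //= _; rewrite mem_enum.
Qed.

End vector_measures.

(** * Radon measures and compactness *)

Section finite_measure_arith.
Context d (T : measurableType d) (R : realType) (mu : {finite_measure set T -> \bar R}).

Lemma fine_measure_le A A' : measurable A -> measurable A' -> A `<=` A' ->
  fine (mu A) <= fine (mu A').
Proof.
by move=> mA mA' AA'; rewrite -lee_fin !measure_fineK// le_measure// inE.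
Qed.

Lemma fine_measure_ge0 A : 0 <= fine (mu A).
Proof. by rewrite fine_ge0. Qed.

Lemma fine_measureU A A' : measurable A -> measurable A' -> A `&` A' = set0 ->
  fine (mu (A `|` A')) = fine (mu A) + fine (mu A').
Proof. by move=> mA mA' AA'; rewrite measureU// fineD// fin_num_measure. Qed.

Lemma fine_measureD A A' : measurable A -> measurable A' -> A `<=` A' ->
  fine (mu (A' `\` A)) = fine (mu A') - fine (mu A).
Proof.
move=> mA mA' AA'; have mD := measurableD mA' mA.
rewrite -[in RHS](setDUK AA') fine_measureU//; first by rewrite addrAC subrr add0r.
by rewrite setIDA setIC -setIDA setDv setI0.
Qed.

End finite_measure_arith.

Section radon_measures.
Variables (R : realType) (X : ptopologicalType).
Hypothesis hX : hausdorff_space X.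
Implicit Types (mu : {finite_measure set (borel X) -> \bar R}).

Lemma eq_radon (m m' : set (borel X) -> \bar R) :
  (forall A, measurable A -> m A = m' A) -> radon m -> radon m'.
Proof.
move=> mm [m1 m2]; split=> [A mA|U oU].
  rewrite -mm// m1//; congr ereal_inf; apply/seteqP; split=> _ [U [oU AU] <-];
    exists U => //; rewrite mm//; exact: open_borel.
rewrite -mm; last exact: open_borel.
by rewrite m2//; congr ereal_sup; apply/seteqP; split=> _ [K [cK KU] <-];
  exists K => //; rewrite mm//; exact: compact_borel.
Qed.

(** Regularity expressed by the measure of a difference of sets is inherited by every
    dominated measure. *)
Lemma radonP mu : radon mu <->
  (forall (A : set (borel X)) (e : R), measurable A -> 0 < e ->
     exists U : set X, [/\ open U, A `<=` U & fine (mu (U `\` A)) <= e]) /\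
  (forall (U : set X) (e : R), open U -> 0 < e ->
     exists K : set X, [/\ compact K, K `<=` U & fine (mu (U `\` K)) <= e]).
Proof.
split=> [[m1 m2]|[m1 m2]]; split.
- move=> A e mA e0.
  have fA : ereal_inf [set mu U | U in [set U : set X | open U /\ A `<=` U]] \is a fin_num.
    by rewrite -m1// fin_num_measure.
  have [_ [U [oU AU] <-]] := lb_ereal_inf_adherent e0 fA.
  rewrite -m1// => mU; exists U; split => //.
  have mU' := open_borel oU.
  rewrite fine_measureD// lerBlDl -lee_fin EFinD !measure_fineK//; exact: ltW.
- move=> U e oU e0.
  have mU := open_borel oU.
  have fU : ereal_sup [set mu K | K in [set K : set X | compact K /\ K `<=` U]] \is a fin_num.
    by rewrite -m2// fin_num_measure.
  have [_ [K [cK KU] <-]] := ub_ereal_sup_adherent e0 fU.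
  rewrite -m2// => mK; exists K; split => //.
  have mK' := compact_borel hX cK.
  rewrite fine_measureD// lerBlDr -lerBlDl -lee_fin EFinB !measure_fineK//; exact: ltW.
- move=> A mA; apply/eqP; rewrite eq_le; apply/andP; split.
    apply: le_ereal_inf_tmp => _ [U [oU AU] <-].
    by apply: le_measure => //; rewrite inE//; exact: open_borel.
  apply/lee_addgt0Pr => e e0; have [U [oU AU UA]] := m1 A e mA e0.
  have mU := open_borel oU.
  apply: (@le_trans _ _ (mu U)); first by apply: ereal_inf_lbound; exists U.
  rewrite -(measure_fineK mu mA) -(measure_fineK mu mU) -EFinD lee_fin -lerBlDl.
  by rewrite -fine_measureD.
- move=> U oU; have mU := open_borel oU; apply/eqP; rewrite eq_le; apply/andP; split; last first.
    apply: ge_ereal_sup => _ [K [cK KU] <-].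
    by apply: le_measure => //; rewrite inE//; exact: compact_borel.
  apply/lee_addgt0Pr => e e0; have [K [cK KU UK]] := m2 U e oU e0.
  have mK := compact_borel hX cK.
  apply: (@le_trans _ _ (mu K + e%:E)%E).
    rewrite -(measure_fineK mu mK) -(measure_fineK mu mU) -EFinD lee_fin -lerBlDl.
    by rewrite -fine_measureD.
  by rewrite leeD2r//; apply: ereal_sup_ubound; exists K.
Qed.

Lemma radon_dominated mu mu' (c : R) : 0 <= c ->
  (forall A, measurable A -> fine (mu' A) <= c * fine (mu A)) -> radon mu -> radon mu'.
Proof.
move=> c0 mm /radonP[m1 m2]; apply/radonP; have c1 : 0 < c + 1 by rewrite ltr_wpDl.
have small e a : 0 < e -> 0 <= a -> a <= e / (c + 1) -> c * a <= e.
  move=> e0 a0; rewrite ler_pdivlMr//; nra.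
split=> [A e mA e0|U e oU e0].
  have [U [oU AU UA]] := m1 A (e / (c + 1)) mA (divr_gt0 e0 c1).
  exists U; split => //; rewrite (le_trans (mm _ _))//.
    by apply: measurableD => //; exact: open_borel.
  by apply: small => //; exact: fine_measure_ge0.
have [K [cK KU UK]] := m2 U (e / (c + 1)) oU (divr_gt0 e0 c1).
exists K; split => //; rewrite (le_trans (mm _ _))//.
  by apply: measurableD; [exact: open_borel|exact: compact_borel].
by apply: small => //; exact: fine_measure_ge0.
Qed.

Lemma radon_tight mu (e : R) : radon mu -> 0 < e ->
  exists2 K : set X, compact K & fine (mu (~` K)) <= e.
Proof.
move=> /radonP[_ m2] e0; have [K [cK _]] := m2 setT e openT e0.
by rewrite setTD; exists K.
Qed.

(** A finite subcover made disjoint; integrals over [K] are discretised along such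
    partitions, with values frozen at the centres [c i]. *)
Lemma compact_borel_partition (K : set X) (V : X -> set X) : compact K ->
  (forall x, K x -> nbhs x (V x)) ->
  exists n (c : 'I_n -> X) (D : 'I_n -> set (borel X)),
    [/\ forall i, K (c i), forall i, measurable (D i), forall i, D i `<=` V (c i),
        trivIset setT D & \bigcup_i D i = K].
Proof.
move=> cK KV; have := cK; rewrite compact_cover => /(_ X K (fun x => (V x)^°)).
case.
- by move=> x Kx; exact: open_interior.
- by move=> x Kx; exists x => //; exact: KV.
move=> E EK KE; pose s : seq X := E; pose F k : set X := (V (nth point s k))^°.
have mF k : measurable (F k : set (borel X)) by apply: open_borel; exact: open_interior.
exists (size s), (fun i => nth point s i), (fun i => K `&` seqDU F i); split.
- by move=> i; apply/set_mem/EK/mem_nth.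
- move=> i; apply: measurableI; first exact: compact_borel.
  exact: (@seqDU_measurable _ (borel X)).
- by move=> i x [_ h]; apply: interior_subset; exact: (subset_seqDU h).
- move=> i j _ _ [x [[_ xi] [_ xj]]]; apply: val_inj.
  by apply: (@trivIset_seqDU _ F) => //; exists x.
- apply/seteqP; split=> [x [i _ []]//|x Kx].
  have [y /= yE Vx] := KE x Kx.
  have [k _ Fk] : (\bigcup_k seqDU (fun k => if (k < size s)%N then F k else set0) k) x.
    rewrite -seqDU_bigcup_eq; exists (index y s) => //.
    by rewrite index_mem yE /F nth_index.
  have ks : (k < size s)%N.
    by have := subset_seqDU Fk; case: ifP.
  exists (Ordinal ks) => //; split => //=.
  have [Fk1 nFk] := Fk; rewrite ks in Fk1; split => //; apply: contra_not nFk.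
  rewrite -(bigcup_mkord k F) -(bigcup_mkord k (fun l => if (l < size s)%N then F l else set0)).
  move=> [l /= lk Fl]; exists l => //=.
  by rewrite (ltn_trans lk ks).
Qed.

End radon_measures.

(** The tube lemma. *)
Lemma compact_uniform_near (R : realType) (Z Y : topologicalType)
    (B : normedModType R[i]) (f : Z * Y -> B) (K : set Y) (z0 : Z) (e : R) :
  compact K -> continuous f -> 0 < e ->
  \forall z \near z0, forall y, K y -> nrm (f (z, y) - f (z0, y)) < e.
Proof.
move=> /compact_near_coveringP cK cf e0.
apply: (cK Z (nbhs z0) (fun z y => nrm (f (z, y) - f (z0, y)) < e)) => y Ky.
have e20 : 0 < e / 2 by lra.
have /cvg_nrmP/(_ _ e20)[[A A'] /= [Az Ay] AA] := cf (z0, y).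
exists (A', A) => //= -[y' z] [/= A'y' Az'].
rewrite (le_lt_trans (nrm_triangle (f (z0, y)) _ _))// [ltRHS]splitr ltrD//.
  by rewrite nrmBC; apply: (AA (z, y')).
by apply: (AA (z0, y')); split => //=; exact: nbhs_singleton.
Qed.

Section dominated_operators.
Context d (T : measurableType d) (R : realType).

Lemma pairing_dominated (H : hilbertType R[i]) (eta : set T -> H)
    (mu : {finite_measure set T -> \bar R}) : countably_additive eta ->
  (forall A, measurable A -> mu A = Defs.variation eta A) ->
  @dominated_op d T R mu H (R[i] : hilbertType R[i]) (fun A b => inner b (eta A)).
Proof.
move=> ce muE; split=> [|A b mA]; last first.
  rewrite (le_trans (cauchy_schwarz _ _))// mulrC ler_wpM2r ?nrm_ge0//.
  by rewrite -lee_fin measure_fineK// muE// variation_nrm.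
split=> [A mA a u v|A A' b mA mA' AA']; first by rewrite innerDl innerZl.
by rewrite vector_measureU// innerDr.
Qed.

Lemma scalar_dominated (B : normedModType R[i]) (nu : set T -> B)
    (mu : {finite_measure set T -> \bar R}) : countably_additive nu ->
  (forall A, measurable A -> mu A = Defs.variation nu A) ->
  @dominated_op d T R mu (R[i] : hilbertType R[i]) B (fun A (c : R[i]) => c *: nu A).
Proof.
move=> ce muE; split=> [|A b mA]; last first.
  rewrite nrmZ mulrC ler_wpM2r ?nrm_ge0//.
  by rewrite -lee_fin measure_fineK// muE// variation_nrm.
split=> [A mA a u v|A A' b mA mA' AA']; first by rewrite scalerDl scalerA.
by rewrite vector_measureU// scalerDr.
Qed.

Lemma bochner_dominated (B : normedModType R[i]) (mu : {finite_measure set T -> \bar R}) :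
  @dominated_op d T R mu B B (fun A b => (fine (mu A))%:C *: b).
Proof. exact: bochner_dominated_op. Qed.

End dominated_operators.

(** * Positive definite kernels and the Schur product theorem *)

From mathcomp Require Import spectral.

(** By polarisation, since the values at [s + t] and at [s + i t] are real. *)
Lemma form_hermitian (R : realType) (V : Type) (comb : R[i] -> V -> V -> V)
    (B : V -> V -> R[i]) :
  (forall a s t u, B (comb a s t) u = a * B s u + B t u) ->
  (forall a s t u, B u (comb a s t) = Num.conj a * B u s + B u t) ->
  (forall s, 0 <= B s s) -> forall s t, B s t = Num.conj (B t s).
Proof.
move=> Bl Br B0 s t.
have ImB u : complex.Im (B u u) = 0 by rewrite (ge0_Re (B0 u)).
have := ImB (comb 1 s t); rewrite Bl !Br conjC1 !mul1r !raddfD/= !ImB add0r addr0 => h1.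
have := ImB (comb 'i s t); rewrite Bl !Br conjCi.
move: h1 (ImB s) (ImB t).
case: (B s s) => x x'; case: (B t t) => y y'; case: (B s t) => a b; case: (B t s) => a' b' /=.
move=> h1 -> -> h2; apply/eqP; rewrite eq_complex /=.
by apply/andP; split; apply/eqP; lra.
Qed.

Section psd_matrix.
Variable R : realType.
Local Notation C := R[i].

(** The spectral theorem for the matrix [A], which is Hermitian by [form_hermitian]. *)
Lemma psd_decomposition n (A : 'I_n -> 'I_n -> C) :
  (forall c : 'I_n -> C, 0 <= \sum_(i < n) \sum_(j < n) A i j * c j * Num.conj (c i)) ->
  exists (d : 'I_n -> C) (P : 'I_n -> 'I_n -> C),
    (forall k, 0 <= d k) /\
    forall i j, A i j = \sum_(k < n) d k * Num.conj (P k i) * P k j.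
Proof.
move=> A0; pose V := 'I_n -> C.
pose comb (a : C) (s t : V) : V := fun i => a * s i + t i.
pose B (s t : V) : C := \sum_(i < n) \sum_(j < n) A i j * s j * Num.conj (t i).
have Bh : forall s t, B s t = Num.conj (B t s).
  apply: (@form_hermitian R V comb B) => //.
  - move=> a s t u; rewrite /B mulr_sumr -big_split; apply: eq_bigr => i _.
    by rewrite mulr_sumr -big_split; apply: eq_bigr => j _; rewrite /comb /=; ring.
  - move=> a s t u; rewrite /B mulr_sumr -big_split; apply: eq_bigr => i _.
    rewrite mulr_sumr -big_split; apply: eq_bigr => j _; rewrite /comb /=.
    by rewrite rmorphD rmorphM/=; ring.
pose del (i : 'I_n) : V := fun j => (j == i)%:R.
have BA i j : B (del j) (del i) = A i j.
  rewrite /B (bigD1 i)//= (bigD1 j)//= /del !eqxx conjC1 !mulr1 big1 ?addr0; last first.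
    by move=> k /negbTE ->; rewrite mulr0 mul0r.
  rewrite big1 ?addr0// => k /negbTE ki; rewrite big1// => l _.
  by rewrite ki conjC0 mulr0.
have Ah i j : A i j = Num.conj (A j i) by rewrite -!BA.
pose M : 'M[C]_n := \matrix_(i, j) A i j.
have MH : map_mx Num.conj M^T = M by apply/matrixP => i j; rewrite !mxE -Ah.
have /orthomx_spectralP : M \is normalmx by apply/normalmxP; rewrite MH.
set P := spectralmx M; set d := spectral_diag M.
have Pu : P \is unitarymx by exact: spectral_unitarymx.
rewrite invmx_unitary// => ME.
have entry i j : A i j = \sum_(k < n) d ord0 k * Num.conj (P k i) * P k j.
  have /matrixP/(_ i j) := ME; rewrite [in LHS]mxE => ->; rewrite mxE; apply: eq_bigr => k _.
  rewrite mxE (bigD1 k)//= big1 => [|l lk].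
    by rewrite addr0 !mxE eqxx mulr1n; ring.
  by rewrite !mxE (negbTE lk) mulr0n mulr0.
exists (fun k => d ord0 k), (fun k i => P k i); split => // k.
have := A0 (fun j => Num.conj (P k j)).
rewrite (_ : (\sum_(i < n) _) = d ord0 k)//.
have PP : P *m map_mx Num.conj P^T = 1%:M by exact/unitarymxP.
have PPe l : \sum_(j < n) P l j * Num.conj (P k j) = (l == k)%:R.
  have /matrixP/(_ l k) := PP; rewrite !mxE => <-.
  by apply: eq_bigr => j _; rewrite !mxE.
transitivity (\sum_(l < n) d ord0 l * (\sum_(i < n) P k i * Num.conj (P l i)) *
    (\sum_(j < n) P l j * Num.conj (P k j))).
  transitivity (\sum_(i < n) \sum_(j < n) \sum_(l < n)
      d ord0 l * (P k i * Num.conj (P l i)) * (P l j * Num.conj (P k j))).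
    apply: eq_bigr => i _; apply: eq_bigr => j _; rewrite entry conjCK -mulrA mulr_suml.
    by apply: eq_bigr => l _; ring.
  transitivity (\sum_(i < n) \sum_(l < n) d ord0 l * (P k i * Num.conj (P l i)) *
       (\sum_(j < n) P l j * Num.conj (P k j))).
    apply: eq_bigr => i _; rewrite exchange_big; apply: eq_bigr => l _.
    by rewrite mulr_sumr.
  by rewrite exchange_big; apply: eq_bigr => l _; rewrite -mulr_suml -mulr_sumr.
rewrite (bigD1 k)//= !PPe eqxx !mulr1 big1 ?addr0// => l lk.
by rewrite !PPe (negbTE lk) !mulr0.
Qed.

End psd_matrix.

Section kernel_forms.
Variables (R : realType) (X : choiceType) (H : hilbertType R[i]).
Local Notation C := R[i].
Implicit Types (K : X -> X -> bop H) (s t : seq (X * H)).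

(** Formal sums may repeat a point, which makes them closed under [kcomb]; positivity
    persists by [kform_ge0]. *)
Definition kform K s t : C :=
  \sum_(a <- s) \sum_(b <- t) inner (K b.1 a.1 a.2) b.2.

Definition kcomb (c : C) s t := [seq (a.1, c *: a.2) | a <- s] ++ t.

Lemma kform_combl K c s t u : kform K (kcomb c s t) u = c * kform K s u + kform K t u.
Proof.
rewrite /kform big_cat big_map/= mulr_sumr; congr (_ + _); apply: eq_bigr => a _.
by rewrite mulr_sumr; apply: eq_bigr => b _; rewrite linearZ innerZl.
Qed.

Lemma kform_combr K c s t u :
  kform K u (kcomb c s t) = Num.conj c * kform K u s + kform K u t.
Proof.
rewrite /kform mulr_sumr -big_split; apply: eq_bigr => a _.
rewrite big_cat big_map/= mulr_sumr; congr (_ + _); apply: eq_bigr => b _.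
by rewrite innerZr.
Qed.

Lemma kernel_form_kform K n (x : 'I_n -> X) (v : 'I_n -> H) (s : seq (X * H)) :
  s = [seq (x i, v i) | i <- enum 'I_n] -> kform K s s = kernel_form K x v.
Proof.
move=> ->; rewrite /kform /kernel_form big_map big_enum/=.
under eq_bigr do rewrite big_map big_enum/=.
by rewrite exchange_big.
Qed.

(** Merging the vectors attached to equal points leads back to distinct points. *)
Lemma kform_ge0 K s : pd_kernel K -> 0 <= kform K s s.
Proof.
move=> pdK; pose E := undup [seq a.1 | a <- s]; pose m := size E.
have aE (a : X * H) : a \in s -> (index a.1 E < m)%N.
  by move=> sa; rewrite index_mem mem_undup; apply: map_f.
case: (posnP m) => [m0|m0].
  case: s @E @m aE m0 => [|a s] E m aE m0; first by rewrite /kform big_nil.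
  by have := aE a (mem_head _ _); rewrite m0.
have [x0 x0s] : exists x0, x0 \in s.
  by case: s @E @m aE m0 => [|a s] E m aE m0 //; exists a; exact: mem_head.
pose p (a : X * H) : 'I_m := insubd (Ordinal m0) (index a.1 E).
have pE a : a \in s -> nth x0.1 E (p a) = a.1.
  by move=> sa; rewrite /p val_insubd aE// nth_index// -index_mem aE.
pose y (i : 'I_m) := nth x0.1 E i.
pose w (i : 'I_m) := \sum_(a <- s | p a == i) a.2.
have yinj : injective y.
  move=> i j /eqP; rewrite nth_uniq ?undup_uniq//; first by move=> /eqP/val_inj.
have -> : kform K s s = kernel_form K y w; last exact: pdK.
rewrite /kernel_form /kform exchange_big/= big_seq.
transitivity (\sum_(b <- s) \sum_(a <- s) inner (K (y (p b)) (y (p a)) a.2) b.2).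
  rewrite [in RHS]big_seq; apply: eq_bigr => b sb; rewrite big_seq [in RHS]big_seq.
  by apply: eq_bigr => a sa; rewrite /y !pE.
rewrite (partition_big p predT)//=; apply: eq_bigr => i _.
transitivity (\sum_(b <- s | p b == i) \sum_(j < m) inner (K (y i) (y j) (w j)) b.2).
  apply: eq_bigr => b /eqP ->; rewrite (partition_big p predT)//=.
  apply: eq_bigr => j _; rewrite /w linear_sum inner_suml; apply: eq_bigr => a /eqP -> //.
rewrite exchange_big; apply: eq_bigr => j _; rewrite -inner_sumr //.
Qed.

Lemma kernel_form_ge0 K n (x : 'I_n -> X) (v : 'I_n -> H) : pd_kernel K ->
  0 <= kernel_form K x v.
Proof. by move=> pdK; rewrite -(kernel_form_kform K erefl); exact: kform_ge0. Qed.

Lemma kform_hermitian K s t : pd_kernel K -> kform K s t = Num.conj (kform K t s).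
Proof.
move=> pdK; apply: (@form_hermitian R _ kcomb (kform K)).
- by move=> *; exact: kform_combl.
- by move=> *; exact: kform_combr.
- by move=> *; exact: kform_ge0.
Qed.

Lemma kernel_hermitian K x y u v : pd_kernel K ->
  inner (K x y u) v = inner u (K y x v).
Proof.
move=> pdK; have := kform_hermitian [:: (y, u)] [:: (x, v)] pdK.
by rewrite /kform !big_seq1/= => ->; rewrite -innerC.
Qed.

Lemma kform_cauchy_schwarz K s t : pd_kernel K ->
  nrm (kform K s t) ^+ 2 <= complex.Re (kform K s s) * complex.Re (kform K t t).
Proof.
move=> pdK; apply: (@form_cauchy_schwarz R _ kcomb (kform K)).
- by move=> *; exact: kform_combl.
- by move=> *; exact: kform_ge0.
- by move=> *; exact: kform_hermitian.
Qed.

Lemma kformD K K' s t : kform (fun x y => K x y + K' x y) s t = kform K s t + kform K' s t.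
Proof.
rewrite /kform -big_split; apply: eq_bigr => a _; rewrite -big_split; apply: eq_bigr => b _.
by rewrite bopD innerDl.
Qed.

Lemma psd_op_cauchy_schwarz (T : bop H) u v : psd_op T ->
  nrm (inner (T u) v) ^+ 2 <= complex.Re (inner (T u) u) * complex.Re (inner (T v) v).
Proof.
move=> T0.
have Tl a (s t z : H) : inner (T (a *: s + t)) z = a * inner (T s) z + inner (T t) z.
  by rewrite linearP innerDl innerZl.
apply: (@form_cauchy_schwarz R H (fun a x y => a *: x + y) (fun u v => inner (T u) v)) => //.
apply: (@form_hermitian R H (fun a x y => a *: x + y)) => //.
by move=> a s t z; rewrite innerDr innerZr.
Qed.

Lemma psd_op_sym (T : bop H) u v : psd_op T -> inner (T u) v = inner u (T v).
Proof.
move=> T0; rewrite [RHS]innerC.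
apply: (@form_hermitian R H (fun a x y => a *: x + y) (fun u v => inner (T u) v)) => //.
- by move=> a s t z; rewrite linearP innerDl innerZl.
- by move=> a s t z; rewrite innerDr innerZr.
Qed.

Lemma psd_op_ker (T : bop H) u : psd_op T -> inner (T u) u = 0 -> T u = 0.
Proof.
move=> T0 Tu; apply: inner_eq0; apply: nrm0_eq0; apply/eqP.
rewrite -sqrf_eq0 eq_le sqr_ge0 andbT.
by rewrite (le_trans (psd_op_cauchy_schwarz _ _ T0))// Tu/= mul0r.
Qed.

End kernel_forms.

Section schur.
Variables (R : realType) (X : choiceType) (H : hilbertType R[i]).
Local Notation C := R[i].

Lemma scalar_kernel_formE (p : X -> X -> C) n (x : 'I_n -> X) (c : 'I_n -> C) :
  kernel_form (scalar_kernel p) x (c : 'I_n -> (C : hilbertType C)) =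
  \sum_(i < n) \sum_(j < n) p (x i) (x j) * c j * Num.conj (c i).
Proof. by []. Qed.

(** The Schur product theorem with an operator as second factor: the first factor is
    split into rank one matrices. *)
Lemma schur_kernel (p : X -> X -> C) (T : bop H) :
  pd_kernel (scalar_kernel p) -> psd_op T -> pd_kernel (fun x y => p x y *: T).
Proof.
move=> pdp T0 n x v _.
have [c|d [P [d0 pE]]] := @psd_decomposition R n (fun i j => p (x i) (x j)).
  rewrite -scalar_kernel_formE; exact: kernel_form_ge0.
pose z k := \sum_(j < n) P k j *: v j.
suff -> : kernel_form (fun x y => p x y *: T) x v = \sum_(k < n) d k * inner (T (z k)) (z k).
  by apply: sumr_ge0 => k _; rewrite mulr_ge0.
rewrite /kernel_form.
transitivity (\sum_(i < n) \sum_(j < n) \sum_(k < n)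
    d k * (P k j * (Num.conj (P k i) * inner (T (v j)) (v i)))).
  apply: eq_bigr => i _; apply: eq_bigr => j _; rewrite bopZ innerZl pE mulr_suml.
  by apply: eq_bigr => k _; ring.
under eq_bigr do rewrite exchange_big/=.
rewrite exchange_big/=; apply: eq_bigr => k _.
rewrite {2}/z inner_sumr mulr_sumr; apply: eq_bigr => i _.
rewrite innerZr /z linear_sum inner_suml !mulr_sumr; apply: eq_bigr => j _.
by rewrite linearZ innerZl; ring.
Qed.

End schur.

(** * Mixtures of kernels over a set of parameters *)

Lemma ge0_closed (R : realType) (z : R[i]) :
  (forall e : R, 0 < e -> exists2 z' : R[i], 0 <= z' & nrm (z - z') <= e) -> 0 <= z.
Proof.
move=> h.
have Im0 : complex.Im z = 0.
  apply/eqP; rewrite -normr_eq0 eq_le normr_ge0 andbT.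
  apply/ler_addgt0Pl => e e0; rewrite addr0; have [z' z'0 zz'] := h e e0.
  rewrite (le_trans _ zz')// (le_trans _ (Im_abs_nrm _))// raddfB/=.
  by rewrite (ge0_Re z'0)/= subr0.
have Re0 : 0 <= complex.Re z.
  apply/ler_addgt0Pl => e e0; have [z' z'0 zz'] := h e e0.
  have := le_trans (Re_abs_nrm _) zz'; rewrite raddfB/= ler_norml => /andP[+ _].
  have : 0 <= complex.Re z' by rewrite -ler0c -(ge0_Re z'0).
  lra.
by rewrite (_ : z = (complex.Re z)%:C) ?ler0c//; case: z Im0 {h Re0} => a b /= ->.
Qed.

Lemma is_bochner_intE d (T : measurableType d) (R : realType) (B : normedModType R[i])
    (mu : set T -> \bar R) (f : T -> B) (I : B) :
  is_bochner_integral mu f I = is_int mu (fun A b => (fine (mu A))%:C *: b) f I.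
Proof. by []. Qed.

Lemma bochner_integral_is d (T : measurableType d) (R : realType) (B : normedModType R[i])
    (mu : set T -> \bar R) (f : T -> B) (I : B) :
  is_bochner_integral mu f I -> is_bochner_integral mu f (bochner_integral mu f).
Proof. by move=> fI; rewrite /bochner_integral; case: xgetP => [T' -> //|/(_ I)]. Qed.

Lemma small_factor (R : realType) (e a : R) : 0 < e -> 0 <= a ->
  exists2 d : R, 0 < d & d * a < e.
Proof.
move=> e0 a0; have a1 : 0 < a + 1 by lra.
exists (e / (a + 1)); first exact: divr_gt0.
by rewrite mulrAC ltr_pdivrMr// ltr_pM2l//; lra.
Qed.

Lemma trivIset_indic_sum (T : Type) (R : pzRingType) n (D : 'I_n -> set T)
    (c : 'I_n -> R) (k : 'I_n) t : trivIset setT D -> D k t ->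
  \sum_(l < n) \1_(D l) t * c l = c k.
Proof.
move=> tD Dk; rewrite (bigD1 k)//= indicE mem_set// mul1r big1 ?addr0// => l /eqP lk.
rewrite indicE memNset ?mul0r// => Dl; apply: lk; apply: tD => //; by exists t.
Qed.

Lemma indic_sum0 (T : Type) (R : pzRingType) n (D : 'I_n -> set T) (c : 'I_n -> R) t :
  (forall l, ~ D l t) -> \sum_(l < n) \1_(D l) t * c l = 0.
Proof. by move=> nD; rewrite big1// => l _; rewrite indicE memNset ?mul0r. Qed.

Lemma continuous_pair (X Y Z : topologicalType) (f : X -> Y) (g : X -> Z) :
  continuous f -> continuous g -> continuous (fun x => (f x, g x)).
Proof. by move=> cf cg x; exact: (cvg_pair (cf x) (cg x)). Qed.

Lemma continuous_pr1 (X Y Z : topologicalType) (f : X -> Y * Z) :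
  continuous f -> continuous (fun x => (f x).1).
Proof. by move=> cf x; apply: (cvg_comp _ _ (cf x)); exact: cvg_fst. Qed.

Lemma continuous_pr2 (X Y Z : topologicalType) (f : X -> Y * Z) :
  continuous f -> continuous (fun x => (f x).2).
Proof. by move=> cf x; apply: (cvg_comp _ _ (cf x)); exact: cvg_snd. Qed.

Lemma continuous_compose (X Y Z : topologicalType) (f : X -> Y) (g : Y -> Z) :
  continuous f -> continuous g -> continuous (fun x => g (f x)).
Proof. by move=> cf cg x; apply: (cvg_comp _ _ (cf x)); exact: cg. Qed.

Lemma continuous_id (X : topologicalType) : continuous (@id X).
Proof. by move=> x; exact: cvg_id. Qed.

Lemma continuous_const (X Y : topologicalType) (y : Y) : continuous (fun _ : X => y).
Proof. by move=> x; exact: cvg_cst. Qed.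

Section operator_measure.
Variables (R : realType) (H : hilbertType R[i]) (Omega : ptopologicalType).
Local Notation C := R[i].
Variables (Lam : set (borel Omega) -> bop H).
Hypothesis LamR : radon_nonneg_opmeasure Lam.
Hypothesis hO : hausdorff_space Omega.

Lemma opmeasure_variation : exists2 mu : {finite_measure set (borel Omega) -> \bar R},
  forall A, measurable A -> mu A = Defs.variation Lam A & radon mu.
Proof.
have [ca fin _ rad] := LamR; have [mu muE] := variation_measure ca fin.
by exists mu => //; apply: eq_radon rad => // A mA; rewrite muE.
Qed.

(** Regularity is inherited from the variation of [Lam], which dominates. *)
Lemma opmeasure_scalar (v : H) :
  exists2 Lam_v : {finite_measure set (borel Omega) -> \bar R},
    forall A : set (borel Omega), measurable A -> inner (Lam A v) v = (fine (Lam_v A))%:C &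
    radon (Lam_v : set (borel Omega) -> \bar R).
Proof.
have [ca _ psd _] := LamR; have [mu muE rmu] := opmeasure_variation.
pose m (A : set (borel Omega)) : \bar R := (complex.Re (inner (Lam A v) v))%:E.
have [|A mA|A mA|F mF tF|nu nuE] := @finite_measure_of _ _ R m.
- by rewrite /m vector_measure0// bop0 inner0l.
- by rewrite lee_fin -ler0c -ge0_Re psd.
- by [].
- rewrite (_ : (fun n => _) = (fun n => (complex.Re (inner ((\sum_(0 <= i < n) Lam (F i)) v) v))%:E)).
    apply: cvg_EFin; first exact: nearW.
    have cl := ca F mF tF.
    apply/cvgrPdist_lt => e e0; have v0 : 0 < nrm v * nrm v + 1.
      by rewrite ltr_wpDl// mulr_ge0 ?nrm_ge0.
    have /cvg_nrmP/(_ _ (divr_gt0 e0 v0)) := cl; apply: filterS => n hn.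
    rewrite -raddfB/= -innerBl -bopB (le_lt_trans (Re_abs_nrm _))//.
    rewrite (le_lt_trans (cauchy_schwarz _ _))//.
    rewrite (@le_lt_trans _ _ (nrm (Lam (\bigcup_n F n) - \sum_(0 <= i < n) Lam (F i)) *
      (nrm v * nrm v + 1)))//.
      rewrite mulrDr mulr1 -[leLHS]addr0 lerD ?nrm_ge0// mulrA ler_wpM2r ?nrm_ge0//.
      exact: nrm_bop_le.
    by rewrite -ltr_pdivlMr.
  by apply/funext => n; rewrite /m sumEFin bop_sum inner_suml [in RHS]raddf_sum.
exists nu.
  by move=> A mA; rewrite nuE//= -ge0_Re// psd.
have nulam A : measurable A -> fine (nu A) <= nrm v ^+ 2 * fine (mu A).
  move=> mA; rewrite nuE//= (le_trans (Re_le_nrm _))// (le_trans (cauchy_schwarz _ _))//.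
  rewrite expr2 [leRHS]mulrC mulrA ler_wpM2r ?nrm_ge0//.
  rewrite (le_trans (nrm_bop_le _ _))// ler_wpM2r ?nrm_ge0//.
  by rewrite -lee_fin measure_fineK// muE// variation_nrm.
by apply: (radon_dominated hO _ nulam rmu); rewrite exprn_ge0// nrm_ge0.
Qed.

Lemma opmeasure_mono A A' v : measurable A -> measurable A' -> A `<=` A' ->
  inner (Lam A v) v <= inner (Lam A' v) v.
Proof.
move=> mA mA' AA'; have [ca _ psd _] := LamR.
have := psd _ (measurableD mA' mA) v; rewrite vector_measureD// bopB innerBl.
by rewrite subr_ge0.
Qed.

End operator_measure.

(** The variation of [Lam] enters as a measure [mu]. The pair [lam], [G] is kept apart:
    it only serves to identify [P] and to differentiate [Lam]. *)
Record mixture_data (R : realType) (H : hilbertType R[i]) (X Omega : ptopologicalType)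
    (p : Omega -> X -> X -> R[i]) (Lam : set (borel Omega) -> bop H) (M : R)
    (mu : {finite_measure set (borel Omega) -> \bar R}) : Prop := MixtureData {
  mixture_hausdorff : hausdorff_space Omega ;
  mixture_bounded : forall w x y, nrm (p w x y) <= M ;
  mixture_continuous : continuous (fun t : Omega * X * X => p t.1.1 t.1.2 t.2) ;
  mixture_pd : forall w, pd_kernel (scalar_kernel (p w)) ;
  mixture_opmeasure : radon_nonneg_opmeasure Lam ;
  mixture_variation : forall A, measurable A -> mu A = Defs.variation Lam A ;
  mixture_radon : radon mu }.

Section mixtures.
Variables (R : realType) (H : hilbertType R[i]) (X Omega : ptopologicalType).
Local Notation C := R[i].
Variables (p : Omega -> X -> X -> C) (Lam : set (borel Omega) -> bop H) (M : R).
Variables (mu : {finite_measure set (borel Omega) -> \bar R}).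
Hypothesis D : mixture_data p Lam M mu.

Let hO := mixture_hausdorff D.
Let pM := mixture_bounded D.
Let pc := mixture_continuous D.
Let ppd := mixture_pd D.
Let LamR := mixture_opmeasure D.
Let muE := mixture_variation D.
Let mu_radon := mixture_radon D.

Let M0 : 0 <= M.
Proof. by rewrite (le_trans _ (pM point point point))// nrm_ge0. Qed.

(** The integral of a scalar function against [Lam] itself. For bounded limits of simple
    functions it is the Bochner integral of [phi G] by [bochner_Lint]. *)
Definition is_Lint (phi : borel Omega -> C) (T : bop H) :=
  is_int mu (fun A (c : (C : normedModType C)) => c *: Lam A) phi T.

Lemma Lam_ca : countably_additive Lam. Proof. by case: LamR. Qed.
Lemma Lam_psd A : measurable A -> psd_op (Lam A). Proof. by case: LamR => _ _ h _; exact: h. Qed.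

Lemma Lam_dominated :
  @dominated_op _ (borel Omega) R mu (C : hilbertType C) (bop H) (fun A (c : C) => c *: Lam A).
Proof. exact: scalar_dominated Lam_ca muE. Qed.

Lemma Lint_indic A : measurable A -> is_Lint (fun w => \1_A w) (Lam A).
Proof.
move=> mA; have := is_int_indic Lam_dominated (1 : C) mA; rewrite scale1r.
suff -> : (fun w => (\1_A w : C) *: (1 : C)) = (fun w => \1_A w) by [].
by apply/funext => w; rewrite [LHS]mulr1.
Qed.

Lemma p_continuousl x y : continuous (fun w => p w x y).
Proof.
have h1 : continuous (fun w : Omega => (w, x, y)).
  apply: continuous_pair; last exact: continuous_const.
  by apply: continuous_pair; [exact: continuous_id|exact: continuous_const].
exact: (continuous_compose h1 pc).
Qed.

Lemma p_simple_limit x y : exists s c, simple_limit (fun w : borel Omega => p w x y) s c.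
Proof.
apply: (@continuous_simple_limit R Omega C (fun w => p w x y) M) => //.
  exact: complex_dense_seq.
exact: p_continuousl.
Qed.

Lemma simple_limit_indic (A : set (borel Omega)) (F : borel Omega -> C) s c :
  measurable A -> simple_limit F s c ->
  simple_limit (fun w => \1_A w * F w) (fun n w => \1_A w * s n w) c.
Proof.
move=> mA [fs sF sc]; split=> [n|w|n w].
- have := finitely_valued_comp (fun z : bool * C => z.1%:R * z.2)
    (finitely_valued_pair (finitely_valued_mem mA) (fs n)).
  by congr finitely_valued; apply/funext => w; rewrite indicE.
- by apply: cvgM; [exact: cvg_cst|exact: sF].
- rewrite -mulrBr nrmM; apply: le_trans (sc n w).
  by rewrite ler_piMl ?nrm_ge0// nrm_indic_le1.
Qed.

(** Partial integrals localise [P] in the parameter: by [mixture_onD] and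
    [mixture_on_pd], [P - P_A] is positive definite. *)
Definition mixture_on (A : set (borel Omega)) x y : bop H :=
  xget 0 (is_Lint (fun w => \1_A w * p w x y)).

Lemma mixture_onP A x y : measurable A -> is_Lint (fun w => \1_A w * p w x y) (mixture_on A x y).
Proof.
move=> mA; have [s [c sp]] := p_simple_limit x y.
have sL := simple_limit_L1 mu (simple_limit_indic mA sp).
have [T hT] := is_int_exists Lam_dominated sL.
by rewrite /mixture_on; case: xgetP => [T' -> //|/(_ T)].
Qed.

Lemma Lint_unique phi T T' : is_Lint phi T -> is_Lint phi T' -> T = T'.
Proof. by move=> h h'; exact: (is_int_unique Lam_dominated h h'). Qed.

Lemma indic_nrm_le (A : set (borel Omega)) w (z : C) : nrm ((\1_A w : C) * z) <= nrm z.
Proof.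
rewrite indicE; case: (_ \in _); rewrite ?mul1r// mul0r nrm0; exact: nrm_ge0.
Qed.

Lemma mixture_onD A x y : measurable A ->
  mixture_on setT x y = mixture_on A x y + mixture_on (~` A) x y.
Proof.
move=> mA; apply: Lint_unique (mixture_onP _ _ measurableT) _.
have := is_intD Lam_dominated (mixture_onP x y mA) (mixture_onP x y (measurableC mA)).
rewrite /is_Lint (_ : (fun w => _ + _) = (fun w => \1_setT w * p w x y))//.
apply/funext => w; rewrite -mulrDl; congr (_ * _); rewrite indicT !indicE in_setC.
by case: (_ \in _); rewrite ?addr0 ?add0r.
Qed.

Lemma mixture_on_bounded A x y : measurable A -> nrm (mixture_on A x y) <= M * fine (mu A).
Proof.
move=> mA; have := is_int_bound Lam_dominated M0 (lexx 0) mA _ _ (mixture_onP x y mA).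
rewrite mul0r addr0; apply=> w Aw; first by rewrite (le_trans (indic_nrm_le _ _ _)).
by rewrite indicE memNset// mul0r nrm0.
Qed.

(** On a compact set of parameters [p_w] is continuous uniformly in [w], and the other
    parameters have small measure. *)
Lemma mixture_on_continuous A : measurable A -> continuous (fun z : X * X => mixture_on A z.1 z.2).
Proof.
move=> mA z0; apply/cvg_nrmP => e e0.
have e20 : 0 < e / 2 by lra.
have [e1 e10 he1] := small_factor e20 (fine_measure_ge0 mu setT).
have [e2 e20' he2] := small_factor e20 (mulr_ge0 (ler0n R 2) M0).
have [K cK Ke] := radon_tight hO mu_radon e20'.
have mK := compact_borel hO cK.
pose f (u : (X * X) * Omega) : C := p u.2 u.1.1 u.1.2.
have cf : continuous f.
  have h1 : continuous (fun u : (X * X) * Omega => (u.2, u.1.1, u.1.2)).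
    have c0 : continuous (fun u : (X * X) * Omega => u) by exact: continuous_id.
    have c1 := continuous_pr1 c0.
    apply: continuous_pair; last exact: (continuous_pr2 c1).
    by apply: continuous_pair; [exact: (continuous_pr2 c0)|exact: (continuous_pr1 c1)].
  exact: (continuous_compose h1 pc).
apply: filterS (compact_uniform_near z0 cK cf e10) => z hz.
have := is_intB Lam_dominated (mixture_onP z0.1 z0.2 mA) (mixture_onP z.1 z.2 mA).
move=> /(is_int_bound Lam_dominated (ltW e10) (mulr_ge0 (ler0n R 2) M0) mK) h.
rewrite (@le_lt_trans _ _ (e1 * fine (mu K) + 2 * M * fine (mu (~` K))))//.
  apply: h => w Kw; rewrite -mulrBr (le_trans (indic_nrm_le _ _ _))//.
    by rewrite nrmBC ltW// hz.
  by rewrite (le_trans (nrm_normD _ _))// nrmN mulr_natl mulr2n lerD.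
have h1 : e1 * fine (mu K) <= e1 * fine (mu setT).
  by rewrite ler_wpM2l ?(ltW e10)// fine_measure_le.
have h2 : 2 * M * fine (mu (~` K)) <= e2 * (2 * M).
  by rewrite [leRHS]mulrC ler_wpM2l// mulr_ge0.
lra.
Qed.

Lemma p_continuousr w : continuous (fun z : X * X => p w z.1 z.2).
Proof.
have c0 : continuous (fun z : X * X => z) by exact: continuous_id.
have c1 : continuous (fun z : X * X => (w, z.1, z.2)).
  apply: continuous_pair; last exact: (continuous_pr2 c0).
  by apply: continuous_pair; [exact: continuous_const|exact: (continuous_pr1 c0)].
exact: (continuous_compose c1 pc).
Qed.

(** Discretising [Lam] along a partition of a compact set of parameters keeps positive
    definiteness, by the Schur product theorem. *)
Lemma mixture_on_pd A : measurable A -> pd_kernel (mixture_on A).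
Proof.
move=> mA n x v _; apply: ge0_closed => e e0.
pose S := \sum_(i < n) \sum_(j < n) nrm (v j) * nrm (v i).
have S0 : 0 <= S by apply: sumr_ge0 => i _; apply: sumr_ge0 => j _; rewrite mulr_ge0 ?nrm_ge0.
have [d d0 dS] := small_factor e0 S0.
have d20 : 0 < d / 2 by lra.
have [e1 e10 he1] := small_factor d20 (fine_measure_ge0 mu setT).
have [e2 e20 he2] := small_factor d20 M0.
have [K cK Ke] := radon_tight hO mu_radon e20.
have mK := compact_borel hO cK.
pose V w := [set w' | forall i j : 'I_n, nrm (p w' (x i) (x j) - p w (x i) (x j)) <= e1].
have nV w : nbhs w (V w).
  apply: filter_forall => i; apply: filter_forall => j.
  have /cvg_nrmP/(_ e1 e10) := @p_continuousl (x i) (x j) w.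
  by apply: filterS => w'; rewrite nrmBC => /ltW.
have [m [c [Dk [_ mD DV tD DK]]]] := compact_borel_partition hO cK (fun w _ => nV w).
have mDA k : measurable (Dk k `&` A) by exact: measurableI.
pose T i j := \sum_(k < m) p (c k) (x i) (x j) *: Lam (Dk k `&` A).
have TP i j : is_Lint (fun w => \sum_(k < m) p (c k) (x i) (x j) *: (\1_(Dk k `&` A) w : C)) (T i j).
  apply: (@is_int_sum _ _ _ mu _ _ _ Lam_dominated) => k.
  exact: (is_intZ Lam_dominated _ (Lint_indic (mDA k))).
have dist i j : nrm (mixture_on A (x i) (x j) - T i j) <= d.
  have := is_intB Lam_dominated (mixture_onP (x i) (x j) mA) (TP i j).
  move=> /(is_int_bound Lam_dominated (ltW e10) M0 mK) h.
  apply: (@le_trans _ _ (e1 * fine (mu K) + M * fine (mu (~` K)))).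
    have sumE w : \sum_(k < m) p (c k) (x i) (x j) *: (\1_(Dk k `&` A) w : C) =
        \1_A w * (\sum_(k < m) \1_(Dk k) w * p (c k) (x i) (x j)).
      rewrite mulr_sumr; apply: eq_bigr => k _; rewrite indicI -[_ *: _]/(_ * _).
      by rewrite /=; ring.
    apply: h => w Kw; rewrite sumE -mulrBr (le_trans (indic_nrm_le _ _ _))//.
      have [k _ Dkw] : (\bigcup_i Dk i) w by rewrite DK.
      by rewrite (trivIset_indic_sum _ tD Dkw); exact: DV.
    by rewrite indic_sum0 ?subr0// => k Dkw; apply: Kw; rewrite -DK; exists k.
  have h1 : e1 * fine (mu K) <= e1 * fine (mu setT).
    by rewrite ler_wpM2l ?(ltW e10)// fine_measure_le.
  have h2 : M * fine (mu (~` K)) <= e2 * M by rewrite [leRHS]mulrC ler_wpM2l.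
  lra.
exists (\sum_(i < n) \sum_(j < n) inner (T i j (v j)) (v i)).
  rewrite (_ : \sum_(i < n) _ = \sum_(k < m)
      kernel_form (fun x y => p (c k) x y *: Lam (Dk k `&` A)) x v).
    apply: sumr_ge0 => k _; apply: kernel_form_ge0; apply: schur_kernel => //.
    exact: Lam_psd.
  rewrite /kernel_form [RHS]exchange_big; apply: eq_bigr => i _.
  rewrite [RHS]exchange_big; apply: eq_bigr => j _.
  by rewrite /T bop_sum inner_suml.
rewrite /kernel_form -sumrB; apply: le_trans (nrm_sum _ _ _) _.
apply: (@le_trans _ _ (d * S)); last exact: ltW.
rewrite /S mulr_sumr; apply: ler_sum => i _; rewrite -sumrB.
apply: le_trans (nrm_sum _ _ _) _; rewrite mulr_sumr; apply: ler_sum => j _.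
rewrite -innerBl -bopB (le_trans (cauchy_schwarz _ _))// mulrA ler_wpM2r ?nrm_ge0//.
by rewrite (le_trans (nrm_bop_le _ _))// ler_wpM2r ?nrm_ge0.
Qed.

Variables (lam : {finite_measure set (borel Omega) -> \bar R}) (G : Omega -> bop H).
Hypothesis RN : RN_decomposition Lam lam G.

Let lam_dom := @bochner_dominated _ (borel Omega) R (bop H) lam.

Lemma bochner_indic A : measurable A ->
  is_bochner_integral lam (fun w : borel Omega => (\1_A w : C) *: G w) (Lam A).
Proof.
move=> mA; have [[s Gs] LamE] := RN.
have [_ /(is_int_exists lam_dom)[T hT]] :=
  L1_approx_scale (simple_limit_indic1 R mA) (nrm_indic_le1 R A) Gs.
rewrite LamE//; apply: (@bochner_integral_is _ _ _ _ _ _ T).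
by rewrite is_bochner_intE.
Qed.

(** Both sides agree for simple [phi], and both are continuous under bounded
    pointwise convergence. *)
Lemma bochner_Lint (phi : borel Omega -> C) s c N T :
  simple_limit phi s c -> (forall w, nrm (phi w) <= N) -> is_Lint phi T ->
  is_bochner_integral lam (fun w : borel Omega => phi w *: G w) T.
Proof.
move=> sl phiN phiT; have [[t Gt] LamE] := RN.
have [cv /(is_int_exists lam_dom)[T' hT']] := L1_approx_scale sl phiN Gt.
rewrite is_bochner_intE.
suff <- : T' = T by [].
have [fs _ _] := sl.
have simpl n : is_int lam (fun A b => (fine (lam A))%:C *: b)
    (fun w : borel Omega => s n w *: G w)
    (simple_int (fun A (c : (C : normedModType C)) => c *: Lam A) (s n)).
  have [fr mr] := fs n.
  rewrite /simple_int fsbig_finite//=; set E := fset_set _.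
  have h : is_int lam (fun A b => (fine (lam A))%:C *: b)
      (fun w : borel Omega => \sum_(c <- E) c *: ((\1_(s n @^-1` [set c]) w : C) *: G w))
      (\sum_(c <- E) c *: Lam (s n @^-1` [set c])).
    apply: (is_int_sum lam_dom) => b; apply: (is_intZ lam_dom).
    by rewrite -is_bochner_intE; exact: bochner_indic.
  rewrite (_ : (fun w : borel Omega => s n w *: G w) =
    (fun w : borel Omega => \sum_(c <- E) c *: ((\1_(s n @^-1` [set c]) w : C) *: G w)))//.
  apply/funext => w.
  rewrite (bigD1_seq (s n w)) ?fset_uniq//=; last by rewrite in_fset_set// mem_set.
  rewrite indicE mem_set//= scale1r big1 ?addr0// => b bw.
  by rewrite indicE memNset ?scale0r ?scaler0//= => wb; rewrite wb eqxx in bw.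
have c1 := is_int_cvg lam_dom simpl hT' cv.
have c2 := is_int_L1_approx Lam_dominated phiT (simple_limit_L1 mu sl).
by apply: (cvg_unique _ c1 c2); exact: norm_hausdorff.
Qed.

Lemma mixture_bochner x y :
  is_bochner_integral lam (fun w : borel Omega => p w x y *: G w) (mixture_on setT x y).
Proof.
have [s [c sl]] := p_simple_limit x y.
apply: (bochner_Lint sl (fun w => pM w x y)).
have := mixture_onP x y measurableT; rewrite /is_Lint.
by rewrite (_ : (fun w => _ * _) = (fun w => p w x y))//; apply/funext => w; rewrite indicT mul1r.
Qed.

Lemma bochner_unique f (T T' : bop H) :
  is_bochner_integral lam f T -> is_bochner_integral lam f T' -> T = T'.
Proof. by rewrite !is_bochner_intE => h h'; exact: (is_int_unique lam_dom h h'). Qed.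

Lemma mixtureE : mixture p lam G = mixture_on setT.
Proof.
apply/funext => x; apply/funext => y; rewrite /mixture /bochner_integral.
case: xgetP => [T -> h|/(_ (mixture_on setT x y))]; first exact: bochner_unique h (mixture_bochner x y).
by case; exact: mixture_bochner.
Qed.

End mixtures.

(** * The reproducing kernel Hilbert space *)

Section kernel_seminorm.
Variables (R : realType) (X : choiceType) (H : hilbertType R[i]).
Variables (K : X -> X -> bop H).
Local Notation C := R[i].
Implicit Types (f g : X -> H) (s t : seq (X * H)).

Definition eval_form f s : C := \sum_(a <- s) inner a.2 (f a.1).

Definition knorm s : R := Num.sqrt (complex.Re (kform K s s)).

Lemma knorm_ge0 s : 0 <= knorm s. Proof. exact: sqrtr_ge0. Qed.

Lemma knorm_nil : knorm [::] = 0.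
Proof. by rewrite /knorm /kform big_nil sqrtr0. Qed.

Lemma kform_kcombZ c s : kform K (kcomb c s [::]) (kcomb c s [::]) = (nrm c ^+ 2)%:C * kform K s s.
Proof.
have k0 u : kform K [::] u = 0 by rewrite /kform big_nil.
have k0' u : kform K u [::] = 0 by rewrite /kform big1// => a _; rewrite big_nil.
by rewrite kform_combl k0 addr0 kform_combr k0' addr0 mulrA nrm_sqr.
Qed.

Lemma knormZ c s : knorm (kcomb c s [::]) = nrm c * knorm s.
Proof.
rewrite /knorm kform_kcombZ ReE_mulr sqrtrM ?sqr_ge0// sqrtr_sqr ger0_norm//.
exact: nrm_ge0.
Qed.

Lemma eval_form_comb f c s t : eval_form f (kcomb c s t) = c * eval_form f s + eval_form f t.
Proof.
rewrite /eval_form big_cat big_map/= mulr_sumr; congr (_ + _).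
by apply: eq_bigr => a _; rewrite innerZl.
Qed.

Lemma eval_formZ f c s : eval_form f (kcomb c s [::]) = c * eval_form f s.
Proof. by rewrite eval_form_comb /eval_form big_nil addr0. Qed.

Lemma eval_formP f g (a : C) s :
  eval_form (a *: f + g) s = Num.conj a * eval_form f s + eval_form g s.
Proof.
rewrite /eval_form mulr_sumr -big_split; apply: eq_bigr => b _.
by rewrite innerDr innerZr.
Qed.

Lemma eval_form0 s : eval_form 0 s = 0.
Proof. by rewrite /eval_form big1// => a _; rewrite inner0r. Qed.

Lemma eval_formD f g s : eval_form (f + g) s = eval_form f s + eval_form g s.
Proof. by rewrite -[f in LHS]scale1r eval_formP conjC1 mul1r. Qed.

Lemma eval_formZl a f s : eval_form (a *: f) s = Num.conj a * eval_form f s.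
Proof. by rewrite -[a *: f]addr0 eval_formP eval_form0 addr0. Qed.

Lemma eval_formB f g s : eval_form (f - g) s = eval_form f s - eval_form g s.
Proof. by rewrite -[- g]scaleN1r eval_formD eval_formZl rmorphN1 mulN1r. Qed.

(** The functions that are bounded against the energy seminorm: the reproducing
    kernel Hilbert space, presented as the dual of the span of the kernel. *)
Definition rkhs_pred : {pred X -> H} := fun f =>
  `[< exists c : R, forall s, nrm (eval_form f s) <= c * knorm s >].

Lemma rkhs_pred_submod : subsemimod_closed rkhs_pred.
Proof.
split; [split|].
- by apply/asboolP; exists 0 => s; rewrite eval_form0 nrm0 mul0r.
- move=> f g /asboolP[c fc] /asboolP[c' gc]; apply/asboolP; exists (c + c') => s.
  by rewrite eval_formD (le_trans (nrm_normD _ _))// mulrDl lerD.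
- move=> a f /asboolP[c fc]; apply/asboolP; exists (nrm a * c) => s.
  by rewrite eval_formZl nrmM nrm_conj -mulrA ler_wpM2l ?nrm_ge0.
Qed.

HB.instance Definition _ :=
  GRing.isSubmodClosed.Build R[i] (X -> H) rkhs_pred rkhs_pred_submod.

End kernel_seminorm.

Record rkhs (R : realType) (X : choiceType) (H : hilbertType R[i])
    (K : X -> X -> bop H) (pdK : pd_kernel K) :=
  RKHSElt { rkhs_val :> X -> H ; _ : rkhs_val \in rkhs_pred K }.

Section rkhs_norm.
Variables (R : realType) (X : choiceType) (H : hilbertType R[i]).
Variables (K : X -> X -> bop H) (pdK : pd_kernel K).
Local Notation C := R[i].
Local Notation E := (rkhs pdK).

HB.instance Definition _ := [isSub for @rkhs_val _ _ _ _ pdK].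
HB.instance Definition _ := [Choice of E by <:].
HB.instance Definition _ := [SubChoice_isSubLmodule of E by <:].

Implicit Types (f g : E) (s t : seq (X * H)).

Lemma rkhsP f : exists c : R, forall s, nrm (eval_form f s) <= c * knorm K s.
Proof. by case: f => h /= /asboolP. Qed.

(** The norm of [f] as a functional on formal sums with the seminorm [knorm]. *)
Definition rnorm f : R := sup [set nrm (eval_form f s) | s in [set s | knorm K s <= 1]].

Lemma rnorm_has_sup f : has_sup [set nrm (eval_form f s) | s in [set s | knorm K s <= 1]].
Proof.
split; first by exists (nrm (eval_form f [::])), [::] => //=; rewrite knorm_nil.
have [c fc] := rkhsP f; exists `|c| => _ [s /= s1 <-].
rewrite (le_trans (fc s))// (le_trans (ler_norm _))// normrM ler_piMr//.
by rewrite ger0_norm ?knorm_ge0.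
Qed.

Lemma rnorm_ge0 f : 0 <= rnorm f.
Proof.
have := sup_upper_bound (rnorm_has_sup f); apply; exists [::] => /=.
  by rewrite knorm_nil.
by rewrite /eval_form big_nil nrm0.
Qed.

Lemma le_rnorm f s : nrm (eval_form f s) <= rnorm f * knorm K s.
Proof.
have [s0|s0] := eqVneq (knorm K s) 0.
  by have [c /(_ s)] := rkhsP f; rewrite s0 !mulr0.
have sgt0 : 0 < knorm K s by rewrite lt_def s0 knorm_ge0.
have nV : nrm ((knorm K s)^-1%:C : R[i]) = (knorm K s)^-1.
  by rewrite nrm_real ger0_norm// invr_ge0 knorm_ge0.
rewrite -ler_pdivrMr// mulrC -nV -nrmM -eval_formZ.
apply: (sup_upper_bound (rnorm_has_sup f)); exists (kcomb (knorm K s)^-1%:C s [::]) => //=.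
by rewrite knormZ nV mulVf.
Qed.

Lemma rnorm_le f (c : R) : 0 <= c ->
  (forall s, nrm (eval_form f s) <= c * knorm K s) -> rnorm f <= c.
Proof.
move=> c0 fc; apply: ge_sup; first by case: (rnorm_has_sup f).
by move=> _ [s /= s1 <-]; rewrite (le_trans (fc s))// ler_piMr.
Qed.

Lemma rnormD f g : (rnorm (f + g))%:C <= (rnorm f)%:C + (rnorm g)%:C :> R[i].
Proof.
rewrite -rmorphD lecR; apply: rnorm_le => [|s]; first by rewrite addr_ge0 ?rnorm_ge0.
by rewrite eval_formD (le_trans (nrm_normD _ _))// mulrDl lerD// le_rnorm.
Qed.

Let rnormZ_le (a : C) f : rnorm (a *: f) <= nrm a * rnorm f.
Proof.
apply: rnorm_le => [|s]; first by rewrite mulr_ge0 ?nrm_ge0 ?rnorm_ge0.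
by rewrite eval_formZl nrmM nrm_conj -mulrA ler_wpM2l ?nrm_ge0// le_rnorm.
Qed.

Lemma rnormZ (a : C) f : (rnorm (a *: f))%:C = `|a| * (rnorm f)%:C.
Proof.
rewrite -(nrm_normc a) -rmorphM; congr (_%:C); apply/eqP; rewrite eq_le rnormZ_le/=.
have [->|a0] := eqVneq a 0; first by rewrite nrm0 mul0r rnorm_ge0.
have na0 := nrm_gt0 a0.
have nV : nrm a^-1 = (nrm a)^-1.
  by apply: complexI; rewrite nrm_normc normfV -(nrm_normc a) fmorphV.
rewrite -ler_pdivlMl// -nV (le_trans _ (rnormZ_le _ _))//.
by rewrite scalerA mulVf// scale1r.
Qed.

Lemma rkhs_inner_eval f x v : inner v (f x) = eval_form f [:: (x, v)].
Proof. by rewrite /eval_form big_seq1. Qed.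

Lemma knorm1_le x v : knorm K [:: (x, v)] <= Num.sqrt (nrm (K x x)) * nrm v.
Proof.
rewrite -[X in _ * X]ger0_norm ?nrm_ge0// -sqrtr_sqr -sqrtrM ?nrm_ge0//.
apply: ler_wsqrtr; rewrite /kform !big_seq1 (le_trans (Re_le_nrm _))//.
rewrite (le_trans (cauchy_schwarz _ _))// expr2 mulrA ler_wpM2r ?nrm_ge0//.
exact: nrm_bop_le.
Qed.

Lemma rkhs_eval_le f x : nrm (f x) <= rnorm f * Num.sqrt (nrm (K x x)).
Proof.
apply: nrm_le_inner => [|v]; first by rewrite mulr_ge0 ?rnorm_ge0 ?sqrtr_ge0.
rewrite rkhs_inner_eval (le_trans (le_rnorm _ _))// -mulrA ler_wpM2l ?rnorm_ge0//.
exact: knorm1_le.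
Qed.

Lemma rnorm0_eq0 f : (rnorm f)%:C = 0 :> R[i] -> f = 0.
Proof.
move=> /complexI f0; apply/val_inj/funext => x; apply: nrm0_eq0.
apply/eqP; rewrite eq_le nrm_ge0 andbT.
by rewrite (le_trans (rkhs_eval_le _ _))// f0 mul0r.
Qed.

HB.instance Definition _ := Lmodule_isNormed.Build R[i] E
  rnormD rnormZ rnorm0_eq0.

Lemma nrm_rnorm f : nrm f = rnorm f. Proof. by []. Qed.

Lemma eval_form_cvg (F : set_system E) (h : X -> H) s : ProperFilter F ->
  (forall x, (fun f : E => f x) @ F --> h x) ->
  (fun f : E => eval_form f s : C) @ F --> (eval_form h s : C).
Proof.
move=> FF Fh; elim: s => [|a s ih].
  by rewrite /eval_form; under eq_fun do rewrite big_nil; rewrite big_nil; exact: cvg_cst.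
rewrite /eval_form; under eq_fun do rewrite big_cons; rewrite big_cons.
have h1 : (fun f : E => inner a.2 (f a.1) : C) @ F --> (inner a.2 (h a.1) : C).
  by have := Fh a.1; exact: inner_cvgr.
exact: (cvgD h1 ih).
Qed.

(** The pointwise limit of a Cauchy filter stays bounded against [knorm], and the filter
    converges to it in norm because the estimates pass to the limit. *)
Lemma rkhs_complete (F : set_system E) : ProperFilter F -> cauchy F -> cvg F.
Proof.
move=> FF Fc.
have evc x : cvg ((fun f : E => f x) @ F).
  apply/cauchy_cvgP; apply: nrm_cauchy => e e0.
  have [d d0 dk] := small_factor e0 (sqrtr_ge0 (nrm (K x x))).
  have [A FA Ae] := cauchy_nrmP FF Fc d0.
  exists ((fun f : E => f x) @` A).
    by apply: (@filterS _ F _ _ _ _ FA) => f Af; exists f.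
  move=> _ _ [f Af <-] [g Ag <-].
  rewrite (le_lt_trans (rkhs_eval_le (f - g) x))// (le_lt_trans _ dk)//.
  by rewrite ler_wpM2r ?sqrtr_ge0// ltW// Ae.
pose h x := lim ((fun f : E => f x) @ F).
have Fh x : (fun f : E => f x) @ F --> h x by exact: evc.
have [A FA A1] := cauchy_nrmP FF Fc (@ltr01 R).
have [f0 Af0] := filter_ex FA.
have hB s : nrm (eval_form h s) <= (1 + nrm f0) * knorm K s.
  rewrite -nrmN -sub0r; apply: (@nrm_cvg_le R C E F FF (fun f : E => eval_form f s) _ _ _ (@eval_form_cvg F h s FF Fh)).
  apply: (@filterS _ F _ _ _ _ FA) => f Af; rewrite sub0r nrmN.
  rewrite (le_trans (le_rnorm _ _))// ler_wpM2r ?knorm_ge0//.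
  by rewrite -nrm_rnorm (le_trans (nrm_leD _ f0))// lerD2r ltW// A1.
have hE : h \in rkhs_pred K by apply/asboolP; exists (1 + nrm f0).
apply/cvg_ex; exists (RKHSElt pdK hE); apply/(@cvg_nrmP R E _ F _ id) => e e0.
have e20 : 0 < e / 2 by lra.
have [B FB Be] := cauchy_nrmP FF Fc e20.
apply: (@filterS _ F _ _ _ _ FB) => f Bf; rewrite (@le_lt_trans _ _ (e / 2))//; last by lra.
rewrite nrmBC nrm_rnorm; apply: rnorm_le => [|s]; first exact: ltW.
have -> : eval_form (f - RKHSElt pdK hE) s = eval_form f s - eval_form h s.
  exact: eval_formB.
apply: (@nrm_cvg_le R C E F FF (fun f : E => eval_form f s) _ _ _ (@eval_form_cvg F h s FF Fh)).
apply: (@filterS _ F _ _ _ _ FB) => g Bg.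
have -> : eval_form f s - eval_form g s = eval_form (f - g) s.
  by rewrite -eval_formB.
by rewrite (le_trans (le_rnorm _ _))// ler_wpM2r ?knorm_ge0// ltW// Be.
Qed.

HB.instance Definition _ := Uniform_isComplete.Build E rkhs_complete.

End rkhs_norm.

Section rkhs_inner.
Variables (R : realType) (X : choiceType) (H : hilbertType R[i]).
Variables (K : X -> X -> bop H) (pdK : pd_kernel K).
Local Notation C := R[i].
Local Notation E := (rkhs pdK).
Implicit Types (f g : E) (s t : seq (X * H)).

Lemma knorm_sq s : (knorm K s ^+ 2)%:C = kform K s s.
Proof.
rewrite /knorm sqr_sqrtr -?ge0_Re//; first exact: kform_ge0.
by rewrite -ler0c -ge0_Re; exact: kform_ge0.
Qed.

Lemma kform_le s t : nrm (kform K s t) <= knorm K s * knorm K t.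
Proof.
rewrite -(@ler_pXn2r _ 2) ?nnegrE ?mulr_ge0 ?nrm_ge0 ?knorm_ge0// exprMn.
by have := kform_cauchy_schwarz s t pdK; rewrite -!knorm_sq.
Qed.

Definition represents (e : R) t (h : X -> H) :=
  forall s, nrm (eval_form h s - kform K s t) <= e * knorm K s.

(** The functional of [f] is bounded for the form of the kernel, so [form_approx_riesz]
    applies. *)
Lemma represents_ex f (e : R) : 0 < e -> exists t, represents e t f.
Proof.
move=> e0.
have [||||||t ht] := @form_approx_riesz R _ (@kcomb R X H) (kform K) _ _ _
  (eval_form f) (rnorm f ^+ 2) [::] _ _ (e ^+ 2).
- by move=> *; exact: kform_combl.
- by move=> *; exact: kform_ge0.
- by move=> *; exact: kform_hermitian.
- by move=> *; exact: eval_form_comb.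
- move=> s; rewrite -knorm_sq/= -exprMn lerXn2r ?nnegrE ?nrm_ge0 ?mulr_ge0 ?rnorm_ge0 ?knorm_ge0//.
  exact: le_rnorm.
- by rewrite exprn_gt0.
exists t => s; have := ht s; rewrite -knorm_sq/= -exprMn.
by rewrite ler_pXn2r// ?nnegrE ?mulr_ge0 ?nrm_ge0 ?knorm_ge0 ?ltW.
Qed.

Lemma represents_close (h : X -> H) (e e' : R) t t' : 0 <= e -> 0 <= e' ->
  represents e t h -> represents e' t' h ->
  knorm K (kcomb (-1) t' t) <= e + e'.
Proof.
move=> e0 e'0 ht ht'; set d := kcomb _ _ _.
have : knorm K d ^+ 2 <= (e + e') * knorm K d.
  rewrite -[leLHS]ger0_norm ?sqr_ge0// -nrm_real knorm_sq {2}/d kform_combr.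
  rewrite rmorphN1 mulN1r addrC mulrDl (le_trans (nrm_triangle (eval_form h d) _ _))//.
  by rewrite lerD// nrmBC.
have [->|d0] := eqVneq (knorm K d) 0; first by rewrite addr_ge0.
by rewrite expr2 ler_pM2r// lt_def d0 knorm_ge0.
Qed.

Lemma eval_form_close f t t' :
  nrm (eval_form f t - eval_form f t') <= rnorm f * knorm K (kcomb (-1) t' t).
Proof. by have := le_rnorm f (kcomb (-1) t' t); rewrite eval_form_comb mulN1r addrC. Qed.

Let ap_ex f n : exists t, represents (n.+1%:R^-1) t f.
Proof. by apply: represents_ex; rewrite invr_gt0. Qed.

Definition approximant f n := projT1 (cid (ap_ex f n)).

Lemma approximantP f n : represents (n.+1%:R^-1) (approximant f n) f.
Proof. exact: (projT2 (cid (ap_ex f n))). Qed.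

(** Evaluating [f] at formal sums that represent [g] better and better. *)
Definition rinner f g : C := limn (fun n => Num.conj (eval_form f (approximant g n)) : C).

Lemma rinner_cvg f g :
  (fun n => Num.conj (eval_form f (approximant g n)) : C) @ \oo --> rinner f g.
Proof.
apply: (@cauchy_seq_cvg R C _ (fun n => rnorm f * n.+1%:R^-1)).
  move=> n m; rewrite -rmorphB nrm_conj (le_trans (eval_form_close _ _ _))//.
  rewrite -mulrDr ler_wpM2l ?rnorm_ge0//.
  by apply: (represents_close _ _ (approximantP g n) (approximantP g m)).
by rewrite -(mulr0 (rnorm f)); apply: cvgMr; exact: cvg_harmonic.
Qed.

(** Two formal sums representing the same function are close in [knorm]. *)
Lemma rinner_represents f g (e : R) t : 0 <= e -> represents e t g ->
  nrm (rinner f g - Num.conj (eval_form f t)) <= rnorm f * e.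
Proof.
move=> e0 gt; apply/ler_addgt0Pl => d d0.
have [d' d'0 dd'] := small_factor d0 (rnorm_ge0 f).
rewrite nrmBC; apply: (@nrm_cvg_le R C nat \oo _ _ (rinner f g) _ _ (@rinner_cvg f g)); near=> n.
rewrite -rmorphB nrm_conj (le_trans (eval_form_close _ _ _))//.
apply: (@le_trans _ _ (rnorm f * (e + n.+1%:R^-1))).
  by rewrite ler_wpM2l ?rnorm_ge0//; apply: represents_close gt (approximantP g n).
rewrite mulrDr addrC lerD2r (le_trans _ (ltW dd'))// mulrC ler_wpM2r ?rnorm_ge0// ltW//.
by near: n; exact: harmonic_small.
Unshelve. all: by end_near. Qed.

Lemma eq_of_harmonic (a b : C) (c : R) : (forall n, nrm (a - b) <= c * n.+1%:R^-1) -> a = b.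
Proof.
move=> h; apply/eqP; rewrite -subr_eq0; apply/eqP/nrm_eq0_small => e e0.
have c0 : 0 <= c by have := le_trans (nrm_ge0 _) (h 0%N); rewrite invr1 mulr1.
have [d d0 dc] := small_factor e0 c0; have [n nd] := ex_harmonic_small d0.
rewrite (le_trans (h n))// (le_trans _ (ltW dc))// mulrC ler_wpM2r//; exact: ltW.
Qed.

Lemma approximant_knorm f n : `|rnorm f - knorm K (approximant f n)| <= n.+1%:R^-1.
Proof.
set t := approximant f n; have ht := approximantP f n; set e := n.+1%:R^-1 in ht *.
have e0 : 0 <= e by rewrite /e invr_ge0.
rewrite ler_distl; apply/andP; split.
  rewrite lerBlDr.
  have : knorm K t ^+ 2 <= (rnorm f + e) * knorm K t.
    rewrite -[leLHS]ger0_norm ?sqr_ge0// -nrm_real knorm_sq.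
    rewrite (le_trans (nrm_leD _ (eval_form f t)))// addrC mulrDl lerD ?le_rnorm//.
    by rewrite nrmBC; exact: ht.
  have [->|d0] := eqVneq (knorm K t) 0; first by rewrite addr_ge0 ?rnorm_ge0.
  by rewrite expr2 ler_pM2r// lt_def d0 knorm_ge0.
apply: rnorm_le => [|s]; first by rewrite addr_ge0 ?knorm_ge0.
rewrite (le_trans (nrm_leD _ (kform K s t)))// mulrDl addrC lerD//.
by rewrite mulrC kform_le.
Qed.

Lemma rinner_kform f g n :
  nrm (rinner f g - kform K (approximant f n) (approximant g n)) <=
  (rnorm f + rnorm g + 1) * n.+1%:R^-1.
Proof.
set t := approximant g n; set u := approximant f n; set e := n.+1%:R^-1.
have e1 : e <= 1 by rewrite invf_le1// ler1n.
rewrite (le_trans (nrm_triangle (Num.conj (eval_form f t)) _ _))//.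
have h1 := rinner_represents f _ (approximantP g n); rewrite -/e in h1.
have h2 := approximantP f n t; rewrite -/u -/e in h2.
have h3 := approximant_knorm g n; rewrite -/t -/e in h3.
have h4 : knorm K t <= rnorm g + 1.
  by move: h3; rewrite ler_distlC => /andP[_] h3; rewrite (le_trans h3)// lerD2l.
rewrite -addrA mulrDl lerD//; first by apply: h1; rewrite /e invr_ge0.
by rewrite kform_hermitian// -rmorphB nrm_conj (le_trans h2)// mulrC ler_wpM2r// /e invr_ge0.
Qed.

Lemma rinner_herm f g : rinner f g = Num.conj (rinner g f).
Proof.
apply: (@eq_of_harmonic _ _ ((rnorm f + rnorm g + 1) + (rnorm g + rnorm f + 1))) => n.
rewrite (le_trans (nrm_triangle (kform K (approximant f n) (approximant g n)) _ _))//.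
rewrite mulrDl lerD// ?rinner_kform// kform_hermitian// -rmorphB nrm_conj nrmBC.
exact: rinner_kform.
Qed.

Lemma rinner_linear (a : C) f g h : rinner (a *: f + g) h = a * rinner f h + rinner g h.
Proof.
apply/cvg_lim => //.
rewrite (_ : (fun n => _) = (fun n => a * Num.conj (eval_form f (approximant h n)) +
   Num.conj (eval_form g (approximant h n)))).
  by apply: cvgD; [apply: cvgMr|]; exact: rinner_cvg.
by apply/funext => n; rewrite eval_formP rmorphD rmorphM/= conjCK.
Qed.

Lemma rinner_bilinear : bilinear_for *%R (Num.conj \; *%R) rinner.
Proof.
split => [u a x y|u a x y] /=; first exact: rinner_linear.
by rewrite rinner_herm rinner_linear rmorphD rmorphM/= -!rinner_herm.
Qed.

HB.instance Definition _ := bilinear_isBilinear.Build C E E C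
  *%R (Num.conj \; *%R) rinner rinner_bilinear.

Lemma rinner_hermitian f g : rinner f g = (-1) ^+ false * Num.conj (rinner g f).
Proof. by rewrite expr0 mul1r -rinner_herm. Qed.

HB.instance Definition _ := isHermitianSesquilinear.Build C E
  false Num.conj rinner rinner_hermitian.

Lemma rinner_rnorm f : rinner f f = (rnorm f ^+ 2)%:C.
Proof.
apply: (@eq_of_harmonic _ _ ((rnorm f + rnorm f + 1) + (rnorm f + rnorm f + 1))) => n.
rewrite (le_trans (nrm_triangle (kform K (approximant f n) (approximant f n)) _ _))//.
rewrite mulrDl lerD ?rinner_kform// -knorm_sq -rmorphB nrm_real.
have h := approximant_knorm f n; set k := knorm K _ in h *.
have e1 : n.+1%:R^-1 <= 1 :> R by rewrite invf_le1// ler1n.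
have k1 : k <= rnorm f + 1.
  by move: h; rewrite ler_distlC => /andP[_] h3; rewrite (le_trans h3)// lerD2l.
rewrite subr_sqr normrM mulrC ler_pM// ?normr_ge0//; last by rewrite distrC.
rewrite ger0_norm ?addr_ge0 ?rnorm_ge0 ?knorm_ge0//; lra.
Qed.

Lemma rinner_gt0 f : f != 0 -> 0 < rinner f f.
Proof.
move=> f0; rewrite rinner_rnorm -[0]/(0%:C) ltcR exprn_gt0// -nrm_rnorm; exact: nrm_gt0.
Qed.

HB.instance Definition _ := isDotProduct.Build C E rinner rinner_gt0.

Lemma rinner_norm f : `|f| ^+ 2 = rinner f f.
Proof. by rewrite rinner_rnorm -nrm_rnorm rmorphXn/= nrmE. Qed.

HB.instance Definition _ :=
  CompleteNormedModule_isHilbert.Build C E rinner_norm.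

Definition kspan t : X -> H := fun z => \sum_(b <- t) K z b.1 b.2.

Lemma eval_form_kspan s t : eval_form (kspan t) s = kform K s t.
Proof.
rewrite /eval_form /kform; apply: eq_bigr => a _; rewrite inner_sumr; apply: eq_bigr => b _.
by rewrite kernel_hermitian.
Qed.

Lemma kspan_rkhs t : kspan t \in rkhs_pred K.
Proof.
by apply/asboolP; exists (knorm K t) => s; rewrite eval_form_kspan mulrC kform_le.
Qed.

Definition kelt t : E := RKHSElt pdK (kspan_rkhs t).

Lemma rinner_kelt f t : rinner f (kelt t) = Num.conj (eval_form f t).
Proof.
apply/eqP; rewrite -subr_eq0; apply/eqP/nrm0_eq0/eqP; rewrite eq_le nrm_ge0 andbT.
rewrite -(mulr0 (rnorm f)); apply: rinner_represents => // s.
by rewrite eval_form_kspan subrr nrm0 mul0r.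
Qed.

Definition ksection x v : E := kelt [:: (x, v)].

Lemma ksectionE x v : rkhs_val (ksection x v) = fun z => K z x v.
Proof. by apply/funext => z; rewrite /= /kspan big_seq1. Qed.

Lemma kelt_sum t : kelt t = \sum_(i < size t)
  (1 : C) *: ksection (tnth (in_tuple t) i).1 (tnth (in_tuple t) i).2.
Proof.
apply/val_inj/funext => z; rewrite raddf_sum /=.
have -> : (\sum_(i < size t) val ((1 : C) *: ksection (tnth (in_tuple t) i).1 (tnth (in_tuple t) i).2)) z =
  \sum_(i < size t) K z (tnth (in_tuple t) i).1 (tnth (in_tuple t) i).2.
  rewrite fct_sumE; apply: eq_bigr => i _; rewrite scale1r.
  exact: (congr1 (fun h => h z) (ksectionE _ _)).
by rewrite /kspan (big_tnth _ _ t).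
Qed.

(** By [represents_ex], a formal sum representing [f] is close to [f] in norm. *)
Lemma kelt_dense : dense [set f : E | exists n (a : 'I_n -> C) (x : 'I_n -> X) (v : 'I_n -> H),
      f = \sum_(i < n) a i *: ksection (x i) (v i)].
Proof.
move=> O [f Of] oO; have /nbhs_ballP[e /= e0 eO] := open_nbhs_nbhs (conj oO Of).
have eR : (complex.Re e)%:C = e by rewrite RRe_real// realE ltW.
have er0 : 0 < complex.Re e by rewrite -ltcR eR.
have e20 : 0 < complex.Re e / 2 by lra.
have [t ht] := represents_ex f e20.
exists (kelt t); split; last first.
  exists (size t), (fun=> 1), (fun i => (tnth (in_tuple t) i).1), (fun i => (tnth (in_tuple t) i).2).
  exact: kelt_sum.
apply: eO; rewrite -ball_normE /= -[e]eR ltc_nrm nrm_rnorm.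
apply: (@le_lt_trans _ _ (complex.Re e / 2)); last by lra.
apply: rnorm_le => [|s]; first exact: ltW.
have -> : eval_form (f - kelt t) s = eval_form f s - kform K s t.
  by rewrite -eval_form_kspan -eval_formB.
exact: ht.
Qed.

Lemma ksection_reproducing x v f : inner (ksection x v) f = inner v (f x).
Proof.
rewrite rkhs_inner_eval innerC -[inner f _]/(rinner f (ksection x v)).
by rewrite rinner_kelt conjCK.
Qed.

Lemma rkhs_val_linear : linear (@rkhs_val _ _ _ _ pdK).
Proof. by []. Qed.

HB.instance Definition _ := GRing.isLinear.Build C E (X -> H) *:%R (@rkhs_val _ _ _ _ pdK) rkhs_val_linear.

Definition canonical_RKHS : RKHS K :=
  {| rkhs_space := E ;
     rkhs_fun := @rkhs_val _ _ _ _ pdK ;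
     rkhs_fun_inj := val_inj ;
     rkhs_section := ksection ;
     rkhs_sectionE := ksectionE ;
     rkhs_dense := kelt_dense ;
     rkhs_reproducing := ksection_reproducing |}.

(** The bound makes [h] an element of [canonical_RKHS] by definition, so membership in
    the space is reduced to an estimate. *)
Lemma in_RKHS_bound (h : X -> H) (c : R) :
  (forall s, nrm (eval_form h s) <= c * knorm K s) -> in_RKHS K h.
Proof.
move=> hc; have hE : h \in rkhs_pred K by apply/asboolP; exists c.
by exists canonical_RKHS, (RKHSElt pdK hE).
Qed.

End rkhs_inner.

(** * Functions in the reproducing kernel Hilbert space *)

Section rkhs_evaluation.
Variables (R : realType) (X : Type) (H : hilbertType R[i]).
Variables (K : X -> X -> bop H) (E : RKHS K).
Local Notation C := R[i].

Lemma rkhs_section_le x v : nrm (rkhs_section E x v) <= Num.sqrt (nrm (K x x)) * nrm v.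
Proof.
rewrite -(@ler_pXn2r _ 2) ?nnegrE ?mulr_ge0 ?nrm_ge0 ?sqrtr_ge0// exprMn.
rewrite sqr_sqrtr ?nrm_ge0// -[leLHS]ger0_norm ?sqr_ge0// -nrm_real -inner_nrm.
rewrite rkhs_reproducing rkhs_sectionE (le_trans (cauchy_schwarz _ _))//.
by rewrite mulrC expr2 mulrA ler_wpM2r ?nrm_ge0// nrm_bop_le.
Qed.

Lemma rkhs_fun_le (F : E) x : nrm (rkhs_fun E F x) <= Num.sqrt (nrm (K x x)) * nrm F.
Proof.
apply: nrm_le_inner => [|v]; first by rewrite mulr_ge0 ?sqrtr_ge0 ?nrm_ge0.
rewrite -rkhs_reproducing (le_trans (cauchy_schwarz _ _))//.
by rewrite mulrAC ler_wpM2r ?nrm_ge0// rkhs_section_le.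
Qed.

Lemma rkhs_section_approx (F : E) (d : R) : 0 < d ->
  exists n (a : 'I_n -> C) (x : 'I_n -> X) (v : 'I_n -> H),
    nrm (F - \sum_(i < n) a i *: rkhs_section E (x i) (v i)) < d.
Proof.
move=> d0; have dC0 : 0 < d%:C :> C by rewrite ltcR.
have [G [bG [n [a [x [v GE]]]]]] : ball F d%:C `&` [set f : E |
    exists n (a : 'I_n -> C) (x : 'I_n -> X) (v : 'I_n -> H),
      f = \sum_(i < n) a i *: rkhs_section E (x i) (v i)] !=set0.
  have dE := @rkhs_dense _ _ _ _ E.
  by apply: dE; [exists F; exact: ballxx|exact: ball_open].
by exists n, a, x, v; rewrite -GE; move: bG; rewrite -ball_normE /= ltc_nrm.
Qed.

Lemma rkhs_fun_span n (a : 'I_n -> C) (x : 'I_n -> X) (v : 'I_n -> H) z :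
  rkhs_fun E (\sum_(i < n) a i *: rkhs_section E (x i) (v i)) z =
  \sum_(i < n) a i *: K z (x i) (v i).
Proof.
rewrite linear_sum fct_sumE; apply: eq_bigr => i _.
by rewrite linearZ /= rkhs_sectionE.
Qed.

End rkhs_evaluation.

Section rkhs_topology.
Variables (R : realType) (X : topologicalType) (H : hilbertType R[i]).
Variables (K : X -> X -> bop H).
Local Notation C := R[i].

Lemma continuous_bop_apply (Y : topologicalType) (F : Y -> bop H) v :
  continuous F -> continuous (fun y => F y v).
Proof.
move=> cF y; apply: (@cvg_nrm_le R H _ _ _ _ _ (fun z => nrm (F y - F z) * nrm v)).
  by move=> z; rewrite -bopB nrm_bop_le.
by rewrite -(mul0r (nrm v)); apply: cvgMl; apply: cvg_dist0; exact: cF.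
Qed.

Lemma continuous_sum (Y : topologicalType) (B : normedModType C) (I : Type) (r : seq I)
    (F : I -> Y -> B) : (forall i, continuous (F i)) ->
  continuous (fun y => \sum_(i <- r) F i y).
Proof.
move=> cF; elim: r => [|i r ih].
  rewrite (_ : (fun y => _) = fun=> 0); first exact: continuous_const.
  by apply/funext => y; rewrite big_nil.
rewrite (_ : (fun y => _) = (fun y => F i y + \sum_(i <- r) F i y)); last first.
  by apply/funext => y; rewrite big_cons.
move=> y; exact: (cvgD (cF i y) (ih y)).
Qed.

(** Combinations of sections are continuous and dense, and point evaluations are bounded
    uniformly in the point because the kernel is. *)
Lemma bounded_continuous_RKHS : bounded_kernel K ->
  continuous (fun z : X * X => K z.1 z.2) -> RKHS_continuous K.
Proof.
move=> [M KM] cK _ [E [F <-]] x; apply/cvg_nrmP => e e0.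
have [d d0 ds] := small_factor (divr_gt0 e0 (ltr0n R 4)) (sqrtr_ge0 M).
have [n [a [y [v hF]]]] := rkhs_section_approx F d0.
set h := \sum_(i < n) _ in hF; pose k z := \sum_(i < n) a i *: K z (y i) (v i).
have Fk z : nrm (rkhs_fun E F z - k z) < e / 4.
  have -> : k z = rkhs_fun E h z by rewrite /h rkhs_fun_span.
  have -> : rkhs_fun E F z - rkhs_fun E h z = rkhs_fun E (F - h) z by rewrite linearB.
  rewrite (le_lt_trans (rkhs_fun_le _ _))// (le_lt_trans _ ds)// mulrC.
  by apply: ler_pM; rewrite ?sqrtr_ge0 ?nrm_ge0 ?ler_wsqrtr// ltW.
have ck : continuous k.
  apply: continuous_sum => i z; apply: cvgZr; apply: continuous_bop_apply => t.
  have h1 : continuous (fun t : X => (t, y i)).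
    by apply: continuous_pair; [exact: continuous_id|exact: continuous_const].
  exact: (continuous_compose h1 cK).
have /cvg_nrmP/(_ _ (divr_gt0 e0 (ltr0n R 4))) := ck x.
apply: filterS => z hz.
rewrite (le_lt_trans (nrm_triangle (k x) _ _))//.
rewrite (@le_lt_trans _ _ (e / 4 + (e / 4 + e / 4)))//; last by lra.
rewrite lerD//; first exact/ltW/Fk.
rewrite (le_trans (nrm_triangle (k z) _ _))// lerD//; first exact: ltW.
by rewrite nrmBC ltW ?Fk.
Qed.

End rkhs_topology.

Section universal_scalar.
Variables (R : realType) (X : topologicalType).
Local Notation C := R[i].

(** Universality provides an element of the space; by density of the sections and
    uniform boundedness of the evaluations it may be taken to be a finite combination. *)
Lemma universal_span (p : X -> X -> C) (M : R) (A : set X) (g : X -> C) (e : R) :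
  (forall x y, nrm (p x y) <= M) ->
  universal (scalar_kernel p) -> compact A -> {within A, continuous g} -> 0 < e ->
  exists l : seq (C * X), forall y, A y -> nrm (\sum_(a <- l) a.1 * p y a.2 - g y) < e.
Proof.
move=> pM [_ up] cA cg e0; have e20 : 0 < e / 2 by lra.
have [f [E [F Ff]] fg] := up A g _ cA cg e20.
have [d d0 ds] := small_factor e20 (sqrtr_ge0 M).
have [n [a [x [v hF]]]] := rkhs_section_approx F d0.
exists [seq (a i * v i, x i) | i <- enum 'I_n] => y Ay.
rewrite big_map big_enum/= (le_lt_trans (nrm_triangle (f y) _ _))// [ltRHS]splitr ltrD//.
  rewrite nrmBC -Ff.
  have -> : \sum_(i < n) a i * v i * p y (x i) =
      rkhs_fun E (\sum_(i < n) a i *: rkhs_section E (x i) (v i)) y.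
    rewrite rkhs_fun_span; apply: eq_bigr => i _; rewrite -[RHS]/(a i * (p y (x i) * v i)); ring.
  set h := \sum_(i < n) _ in hF *.
  have -> : rkhs_fun E F y - rkhs_fun E h y = rkhs_fun E (F - h) y by rewrite linearB.
  rewrite (le_lt_trans (rkhs_fun_le _ _))// (le_lt_trans _ ds)// mulrC.
  apply: ler_pM; rewrite ?sqrtr_ge0 ?nrm_ge0 ?ler_wsqrtr//; first exact: ltW.
  apply: bop_nrm_le => [|c]; first by rewrite (le_trans _ (pM y y))// nrm_ge0.
  by rewrite -[scalar_kernel _ _ _ c]/(p y y * c) nrmM ler_wpM2r ?nrm_ge0.
rewrite -lte_fin; apply: le_lt_trans fg; apply: ereal_sup_ubound.
by exists y.
Qed.

End universal_scalar.

(** * Universality of mixtures *)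

Section partition_of_unity.
Variables (R : realType) (X : ptopologicalType) (A : set X).
Local Notation C := R[i].
Hypotheses (hX : hausdorff_space X) (cA : compact A).

Lemma cvg_real_complex (T : Type) (F : set_system T) (FF : Filter F) (f : T -> R) (a : R) :
  f @ F --> a -> (fun t => (f t)%:C : C) @ F --> (a%:C : C).
Proof.
move=> /cvgrPdist_lt fa; apply/cvg_nrmP => e e0; apply: filterS (fa e e0) => t.
by rewrite -rmorphB nrm_real.
Qed.

Lemma cvg_sum (T I : Type) (F : set_system T) (FF : Filter F) (r : seq I)
    (f : I -> T -> R) (a : I -> R) : (forall i, f i @ F --> a i) ->
  (fun t => \sum_(i <- r) f i t) @ F --> \sum_(i <- r) a i.
Proof.
move=> fa; elim: r => [|i r ih].
  rewrite (_ : (fun t => _) = fun=> 0); first by rewrite big_nil; exact: cvg_cst.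
  by apply/funext => t; rewrite big_nil.
rewrite (_ : (fun t => _) = (fun t => f i t + \sum_(i <- r) f i t)); last first.
  by apply/funext => t; rewrite big_cons.
by rewrite big_cons; exact: (cvgD (fa i) ih).
Qed.

Lemma within_near (B : normedModType C) (g : X -> B) x (e : R) :
  {within A, continuous g} -> A x -> 0 < e ->
  nbhs x [set y | A y -> nrm (g y - g x) < e].
Proof.
move=> /subspace_continuousP cg Ax e0; have /cvg_nrmP/(_ e e0) := cg x Ax.
rewrite /prop_near1 /within /= => h.
apply: (@filterS _ (nbhs x) _ _ _ _ h) => y hy Ay; rewrite nrmBC; exact: hy.
Qed.

Lemma compact_continuous_bounded (B : normedModType C) (g : X -> B) :
  {within A, continuous g} -> exists2 M : R, 0 <= M & forall x, A x -> nrm (g x) <= M.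
Proof.
move=> cg; have [n [c [D [Ac _ DV _ DA]]]] := compact_borel_partition hX cA
  (fun x Ax => within_near cg Ax (@ltr01 R)).
exists (\sum_(i < n) nrm (g (c i)) + 1) => [|x Ax].
  by rewrite addr_ge0// sumr_ge0// => i _; exact: nrm_ge0.
have [i _ Dx] : (\bigcup_i D i) x by rewrite DA.
rewrite (le_trans (nrm_leD _ (g (c i))))// addrC lerD ?(ltW (DV _ _ Dx Ax))//.
by rewrite (bigD1 i)//= lerDl sumr_ge0// => j _; exact: nrm_ge0.
Qed.

(** By a partition of unity: the weight of [g (c i)] at [x] is proportional to the
    positive part of [e - nrm (g x - g (c i))]. *)
Lemma finite_rank_approx (B : normedModType C) (g : X -> B) (e : R) :
  {within A, continuous g} -> 0 < e ->
  exists n (f : 'I_n -> X -> C) (v : 'I_n -> B),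
    (forall i, {within A, continuous (f i)}) /\
    forall x, A x -> nrm (\sum_(i < n) f i x *: v i - g x) <= e.
Proof.
move=> cg e0; have [n [c [D [Ac _ DV _ DA]]]] := compact_borel_partition hX cA
  (fun x Ax => within_near cg Ax e0).
pose h i x := e - nrm (g x - g (c i)); pose psi i x := h i x + `|h i x|.
pose S x := \sum_(i < n) psi i x.
have psi0 i x : 0 <= psi i x by rewrite /psi; have := ler_norm (- h i x); rewrite normrN; lra.
have S0 x : A x -> 0 < S x.
  move=> Ax; have [i _ Dx] : (\bigcup_i D i) x by rewrite DA.
  have hi : 0 < h i x by rewrite subr_gt0 (DV _ _ Dx).
  rewrite /S (bigD1 i)//= ltr_pwDl ?sumr_ge0// /psi.
  by rewrite gtr0_norm// addr_gt0.
exists n, (fun i x => (psi i x / S x)%:C), (g \o c); split=> [i|x Ax].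
  apply/subspace_continuousP => x Ax.
  have cgx : g @ within A (nbhs x) --> g x by move/subspace_continuousP : cg; exact.
  have cpsi j : psi j @ within A (nbhs x) --> psi j x.
    have ch : h j @ within A (nbhs x) --> h j x.
      by apply: cvgB; [exact: cvg_cst|apply: cvg_nrm; apply: cvgB; [exact: cgx|exact: cvg_cst]].
    exact: (cvgD ch (cvg_norm ch)).
  have cS : S @ within A (nbhs x) --> S x.
    by apply: cvg_sum => j; exact: cpsi.
  apply: cvg_real_complex; apply: cvgM; first exact: cpsi.
  by apply: cvgV => //; rewrite gt_eqF// S0.
have Sx := S0 x Ax.
have -> : g x = \sum_(i < n) (psi i x / S x)%:C *: g x.
  by rewrite -scaler_suml -raddf_sum -mulr_suml mulfV ?gt_eqF// scale1r.
rewrite -sumrB (le_trans (nrm_sum _ _ _))//.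
apply: (@le_trans _ _ (\sum_(i < n) psi i x / S x * e)); last first.
  by rewrite -mulr_suml -mulr_suml mulfV ?gt_eqF// mul1r.
apply: ler_sum => i _; rewrite -scalerBr nrmZ nrm_real ger0_norm ?divr_ge0//; last exact: ltW.
rewrite -![_ / S x * _]mulrAC ler_wpM2r ?invr_ge0 ?(ltW Sx)//.
have [he|he] := lerP (nrm (g x - g (c i))) e; first by rewrite nrmBC ler_wpM2l.
have -> : psi i x = 0 by rewrite /psi ltr0_norm ?subrr// subr_lt0.
by rewrite !mul0r.
Qed.

End partition_of_unity.

(** By [finite_rank_approx] the products [f *: v] span a uniformly dense space. *)
Lemma universal_criterion (R : realType) (X : ptopologicalType) (H : hilbertType R[i])
    (K : X -> X -> bop H) : hausdorff_space X -> pd_kernel K -> RKHS_continuous K ->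
  (forall (A : set X) (f : X -> R[i]) v (e : R), compact A -> {within A, continuous f} -> 0 < e ->
    exists2 h, h \in rkhs_pred K & forall x, A x -> nrm (h x - f x *: v) <= e) ->
  universal K.
Proof.
move=> hX pdK cK happ; split => // A g e cA cg e0.
have e40 : 0 < e / 4 by lra.
have [n [f [v [cf fg]]]] := finite_rank_approx hX cA cg e40.
have [d d0 dn] := small_factor e40 (ler0n R n).
have [h hK hf] : exists2 h : 'I_n -> X -> H, forall i, h i \in rkhs_pred K &
    forall i x, A x -> nrm (h i x - f i x *: v i) <= d.
  have /choice[h hP] : forall i, exists h : X -> H, h \in rkhs_pred K /\
      forall x, A x -> nrm (h x - f i x *: v i) <= d.
    by move=> i; have [h h1 h2] := happ A (f i) (v i) d cA (cf i) d0; exists h.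
  by exists h => i; have [] := hP i.
have /asboolP[c hc] : \sum_(i < n) h i \in rkhs_pred K by apply: rpred_sum => i _; exact: hK.
exists (\sum_(i < n) h i); first exact: (in_RKHS_bound pdK hc).
apply: (@le_lt_trans _ _ (e / 2)%:E); last by rewrite lte_fin; lra.
apply: ge_ereal_sup => _ [x Ax <-]; rewrite lee_fin fct_sumE.
rewrite (le_trans (nrm_triangle (\sum_(i < n) f i x *: v i) _ _))//.
apply: (@le_trans _ _ (d * n%:R + e / 4)); last by lra.
rewrite lerD ?fg// -sumrB (le_trans (nrm_sum _ _ _))//.
apply: (@le_trans _ _ (\sum_(i < n) d)); first by apply: ler_sum => i _; exact: hf.
by rewrite sumr_const card_ord mulr_natr.
Qed.

Lemma knorm_leD (R : realType) (X : choiceType) (H : hilbertType R[i])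
    (K K1 K2 : X -> X -> bop H) s :
  (forall x y, K x y = K1 x y + K2 x y) -> pd_kernel K2 -> knorm K1 s <= knorm K s.
Proof.
move=> KE pd2; apply: ler_wsqrtr.
have -> : kform K s s = kform K1 s s + kform K2 s s.
  rewrite -kformD; congr (kform _ s s).
  by apply/funext => z; apply/funext => y; exact: KE.
by rewrite raddfD lerDl -ler0c -ge0_Re; exact: kform_ge0.
Qed.

(** The seminorm of [K1] is at most that of [K], and Cauchy-Schwarz for [K1] bounds its
    sections against it. *)
Lemma dominated_kernel_rkhs (R : realType) (X : choiceType) (H : hilbertType R[i])
    (K K1 K2 : X -> X -> bop H) x u : pd_kernel K1 -> pd_kernel K2 ->
  (forall x y, K x y = K1 x y + K2 x y) -> (fun y => K1 y x u) \in rkhs_pred K.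
Proof.
move=> pd1 pd2 KE; apply/asboolP; exists (knorm K1 [:: (x, u)]) => s.
have -> : (fun y => K1 y x u) = kspan K1 [:: (x, u)].
  by apply/funext => y; rewrite /kspan big_seq1.
rewrite eval_form_kspan// mulrC (le_trans (kform_le pd1 _ _))// ler_wpM2r ?knorm_ge0//.
exact: knorm_leD KE pd2.
Qed.

Section mixture_universality.
Variables (R : realType) (H : hilbertType R[i]) (X Omega : ptopologicalType).
Local Notation C := R[i].
Variables (p : Omega -> X -> X -> C) (Lam : set (borel Omega) -> bop H) (M : R).
Variables (mu : {finite_measure set (borel Omega) -> \bar R}).
Hypothesis D : mixture_data p Lam M mu.

Lemma mixture_RKHS_continuous A : measurable A -> RKHS_continuous (mixture_on p Lam mu A).
Proof.
move=> mA; apply: bounded_continuous_RKHS; last exact: (mixture_on_continuous D).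
by exists (M * fine (mu A)) => x y; exact: (mixture_on_bounded D).
Qed.

(** [P_A] is dominated by [P]. *)
Lemma mixture_on_rkhs (A : set (borel Omega)) x u : measurable A ->
  (fun y => mixture_on p Lam mu A y x u) \in rkhs_pred (mixture_on p Lam mu setT).
Proof.
move=> mA; have pdA := mixture_on_pd D mA; have mC := measurableC mA.
by apply: (dominated_kernel_rkhs x u pdA (mixture_on_pd D mC)) => y z; exact: (mixture_onD D).
Qed.

(** If for [w] near [w_k] a combination of sections of [p_w] is close to [f], then
    integrating it against [Lam u] gives an element of the space of [P] close to
    [f *: Lam Omega u]. The range of a positive definite operator being dense, all
    products [f *: v] are reached. *)
Lemma mixture_universal : hausdorff_space X ->
  (forall w, universal (scalar_kernel (p w))) -> pd_op (Lam setT) ->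
  universal (mixture_on p Lam mu setT).
Proof.
move=> hX pu Lpd; apply: universal_criterion => //.
  exact: (mixture_on_pd D).
  exact: mixture_RKHS_continuous.
move=> A f v e cA cf e0.
have hO := mixture_hausdorff D; have LD := Lam_dominated D.
have [N N0 fN] := compact_continuous_bounded hX cA cf.
have e20 : 0 < e / 2 by lra.
have e40 : 0 < e / 4 by lra.
(* [Lam Omega u] will stand for [v]. *)
have [d d0 dN] := small_factor e20 N0.
have [u hu] := pd_op_dense_range Lpd v d0.
have [e1 e10 he1] := small_factor e40
  (mulr_ge0 (mulr_ge0 (ler0n R 2) (fine_measure_ge0 mu setT)) (nrm_ge0 u)).
have [e2 e2_0 he2] := small_factor e40 (mulr_ge0 N0 (nrm_ge0 u)).
have /choice[l lP] : forall w, exists l : seq (C * X),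
    forall y, A y -> nrm (\sum_(a <- l) a.1 * p w y a.2 - f y) < e1.
  by move=> w; exact: (universal_span (mixture_bounded D w) (pu w) cA cf e10).
(* The same coefficients serve for all parameters near [w]. *)
pose V w := [set w' | forall y, A y ->
  nrm (\sum_(a <- l w) a.1 * p w' y a.2 - \sum_(a <- l w) a.1 * p w y a.2) < e1].
have nV w : nbhs w (V w).
  pose F (z : Omega * X) : C := \sum_(a <- l w) a.1 * p z.1 z.2 a.2.
  have cF : continuous F.
    apply: continuous_sum => a z; apply: cvgM; first exact: cvg_cst.
    have c1 : continuous (fun z : Omega * X => (z.1, z.2, a.2)).
      apply: continuous_pair; last exact: continuous_const.
      by apply: continuous_pair; [exact: (continuous_pr1 (@continuous_id _))|exact: (continuous_pr2 (@continuous_id _))].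
    exact: (continuous_compose c1 (mixture_continuous D)).
  exact: (compact_uniform_near w cA cF e10).
have [K cK Ke] := radon_tight hO (mixture_radon D) e2_0.
have mK := compact_borel hO cK.
have [n [c [Dk [_ mD DV tD DK]]]] := compact_borel_partition hO cK (fun w _ => nV w).
pose h := \sum_(k < n) \sum_(a <- l (c k)) a.1 *: (fun y => mixture_on p Lam mu (Dk k) y a.2 u).
exists h.
  apply: rpred_sum => k _; apply: rpred_sum => a _; apply: rpredZ; exact: mixture_on_rkhs.
move=> y Ay.
pose T := \sum_(k < n) \sum_(a <- l (c k)) a.1 *: mixture_on p Lam mu (Dk k) y a.2.
have hT : h y = T u.
  rewrite /h /T fct_sumE bop_sum; apply: eq_bigr => k _.
  by rewrite fct_sumE bop_sum; apply: eq_bigr => a _; rewrite bopZ.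
have TP : is_Lint Lam mu (fun w => \sum_(k < n) \sum_(a <- l (c k))
    a.1 *: (\1_(Dk k) w * p w y a.2 : C)) T.
  apply: (is_int_sum LD) => k; apply: (is_int_sum LD) => a.
  by apply: (is_intZ LD); exact: (mixture_onP D).
have dist : nrm (T - f y *: Lam setT) <= 2 * e1 * fine (mu K) + N * fine (mu (~` K)).
  have := is_intB LD TP (is_intZ LD (f y) (Lint_indic D measurableT)).
  have sumE w : \sum_(k < n) \sum_(a <- l (c k)) a.1 *: (\1_(Dk k) w * p w y a.2 : C) =
      \sum_(k < n) \1_(Dk k) w * (\sum_(a <- l (c k)) a.1 * p w y a.2).
    apply: eq_bigr => k _; rewrite mulr_sumr; apply: eq_bigr => a _.
    by rewrite -[_ *: _]/(_ * _); ring.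
  apply: (is_int_bound LD _ N0 mK) => [|w Kw|w Kw]; first by rewrite mulr_ge0// ltW.
    rewrite sumE indicT; have [k _ Dkw] : (\bigcup_i Dk i) w by rewrite DK.
    rewrite (trivIset_indic_sum _ tD Dkw) -[_ *: _]/(_ * _) mulr1.
    rewrite (le_trans (nrm_triangle (\sum_(a <- l (c k)) a.1 * p (c k) y a.2) _ _))//.
    by rewrite mulr_natl mulr2n lerD// ltW//; [exact: (DV _ _ Dkw)|exact: lP].
  rewrite sumE indic_sum0 ?sub0r ?nrmN ?indicT; last first.
    by move=> k Dkw; apply: Kw; rewrite -DK; exists k.
  by rewrite -[_ *: _]/(_ * _) mulr1 fN.
rewrite hT (le_trans (nrm_triangle (f y *: Lam setT u) _ _))//.
rewrite -bopZ -bopB bopZ -scalerBr nrmZ.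
have h1 : nrm (f y) * nrm (Lam setT u - v) <= d * N.
  by rewrite mulrC ler_pM ?nrm_ge0 ?fN// nrmBC ltW.
have h2 : nrm ((T - f y *: Lam setT) u) <=
    (2 * e1 * fine (mu K) + N * fine (mu (~` K))) * nrm u.
  by rewrite (le_trans (nrm_bop_le _ _))// ler_wpM2r ?nrm_ge0.
have h3 : 2 * e1 * fine (mu K) * nrm u <= e1 * (2 * fine (mu setT) * nrm u).
  rewrite [leRHS]mulrA ler_wpM2r ?nrm_ge0// mulrCA mulrA ler_wpM2l ?mulr_ge0 ?(ltW e10)//.
  exact: fine_measure_le.
have h4 : N * fine (mu (~` K)) * nrm u <= e2 * (N * nrm u).
  by rewrite [leRHS]mulrA ler_wpM2r ?nrm_ge0// mulrC ler_wpM2r.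
lra.
Qed.

End mixture_universality.

(** * Density points of the Radon-Nikodym derivative *)

Section density_points.
Variables (R : realType) (Omega : ptopologicalType).
Variables (mu lam : {finite_measure set (borel Omega) -> \bar R}).
Hypotheses (hO : hausdorff_space Omega) (mu_radon : radon mu).
Hypothesis mu_lam : forall A, measurable A -> lam A = 0%E -> mu A = 0%E.

(** By inner regularity of [mu] on the union of the open sets, it suffices to look at
    compact sets, which are covered by finitely many of them. *)
Lemma locally_null_negligible (E : set (borel Omega)) : measurable E ->
  mu.-negligible ((\bigcup_(U in [set U : set Omega | open U /\ lam (U `&` E) = 0%E]) U) `&` E).
Proof.
move=> mE; set W := \bigcup_(U in _) _.
have oW : open W by apply: bigcup_open => U [].
have mW := open_borel oW; exists (W `&` E); split => //; first exact: measurableI.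
apply/eqP; rewrite eq_le measure_ge0 andbT; apply/lee_addgt0Pr => e e0; rewrite add0e.
have [_ /(_ W e oW e0)[K [cK KW Ke]]] := (radonP hO mu).1 mu_radon.
have mK := compact_borel hO cK.
have KV w : K w -> exists U : set Omega, [/\ open U, lam (U `&` E) = 0%E & U w].
  by move=> /KW[U [oU U0] Uw]; exists U.
pose V w := xget setT [set U : set Omega | [/\ open U, lam (U `&` E) = 0%E & U w]].
have VP w : K w -> [/\ open (V w), lam (V w `&` E) = 0%E & V w w].
  by move=> /KV[U hU]; rewrite /V; case: xgetP => [U' _ //|/(_ U)].
have KnV w : K w -> nbhs w (V w) by move=> /VP[oV _ Vw]; exact: open_nbhs_nbhs.
have [n [c [D [Kc mD DV tD DK]]]] := compact_borel_partition hO cK KnV.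
have mDE i : measurable (D i `&` E) by exact: measurableI.
have K0 : mu (K `&` E) = 0%E.
  rewrite -DK setI_bigcupl measure_fin_bigcup//; [|exact: finite_finset|exact: trivIset_setIr].
  rewrite fsbig1// => i _; apply: mu_lam => //.
  have [oV V0 _] := VP _ (Kc i).
  apply: (subset_measure0 (mDE i) _ _ V0); last exact: setSI.
  by apply: measurableI => //; exact: open_borel.
have mWK : measurable (W `\` K : set (borel Omega)) by exact: measurableD.
pose S : set (borel Omega) := W `\` K `|` K `&` E.
have h1 : (mu (W `&` E : set (borel Omega)) <= mu S)%E.
  apply: le_measure; rewrite ?inE; [exact: measurableI|apply: measurableU => //; exact: measurableI|].
  by move=> w [Ww Ew]; have [Kw|nKw] := pselect (K w); [right|left].
apply: (le_trans h1).
rewrite measureU//=; first by rewrite K0 adde0 -(measure_fineK mu mWK) lee_fin.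
  exact: measurableI.
by rewrite -subset0 => w [[_ nK] [Kw _]].
Qed.

Variables (B : normedModType R[i]) (G : borel Omega -> B) (s : nat -> borel Omega -> B).
Hypotheses (fs : forall n, simple_fun (s n)) (sG : forall w, s ^~ w @ \oo --> G w).

(** A weak form of Lebesgue point: arbitrarily close to [w] there is some set of
    positive measure on which [G] is nearly [G w]. *)
Definition density_point (w : Omega) := forall (U : set Omega) (e : R), open U -> U w -> 0 < e ->
  exists A : set (borel Omega), [/\ measurable A, A `<=` U, 0 < fine (lam A) &
    forall w', A w' -> nrm (G w' - G w) <= e].

Lemma simple_values : exists u : nat -> B, forall n w, exists k, s n w = u k.
Proof.
have /countable_injP[f finj] : countable (\bigcup_n range (s n)).
  apply: bigcup_countable => // n _; apply: finite_set_countable; exact: (fs n).1.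
pose u n := xget (0 : B) [set x | (\bigcup_n range (s n)) x /\ f x = n].
exists u => n w; exists (f (s n w)); rewrite /u.
have h : (\bigcup_n range (s n)) (s n w) by exists n => //; exists w.
by case: xgetP => [y _ [Dy fy]|/(_ (s n w))[]//]; apply: finj; rewrite ?mem_set.
Qed.

(** A point that is not a density point lies in one of the countably many locally null
    sets attached to the values of the simple approximants and the radii [1 / m]. *)
Lemma density_point_ae : mu.-negligible [set w | ~ density_point w].
Proof.
have [u uP] := simple_values.
pose E k m : set (borel Omega) := [set w | nrm (G w - u k) < m.+1%:R^-1].
have mE k m : measurable (E k m).
  by rewrite -[E k m]setTI; exact: (measurable_fun_ltr (simple_cvg_measurable (u k) fs sG) (measurable_cst _)).
pose N k m := (\bigcup_(U in [set U : set Omega | open U /\ lam (U `&` E k m) = 0%E]) U) `&` E k m.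
have : mu.-negligible (\bigcup_k \bigcup_m N k m).
  by apply: negligible_bigcup => k; apply: negligible_bigcup => m; exact: locally_null_negligible.
apply: negligibleS => w nd; apply: contrapT => nN; apply: nd => U e oU Uw e0.
have e20 : 0 < e / 2 by lra.
have [m me] := ex_harmonic_small e20.
have m0 : 0 < m.+1%:R^-1 :> R by rewrite invr_gt0.
have /cvg_nrmP/(_ _ m0)/filter_ex[n hn] := @sG w.
have [k sk] := uP n w; rewrite sk in hn.
exists (U `&` E k m); split.
- by apply: measurableI => //; exact: open_borel.
- by move=> w' [].
- rewrite lt_def fine_measure_ge0 andbT; apply/eqP => l0; apply: nN.
  exists k => //; exists m => //; split => //; exists U => //; split => //.
  by rewrite -measure_fineK ?l0//; apply: measurableI => //; exact: open_borel.
- move=> w' [_ Ew']; rewrite (le_trans (nrm_triangle (u k) _ _))//.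
  move: Ew'; rewrite /E /= => Ew'; rewrite [leRHS]splitr lerD//.
    by rewrite ltW// (lt_trans Ew').
  by rewrite nrmBC ltW// (lt_trans hn).
Qed.

End density_points.

(** * Functionals of kernels and strict positive definiteness of mixtures *)

Section kernel_functionals.
Variables (R : realType) (H : hilbertType R[i]) (X : ptopologicalType).
Local Notation C := R[i].

Definition nice_kernel (K : X -> X -> bop H) :=
  bounded_kernel K /\ continuous (fun z : X * X => K z.1 z.2).

(** An abstract version of [K |-> Re (sum of <K(x_i, x_j) v_j, v_i>)] and of
    [K |-> Re (double integral of K)]: by the tightness clause the values of [K] off a
    large compact set matter little. *)
Record kernel_functional (Q : (X -> X -> bop H) -> R) : Prop := KernelFunctional {
  kernel_functionalD : forall K1 K2, nice_kernel K1 -> nice_kernel K2 ->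
    Q (fun x y => K1 x y + K2 x y) = Q K1 + Q K2 ;
  kernel_functionalZ : forall (a : R) K, nice_kernel K ->
    Q (fun x y => a%:C *: K x y) = a * Q K ;
  kernel_functional_ge0 : forall K, nice_kernel K -> pd_kernel K -> 0 <= Q K ;
  kernel_functional_tight : forall e : R, 0 < e -> exists (X0 : set X) (c : R),
    [/\ compact X0, 0 <= c & forall K (a b : R), nice_kernel K -> 0 <= a ->
      (forall x y, X0 x -> X0 y -> nrm (K x y) <= a) -> (forall x y, nrm (K x y) <= b) ->
      `|Q K| <= c * a + e * b] }.

Lemma nice_kernelD K1 K2 : nice_kernel K1 -> nice_kernel K2 ->
  nice_kernel (fun x y => K1 x y + K2 x y).
Proof.
move=> [[a Ka] cK1] [[b Kb] cK2]; split.
  by exists (a + b) => x y; rewrite (le_trans (nrm_normD _ _))// lerD.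
by move=> z; exact: (cvgD (cK1 z) (cK2 z)).
Qed.

Lemma nice_kernelZ a K : nice_kernel K -> nice_kernel (fun x y => a *: K x y).
Proof.
move=> [[b Kb] cK]; split; last by move=> z; apply: cvgZr; exact: cK.
by exists (nrm a * b) => x y; rewrite nrmZ ler_wpM2l ?nrm_ge0.
Qed.

Lemma nice_scalar (q : X -> X -> C) (T : bop H) (M : R) : (forall x y, nrm (q x y) <= M) ->
  continuous (fun z : X * X => q z.1 z.2) -> nice_kernel (fun x y => q x y *: T).
Proof.
move=> qM cq; split; last by move=> z; apply: cvgZl; exact: cq.
by exists (M * nrm T) => x y; rewrite nrmZ ler_wpM2r ?nrm_ge0.
Qed.

(** The values at both summands are nonnegative and add up to 0. *)
Lemma kernel_functional0 Q K : kernel_functional Q -> nice_kernel K ->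
  Q K = 0 -> pd_kernel K -> forall K1 K2, nice_kernel K1 -> nice_kernel K2 ->
  pd_kernel K1 -> pd_kernel K2 -> (forall x y, K x y = K1 x y + K2 x y) -> Q K1 = 0.
Proof.
move=> kQ nK QK0 pK K1 K2 n1 n2 p1 p2 KE.
have : Q K1 + Q K2 = 0.
  rewrite -(kernel_functionalD kQ)// -[RHS]QK0; congr Q.
  by apply/funext => x; apply/funext => y; rewrite KE.
have := kernel_functional_ge0 kQ n1 p1; have := kernel_functional_ge0 kQ n2 p2; lra.
Qed.

End kernel_functionals.

Section rank_one.
Variables (R : realType) (H : hilbertType R[i]).

Lemma rank1_subproof (a : H) : (fun v => inner v a *: a) \in @bounded_linear R H.
Proof.
apply/asboolP; split=> [c u v|]; first by rewrite innerDl innerZl scalerDl scalerA.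
exists (nrm a * nrm a) => v; rewrite nrmZ mulrAC -mulrA mulrCA mulrA ler_wpM2r ?nrm_ge0//.
by rewrite cauchy_schwarz.
Qed.

Definition rank1 (a : H) : bop H := BOp (rank1_subproof a).

Lemma rank1_form (a v : H) : inner (rank1 a v) v = (nrm (inner v a) ^+ 2)%:C.
Proof. by rewrite /= innerZl [inner a v]innerC nrm_sqr. Qed.

Lemma rank1_psd a : psd_op (rank1 a).
Proof. by move=> v; rewrite rank1_form ler0c sqr_ge0. Qed.

(** Cauchy-Schwarz for the form [<T u, v>]. *)
Lemma psd_rank1_le (T : bop H) u : psd_op T ->
  psd_op ((complex.Re (inner (T u) u))%:C *: T - rank1 (T u)).
Proof.
move=> T0 v; rewrite bopB bopZ innerBl innerZl rank1_form.
rewrite [inner (T v) v]ge0_Re// -rmorphM -rmorphB ler0c subr_ge0.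
by rewrite -(psd_op_sym v u T0) mulrC; exact: psd_op_cauchy_schwarz.
Qed.

End rank_one.

Section mixture_density.
Variables (R : realType) (H : hilbertType R[i]) (X Omega : ptopologicalType).
Local Notation C := R[i].
Variables (p : Omega -> X -> X -> C) (Lam : set (borel Omega) -> bop H) (M : R).
Variables (mu lam : {finite_measure set (borel Omega) -> \bar R}) (G : Omega -> bop H).
Hypothesis D : mixture_data p Lam M mu.
Hypothesis RN : RN_decomposition Lam lam G.

Let hO := mixture_hausdorff D.
Let lam_dom := @bochner_dominated _ (borel Omega) R (bop H) lam.

Let M0 : 0 <= M.
Proof. by rewrite (le_trans _ (mixture_bounded D point point point))// nrm_ge0. Qed.

Lemma mixture_on_nice A : measurable A -> nice_kernel (mixture_on p Lam mu A).
Proof.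
move=> mA; split; last exact: (mixture_on_continuous D mA).
by exists (M * fine (mu A)) => x y; exact: (mixture_on_bounded D).
Qed.

Lemma section_nice w (T : bop H) : nice_kernel (fun x y => p w x y *: T).
Proof.
apply: (@nice_scalar _ _ _ _ _ M) => [x y|]; first exact: (mixture_bounded D).
exact: (p_continuousr D).
Qed.

Lemma opmeasure_lam_null A : measurable A -> lam A = 0%E -> Lam A = 0.
Proof.
move=> mA l0.
have h := bochner_indic RN mA; rewrite is_bochner_intE in h.
have h0 : is_int lam (fun A b => (fine (lam A))%:C *: b) (fun=> 0) (Lam A).
  apply: (is_int_ae_eq mA l0 _ h) => w nAw.
  by rewrite indicE memNset// scale0r.
exact: (is_int_unique lam_dom h0 (is_int0 lam_dom)).
Qed.

Lemma variation_lam_null A : measurable A -> lam A = 0%E -> mu A = 0%E.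
Proof.
move=> mA l0; apply/eqP; rewrite eq_le measure_ge0 andbT (mixture_variation D)//.
apply: ge_ereal_sup => _ [n [F [mF tF FA ->]]]; rewrite sumEFin lee_fin big1// => i _.
rewrite opmeasure_lam_null ?nrm0//; apply: (subset_measure0 (mF i) mA _ l0).
by rewrite -FA => t Fit; exists i.
Qed.

Variables (G' : borel Omega -> bop H) (s : nat -> borel Omega -> bop H).
Variables (N0 : set (borel Omega)).
Hypotheses (mN0 : measurable N0) (N00 : lam N0 = 0%E) (GG' : forall w, ~ N0 w -> G' w = G w).
Hypotheses (fs : forall n, simple_fun (s n)) (sG : forall w, s ^~ w @ \oo --> G' w).

Lemma Lint_local (phi : borel Omega -> C) t c' N A T0 (c : C) (T : bop H) (a b : R) :
  simple_limit phi t c' -> (forall w, nrm (phi w) <= N) -> is_Lint Lam mu phi T0 ->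
  measurable A -> 0 <= a -> 0 <= b -> 0 <= N ->
  (forall w, ~ A w -> phi w = 0) -> (forall w, A w -> nrm (phi w - c) <= a) ->
  (forall w, A w -> nrm (G' w - T) <= b) ->
  nrm (T0 - (fine (lam A))%:C *: (c *: T)) <= (a * nrm T + N * b) * fine (lam A).
Proof.
move=> sl phiN phiT mA a0 b0 N_ge0 phi0 phic GT.
have h := bochner_Lint D RN sl phiN phiT; rewrite is_bochner_intE in h.
have h' : is_int lam (fun A b => (fine (lam A))%:C *: b) (fun w => phi w *: G' w) T0.
  by apply: (is_int_ae_eq mN0 N00 _ h) => w nw; rewrite GG'.
have := is_intB lam_dom h' (is_int_indic lam_dom (c *: T) mA).
have k0 : 0 <= a * nrm T + N * b by rewrite addr_ge0 ?mulr_ge0 ?nrm_ge0.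
move=> /(is_int_bound lam_dom k0 (lexx 0) mA); rewrite mul0r addr0; apply=> w Aw.
  rewrite indicE mem_set// scale1r (le_trans (nrm_triangle (phi w *: T) _ _))//.
  rewrite -scalerBr -scalerBl !nrmZ addrC lerD// ?ler_wpM2r ?nrm_ge0 ?phic//.
  by rewrite ler_pM ?nrm_ge0 ?GT.
by rewrite indicE memNset// scale0r subr0 phi0// scale0r nrm0.
Qed.

Lemma mixture_on_density_local A w0 x y (a b : R) :
  measurable A -> 0 <= a -> 0 <= b ->
  (forall w : borel Omega, A w -> nrm (p w x y - p w0 x y) <= a) ->
  (forall w, A w -> nrm (G' w - G' w0) <= b) ->
  nrm (mixture_on p Lam mu A x y - (fine (lam A))%:C *: (p w0 x y *: G' w0)) <=
  (a * nrm (G' w0) + M * b) * fine (lam A).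
Proof.
move=> mA a0 b0 pa Gb; have [t [c sp]] := p_simple_limit D x y.
apply: (Lint_local (simple_limit_indic mA sp) _ (mixture_onP D x y mA)) => //.
- by move=> w; rewrite (le_trans (indic_nrm_le _ _ _))// (mixture_bounded D).
- by move=> w nAw; rewrite indicE memNset// mul0r.
- by move=> w Aw; rewrite indicE mem_set// mul1r pa.
Qed.

Lemma Lam_density_local A w0 (b : R) : measurable A -> 0 <= b ->
  (forall w, A w -> nrm (G' w - G' w0) <= b) ->
  nrm (Lam A - (fine (lam A))%:C *: G' w0) <= b * fine (lam A).
Proof.
move=> mA b0 Gb.
have := @Lint_local _ _ _ 1 A (Lam A) 1 (G' w0) 0 b (simple_limit_indic1 R mA) (nrm_indic_le1 R A)
  (Lint_indic D mA) mA (lexx 0) b0 ler01.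
rewrite scale1r mul0r add0r mul1r; apply=> // w Aw; rewrite indicE.
  by rewrite memNset.
by rewrite mem_set// subrr nrm0.
Qed.

(** [G(w)] is a limit of averages [Lam A / lam A]. *)
Lemma density_psd w0 : density_point lam G' w0 -> psd_op (G' w0).
Proof.
move=> dw v; apply: ge0_closed => e e0.
have [b b0 be] := small_factor e0 (mulr_ge0 (nrm_ge0 v) (nrm_ge0 v)).
have [A [mA _ lA GA]] := dw setT b openT Logic.I b0.
have h := Lam_density_local mA (ltW b0) GA; set l := fine (lam A) in lA h.
exists (l^-1%:C * inner (Lam A v) v).
  by rewrite mulr_ge0 ?ler0c ?invr_ge0 ?(ltW lA)//; exact: (Lam_psd D mA).
have -> : inner (G' w0 v) v - l^-1%:C * inner (Lam A v) v =
    - (l^-1%:C * inner ((Lam A - l%:C *: G' w0) v) v).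
  rewrite bopB bopZ innerBl innerZl mulrBr mulrA -rmorphM mulVf ?gt_eqF//.
  by rewrite mul1r opprB.
rewrite nrmN nrmM nrm_real ger0_norm ?invr_ge0 ?(ltW lA)// ler_pdivrMl//.
rewrite (le_trans (cauchy_schwarz _ _))//.
apply: (@le_trans _ _ (b * l * nrm v * nrm v)).
  by rewrite ler_wpM2r ?nrm_ge0// (le_trans (nrm_bop_le _ _))// ler_wpM2r ?nrm_ge0.
by rewrite -mulrA mulrAC mulrC ler_wpM2l ?(ltW lA) ?(ltW be).
Qed.

Variable Q : (X -> X -> bop H) -> R.
Hypotheses (kQ : kernel_functional Q) (QP : Q (mixture_on p Lam mu setT) = 0).

Lemma kernel_functional_mixB A : measurable A -> Q (mixture_on p Lam mu A) = 0.
Proof.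
move=> mA; have mC := measurableC mA.
apply: (kernel_functional0 kQ (mixture_on_nice measurableT) QP (mixture_on_pd D measurableT)
  (mixture_on_nice mA) (mixture_on_nice mC) (mixture_on_pd D mA) (mixture_on_pd D mC)) => x y.
exact: (mixture_onD D).
Qed.

(** Divided by [lam A], the kernels [P_A] converge to [p_w G(w)] as [A] shrinks to the
    density point [w], uniformly on compact sets and boundedly. *)
Lemma kernel_functional_density w0 : density_point lam G' w0 ->
  Q (fun x y => p w0 x y *: G' w0) = 0.
Proof.
move=> dw; apply/eqP; rewrite -normr_eq0 eq_le normr_ge0 andbT.
apply/ler_addgt0Pr => e e0; rewrite add0r; set K0 := fun x y => _.
have e30 : 0 < e / 3 by lra.
have g0 := nrm_ge0 (G' w0); set g := nrm (G' w0) in g0.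
have k0 : 0 <= 2 * M * g + M by rewrite addr_ge0 ?mulr_ge0.
have [e1 e10 he1] := small_factor e30 k0.
have [X0 [c [cX0 c0 tight]]] := kernel_functional_tight kQ e10.
have [a a0 ha] := small_factor e30 (mulr_ge0 c0 g0).
have [b' b'0 hb'] := small_factor e30 (mulr_ge0 c0 M0).
pose b := Num.min b' 1; have b0 : 0 < b by rewrite lt_min b'0 ltr01.
have b1 : b <= 1 by rewrite ge_min lexx orbT.
have hb : b * (c * M) <= e / 3.
  by rewrite (le_trans _ (ltW hb'))// ler_wpM2r ?mulr_ge0// ge_min lexx.
pose f (u : Omega * (X * X)) : C := p u.1 u.2.1 u.2.2.
have cf : continuous f.
  have h1 : continuous (fun u : Omega * (X * X) => (u.1, u.2.1, u.2.2)).
    have c0' : continuous (fun u : Omega * (X * X) => u) by exact: continuous_id.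
    have c2 := continuous_pr2 c0'.
    apply: continuous_pair; last exact: (continuous_pr2 c2).
    by apply: continuous_pair; [exact: (continuous_pr1 c0')|exact: (continuous_pr1 c2)].
  exact: (continuous_compose h1 (mixture_continuous D)).
have nU := compact_uniform_near w0 (compact_setX cX0 cX0) cf a0.
have [A [mA AU lA GA]] := dw _ b (open_interior _) (nU : interior _ w0) b0.
set l := fine (lam A) in lA.
(* The error kernel [P_A - lam A p_w0 G(w0)] is small on [X0 x X0] and bounded by a
   multiple of [lam A] everywhere. *)
pose K x y := mixture_on p Lam mu A x y + (- l)%:C *: K0 x y.
have nK0 : nice_kernel K0 by exact: section_nice.
have nlK0 := nice_kernelZ (- l)%:C nK0.
have QK : Q K = - l * Q K0.
  rewrite /K (kernel_functionalD kQ (mixture_on_nice mA) nlK0) kernel_functional_mixB// add0r.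
  exact: (kernel_functionalZ kQ).
have KE x y : K x y = mixture_on p Lam mu A x y - l%:C *: K0 x y.
  by rewrite /K rmorphN scaleNr.
have nK : nice_kernel K by exact: (nice_kernelD (mixture_on_nice mA) nlK0).
have gl0 : 0 <= (a * g + M * b) * l by rewrite mulr_ge0 ?addr_ge0 ?mulr_ge0 ?(ltW a0) ?(ltW b0) ?(ltW lA).
have := tight K ((a * g + M * b) * l) ((2 * M * g + M * b) * l) nK gl0.
rewrite QK normrM normrN (gtr0_norm lA) => h.
have {h} : l * `|Q K0| <= c * ((a * g + M * b) * l) + e1 * ((2 * M * g + M * b) * l).
  apply: h => [x y X0x X0y|x y]; rewrite KE.
    apply: (mixture_on_density_local mA (ltW a0) (ltW b0) _ GA) => w Aw.
    by apply: ltW; exact: (interior_subset (AU _ Aw) (x, y)).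
  apply: (mixture_on_density_local mA _ (ltW b0) _ GA) => [|w Aw]; first by rewrite mulr_ge0.
  by rewrite (le_trans (nrm_normD _ _))// nrmN mulr_natl mulr2n lerD ?(mixture_bounded D).
have -> : c * ((a * g + M * b) * l) + e1 * ((2 * M * g + M * b) * l) =
    l * (a * (c * g) + b * (c * M) + e1 * (2 * M * g + M * b)) by ring.
rewrite ler_pM2l// => h; apply: (le_trans h).
have : e1 * (2 * M * g + M * b) <= e1 * (2 * M * g + M).
  by rewrite ler_wpM2l ?(ltW e10)// lerD2l ler_piMr.
lra.
Qed.

(** By [psd_rank1_le] this kernel is dominated by a multiple of [p_w G(w)]. *)
Lemma kernel_functional_rank1 w0 u : density_point lam G' w0 ->
  Q (fun x y => p w0 x y *: rank1 (G' w0 u)) = 0.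
Proof.
move=> dw; have T0 := density_psd dw; have Q0 := kernel_functional_density dw.
set T := G' w0 in T0 Q0 *; set c := complex.Re (inner (T u) u).
have pdT (S : bop H) : psd_op S -> pd_kernel (fun x y => p w0 x y *: S).
  by apply: schur_kernel; exact: (mixture_pd D).
have c0 : 0 <= c by rewrite -ler0c -ge0_Re.
have nT := section_nice w0 T; have nc := section_nice w0 (c%:C *: T).
have Qc : Q (fun x y => p w0 x y *: (c%:C *: T)) = 0.
  have := kernel_functionalZ kQ c nT; rewrite Q0 mulr0 => <-; congr Q.
  by apply/funext => x; apply/funext => y; rewrite !scalerA mulrC.
have pc : psd_op (c%:C *: T) by move=> v; rewrite bopZ innerZl mulr_ge0// ler0c.
apply: (kernel_functional0 kQ nc Qc (pdT _ pc) (section_nice _ _)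
  (section_nice w0 (c%:C *: T - rank1 (T u))) (pdT _ (rank1_psd _)) (pdT _ (psd_rank1_le u T0))).
by move=> x y; rewrite -scalerDr addrC subrK.
Qed.

End mixture_density.

(** A functional vanishing at [P] vanishes at the products of [p_w] with the rank one
    operators of the vectors [G(w) u], for almost all [w]. If this makes [h] orthogonal
    to all [G(w) u], then [G(w) h = 0], and [Lam Omega h] is the integral of [G h]. *)
Theorem mixture_vanishing (R : realType) (H : hilbertType R[i]) (X Omega : ptopologicalType)
    (p : Omega -> X -> X -> R[i]) (Lam : set (borel Omega) -> bop H) (M : R)
    (mu lam : {finite_measure set (borel Omega) -> \bar R}) (G : Omega -> bop H)
    (Q : (X -> X -> bop H) -> R) (h : H) :
  mixture_data p Lam M mu -> RN_decomposition Lam lam G ->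
  kernel_functional Q -> Q (mixture_on p Lam mu setT) = 0 ->
  (forall w a, Q (fun x y => p w x y *: rank1 a) = 0 -> inner h a = 0) ->
  Lam setT h = 0.
Proof.
move=> D RN kQ QP Qh; have [[s0 /L1_approx_everywhere[G' [s [N0 [mN0 N00 GG' [fs sG] _]]]]] _] := RN.
have null := variation_lam_null D RN.
have [N [mN N1 sN]] := density_point_ae (mixture_hausdorff D) (mixture_radon D) null fs sG.
have G'h w : ~ N w -> G' w h = 0.
  move=> nN; have dw : density_point lam G' w by apply: contrapT => /sN.
  apply: inner_eq0; rewrite (psd_op_sym _ _ (density_psd D RN mN0 N00 GG' dw)).
  exact: Qh (kernel_functional_rank1 D RN mN0 N00 GG' kQ QP _ dw).
have LN : Lam N = 0.
  apply: nrm0_eq0; apply/eqP; rewrite eq_le nrm_ge0 andbT -lee_fin.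
  by have := variation_nrm Lam mN; rewrite -(mixture_variation D)// N1.
have mC := measurableC mN.
have -> : Lam setT = Lam (~` N).
  by rewrite -(setUv N) (vector_measureU (Lam_ca D))// ?setICr// LN add0r.
have lam_dom := @bochner_dominated _ (borel Omega) R (bop H) lam.
have lam_domH := @bochner_dominated _ (borel Omega) R H lam.
have := bochner_indic RN mC; rewrite is_bochner_intE => LC.
have LC' : is_int lam (fun A b => (fine (lam A))%:C *: b)
    (fun w => (\1_(~` N) w : R[i]) *: G' w) (Lam (~` N)).
  by apply: (is_int_ae_eq mN0 N00 _ LC) => w nw; rewrite GG'.
have LCh : is_int lam (fun A b => (fine (lam A))%:C *: b)
    ((fun T : bop H => T h) \o (fun w => (\1_(~` N) w : R[i]) *: G' w)) (Lam (~` N) h).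
  apply: (@is_int_map _ (borel Omega) R lam _ _ _ _ _ _ (fun T : bop H => T h) (fun T : bop H => T h)
    (nrm h) lam_domH.1 _ _ _ _ _ _ LC').
  - by move=> S T; rewrite -bopB mulrC nrm_bop_le.
  - by move=> S T; rewrite bopB.
  - exact: (continuous_bop_apply (@continuous_id _)).
  - by move=> A T _; rewrite bopZ.
suff z : (fun T : bop H => T h) \o (fun w => (\1_(~` N) w : R[i]) *: G' w) = fun=> 0.
  by rewrite z in LCh; exact: (is_int_unique lam_domH LCh (is_int0 lam_domH)).
apply/funext => w; rewrite -[LHS]/(((\1_(~` N) w : R[i]) *: G' w) h) bopZ indicE in_setC.
have [wN|wN] := boolP (w \in N); first by rewrite scale0r.
by rewrite G'h ?scaler0// => Nw; move: wN; rewrite mem_set.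
Qed.

Section strict_positivity.
Variables (R : realType) (H : hilbertType R[i]) (X Omega : ptopologicalType).
Local Notation C := R[i].
Variables (p : Omega -> X -> X -> C) (Lam : set (borel Omega) -> bop H) (M : R).
Variables (mu lam : {finite_measure set (borel Omega) -> \bar R}) (G : Omega -> bop H).
Hypothesis D : mixture_data p Lam M mu.
Hypothesis RN : RN_decomposition Lam lam G.

(** The points [x i] form a compact set outside which [K] does not matter at all. *)
Lemma kernel_form_functional n (x : 'I_n -> X) (v : 'I_n -> H) :
  kernel_functional (fun K : X -> X -> bop H => complex.Re (kernel_form K x v)).
Proof.
split.
- move=> K1 K2 _ _; rewrite -raddfD /kernel_form -big_split; congr complex.Re.
  apply: eq_bigr => i _; rewrite -big_split; apply: eq_bigr => j _.
  by rewrite bopD innerDl.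
- move=> a K _; rewrite -ReE_mulr /kernel_form mulr_sumr; congr complex.Re.
  apply: eq_bigr => i _; rewrite mulr_sumr; apply: eq_bigr => j _.
  by rewrite bopZ innerZl.
- by move=> K _ pK; rewrite -ler0c -ge0_Re; exact: kernel_form_ge0.
- move=> e e0; pose c := \sum_(i < n) \sum_(j < n) nrm (v j) * nrm (v i).
  have c0 : 0 <= c by apply: sumr_ge0 => i _; apply: sumr_ge0 => j _; rewrite mulr_ge0 ?nrm_ge0.
  exists (range x), c; split => //.
    apply: finite_compact; apply: finite_image; exact: finite_finset.
  move=> K a b _ a0 Ka Kb; have b0 : 0 <= b by rewrite (le_trans _ (Kb point point))// nrm_ge0.
  rewrite (@le_trans _ _ (c * a))//; last by rewrite lerDl mulr_ge0// ltW.
  rewrite (le_trans (Re_abs_nrm _))// (le_trans (nrm_sum _ _ _))// /c mulr_suml.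
  apply: ler_sum => i _; rewrite (le_trans (nrm_sum _ _ _))// mulr_suml; apply: ler_sum => j _.
  rewrite (le_trans (cauchy_schwarz _ _))// mulrAC ler_wpM2r ?nrm_ge0// mulrC.
  rewrite (le_trans (nrm_bop_le _ _))// ler_wpM2r ?nrm_ge0// Ka//; by exists i || exists j.
Qed.

(** At [v], the form of the product of [p_w] with [rank1 a] is the form of [p_w] at the
    scalars [<v i, a>]. *)
Lemma mixture_strictly_pd : (forall w, strictly_pd_kernel (scalar_kernel (p w))) ->
  pd_op (Lam setT) -> strictly_pd_kernel (mixture_on p Lam mu setT).
Proof.
move=> ps Lpd; split; first exact: (mixture_on_pd D).
move=> n x v xinj Pxv i; apply: contrapT => /eqP vi0.
have := Lpd _ vi0; rewrite lt_def => /andP[/eqP + _]; apply.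
have -> : Lam setT (v i) = 0; last exact: inner0l.
apply: (mixture_vanishing D RN (kernel_form_functional x v)) => [|w a]; first by rewrite Pxv.
have pdw : pd_kernel (fun z y => p w z y *: rank1 a).
  by apply: schur_kernel; [exact: (mixture_pd D)|exact: rank1_psd].
move=> Q0.
have F0 : kernel_form (fun z y => p w z y *: rank1 a) x v = 0.
  by rewrite [LHS]ge0_Re ?Q0//; exact: kernel_form_ge0.
apply: ((ps w).2 n x (fun j => inner (v j) a) xinj) => //.
rewrite -[RHS]F0 scalar_kernel_formE /kernel_form; apply: eq_bigr => k _; apply: eq_bigr => j _.
by rewrite bopZ /= !innerZl [inner a _]innerC mulrA.
Qed.

End strict_positivity.

(** * The double integral of a kernel against a vector measure *)

Record hilbert_measure_data (R : realType) (H : hilbertType R[i]) (X : ptopologicalType)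
    (eta : set (borel X) -> H) (mu : {finite_measure set (borel X) -> \bar R}) : Prop :=
  HilbertMeasureData {
  hilbert_measure_ca : countably_additive eta ;
  hilbert_measure_variation : forall A, measurable A -> mu A = Defs.variation eta A ;
  hilbert_measure_radon : radon mu }.

Lemma radon_vector_measure_data (R : realType) (H : hilbertType R[i]) (X : ptopologicalType)
    (eta : set (borel X) -> H) : hausdorff_space X -> radon_vector_measure eta ->
  exists mu : {finite_measure set (borel X) -> \bar R}, hilbert_measure_data eta mu.
Proof.
move=> hX [ca fin rad]; have [mu muE] := variation_measure ca fin.
by exists mu; split => //; apply: (eq_radon hX _ rad) => A mA; rewrite muE.
Qed.

(** The pairing with [eta], taken over a measure [mu] that agrees with the variation of
    [eta] on Borel sets. *)
Definition is_dual_int (R : realType) (H : hilbertType R[i]) (X : ptopologicalType)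
    (eta : set (borel X) -> H) (mu : {finite_measure set (borel X) -> \bar R})
    (F : borel X -> H) (z : R[i]) :=
  is_int mu (fun A (b : (H : normedModType R[i])) => (inner b (eta A) : (R[i] : normedModType R[i]))) F z.

Section energy.
Variables (R : realType) (H : hilbertType R[i]) (X : ptopologicalType).
Local Notation C := R[i].
Variables (eta : set (borel X) -> H) (mu : {finite_measure set (borel X) -> \bar R}).
Hypotheses (hX : hausdorff_space X) (sH : exists u : nat -> H, dense_seq u).
Hypothesis E : hilbert_measure_data eta mu.

Lemma eta_dominated : @dominated_op _ (borel X) R mu H (C : hilbertType C)
  (fun A b => inner b (eta A)).
Proof. exact: pairing_dominated (hilbert_measure_ca E) (hilbert_measure_variation E). Qed.

Lemma pairingE F z : is_dual_int eta mu F z -> pairing F eta = z.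
Proof.
move=> Fz; have muE := hilbert_measure_variation E.
have toint z' : is_pairing F eta z' -> is_dual_int eta mu F z'.
  move=> [s Fs sz]; exists s => //.
  by apply/(eq_measure_L1_approx _ _ (fun A mA => esym (muE A mA))).
have ispz : is_pairing F eta z.
  move: Fz => [s Fs sz]; exists s => //.
  by apply/(eq_measure_L1_approx _ _ (fun A mA => esym (muE A mA))).
rewrite /pairing; case: xgetP => [z' -> /toint h|/(_ z)//].
exact: (is_int_unique eta_dominated h Fz).
Qed.

Lemma dual_int_exists (F : X -> H) (N : R) : continuous F -> (forall x, nrm (F x) <= N) ->
  exists z, is_dual_int eta mu F z.
Proof.
move=> cF FN; have [s [c sl]] := continuous_simple_limit sH cF FN.
exact: (is_int_exists eta_dominated (simple_limit_L1 mu sl)).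
Qed.

Lemma continuous_slice1 (K : X -> X -> bop H) y : continuous (fun z : X * X => K z.1 z.2) ->
  continuous (fun x => K x y).
Proof.
move=> cK; have c1 : continuous (fun x : X => (x, y)).
  by apply: continuous_pair; [exact: continuous_id|exact: continuous_const].
exact: (continuous_compose c1 cK).
Qed.

(** By the Riesz representation theorem, since the pairing is linear in [v]. *)
Lemma mean_exists (K : X -> X -> bop H) (N : R) :
  (forall x y, nrm (K x y) <= N) -> continuous (fun z : X * X => K z.1 z.2) ->
  exists u : X -> H, forall y v, is_dual_int eta mu (fun x => K x y v) (inner v (u y)).
Proof.
move=> KN cK; have ED := eta_dominated.
have N0 : 0 <= N by rewrite (le_trans _ (KN point point))// nrm_ge0.
have KvN x y v : nrm (K x y v) <= N * nrm v.
  by rewrite (le_trans (nrm_bop_le _ _))// ler_wpM2r ?nrm_ge0.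
suff /choice[u uP] : forall y, exists u, forall v, is_dual_int eta mu (fun x => K x y v) (inner v u).
  by exists u.
move=> y.
have /choice[L LP] : forall v, exists z, is_dual_int eta mu (fun x => K x y v) z.
  move=> v; apply: (@dual_int_exists _ (N * nrm v)) => [|x]; last exact: KvN.
  exact: (continuous_bop_apply (continuous_slice1 cK)).
have [a v v'|v|u uP] := @riesz R H L (N * fine (mu setT)).
- apply: (is_int_unique ED (LP _)).
  have := is_intP ED a (LP v) (LP v').
  rewrite (_ : (fun x => a *: K x y v + K x y v') = (fun x => K x y (a *: v + v')))//.
  by apply/funext => x; rewrite linearP.
- apply: (@le_trans _ _ (N * nrm v * fine (mu setT))); last by rewrite mulrAC.
  apply: (is_int_bounded ED _ _ (LP v)) => [|x]; last exact: KvN.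
  by rewrite mulr_ge0 ?nrm_ge0.
by exists u => v; rewrite -uP.
Qed.

Lemma mean_nrm (F : X -> bop H) (w : H) (S : set (borel X)) (a b : R) :
  measurable S -> 0 <= a -> 0 <= b ->
  (forall x, S x -> nrm (F x) <= a) -> (forall x, ~ S x -> nrm (F x) <= b) ->
  (forall v, is_dual_int eta mu (fun x => F x v) (inner v w)) ->
  nrm w <= a * fine (mu S) + b * fine (mu (~` S)).
Proof.
move=> mS a0 b0 Fa Fb Fw; apply: nrm_le_inner => [|v].
  by rewrite addr_ge0 ?mulr_ge0 ?fine_measure_ge0.
rewrite mulrDl -![_ * _ * nrm v]mulrAC.
apply: (is_int_bound eta_dominated _ _ mS _ _ (Fw v)); rewrite ?mulr_ge0 ?nrm_ge0//.
  by move=> x Sx; rewrite (le_trans (nrm_bop_le _ _))// ler_wpM2r ?nrm_ge0 ?Fa.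
by move=> x Sx; rewrite (le_trans (nrm_bop_le _ _))// ler_wpM2r ?nrm_ge0 ?Fb.
Qed.

Lemma mean_nrm_bounded (F : X -> bop H) (w : H) (N : R) : 0 <= N ->
  (forall x, nrm (F x) <= N) ->
  (forall v, is_dual_int eta mu (fun x => F x v) (inner v w)) -> nrm w <= N * fine (mu setT).
Proof.
move=> N0 FN Fw.
have := @mean_nrm F w setT N 0 measurableT N0 (lexx 0) (fun x _ => FN x) _ Fw.
by rewrite mul0r addr0; apply => x /(_ Logic.I).
Qed.

(** [u] is the mean of [K] against [eta], and [z] the pairing of [u] with [eta], that is
    the double integral of [K]. *)
Record is_mean (K : X -> X -> bop H) (u : X -> H) (z : C) : Prop := IsMean {
  mean_dual : forall y v, is_dual_int eta mu (fun x => K x y v) (inner v (u y)) ;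
  mean_continuous : continuous u ;
  mean_energy : is_dual_int eta mu u z }.

(** The mean is continuous because [K] is so uniformly on compact sets and [eta] is
    tight; a bounded continuous function can be paired with [eta]. *)
Lemma nice_mean K : nice_kernel K -> exists u z, is_mean K u z.
Proof.
move=> [[N KN] cK]; have [u uP] := mean_exists KN cK.
have N0 : 0 <= N by rewrite (le_trans _ (KN point point))// nrm_ge0.
have uN y : nrm (u y) <= N * fine (mu setT).
  exact: (mean_nrm_bounded N0 (fun x => KN x y) (uP y)).
have cu : continuous u.
  move=> y0; apply/cvg_nrmP => e e0.
  have e20 : 0 < e / 2 by lra.
  have [e1 e10 he1] := small_factor e20 (fine_measure_ge0 mu setT).
  have [e2 e2_0 he2] := small_factor e20 (mulr_ge0 (ler0n R 2) N0).
  have [S cS Se] := radon_tight hX (hilbert_measure_radon E) e2_0.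
  have mS := compact_borel hX cS.
  pose f (z : X * X) := K z.2 z.1.
  have cf : continuous f.
    have c0 : continuous (fun z : X * X => z) by exact: continuous_id.
    have c1 : continuous (fun z : X * X => (z.2, z.1)).
      by apply: continuous_pair; [exact: (continuous_pr2 c0)|exact: (continuous_pr1 c0)].
    exact: (continuous_compose c1 cK).
  apply: filterS (compact_uniform_near y0 cS cf e10) => y hy.
  apply: (@le_lt_trans _ _ (e1 * fine (mu S) + 2 * N * fine (mu (~` S)))); last first.
    have h1 : e1 * fine (mu S) <= e1 * fine (mu setT).
      by rewrite ler_wpM2l ?(ltW e10)// fine_measure_le.
    have h2 : 2 * N * fine (mu (~` S)) <= e2 * (2 * N).
      by rewrite [leRHS]mulrC ler_wpM2l// mulr_ge0.
    lra.
  apply: (@mean_nrm (fun x => K x y0 - K x y) _ S) => //.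
  - exact: ltW.
  - by rewrite mulr_ge0.
  - by move=> x Sx; rewrite nrmBC; apply: ltW; exact: hy.
  - by move=> x _; rewrite (le_trans (nrm_normD _ _))// nrmN mulr_natl mulr2n lerD.
  - move=> v; have := is_intB eta_dominated (uP y0 v) (uP y v); rewrite -innerBr.
    suff -> : (fun x => (K x y0 - K x y) v) = (fun x => K x y0 v - K x y v) by [].
    by apply/funext => x; rewrite bopB.
have [z zP] := dual_int_exists cu uN.
by exists u, z.
Qed.

Lemma is_mean_kernel K u z : is_mean K u z -> kernel_mean K eta = u.
Proof.
move=> h; apply: funext => y; rewrite /kernel_mean.
have uP v : inner v (u y) = pairing (fun x : borel X => K x y v) eta.
  by rewrite (pairingE (mean_dual h y v)).
case: xgetP => [w _ wP|/(_ (u y))]; last by move=> /(_ uP).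
apply/eqP; rewrite -subr_eq0; apply/eqP/inner_eq0.
by rewrite innerBr wP uP subrr.
Qed.

Lemma is_mean_pairing K u z : is_mean K u z ->
  pairing (kernel_mean K eta : borel X -> H) eta = z.
Proof. by move=> h; rewrite (is_mean_kernel h) (pairingE (mean_energy h)). Qed.

Definition energy K : C := pairing (kernel_mean K eta : borel X -> H) eta.

Lemma energyE K u z : is_mean K u z -> energy K = z.
Proof. exact: is_mean_pairing. Qed.

End energy.

Section energy_functional.
Variables (R : realType) (H : hilbertType R[i]) (X : ptopologicalType).
Local Notation C := R[i].
Variables (eta : set (borel X) -> H) (mu : {finite_measure set (borel X) -> \bar R}).
Hypotheses (hX : hausdorff_space X) (sH : exists u : nat -> H, dense_seq u).
Hypothesis E : hilbert_measure_data eta mu.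

Let ED := eta_dominated E.
Let m := fine (mu setT).
Let m0 : 0 <= m. Proof. exact: fine_measure_ge0. Qed.
Let m_le A : measurable A -> fine (mu A) <= m.
Proof. by move=> mA; apply: fine_measure_le. Qed.

Lemma is_meanD K1 K2 u1 u2 z1 z2 : is_mean eta mu K1 u1 z1 -> is_mean eta mu K2 u2 z2 ->
  is_mean eta mu (fun x y => K1 x y + K2 x y) (fun y => u1 y + u2 y) (z1 + z2).
Proof.
move=> [d1 c1 e1] [d2 c2 e2]; split => [y v||].
- have := is_intD ED (d1 y v) (d2 y v); rewrite -innerDr.
  suff -> : (fun x => (K1 x y + K2 x y) v) = (fun x => K1 x y v + K2 x y v) by [].
  by apply/funext => x; rewrite bopD.
- by move=> y; exact: (cvgD (c1 y) (c2 y)).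
- exact: (is_intD ED e1 e2).
Qed.

Lemma is_meanZ (a : R) K u z : is_mean eta mu K u z ->
  is_mean eta mu (fun x y => a%:C *: K x y) (fun y => a%:C *: u y) (a%:C * z).
Proof.
move=> [d c e]; split => [y v||].
- have := is_intZ ED a%:C (d y v); rewrite -[_ *: inner _ _]/(_ * _).
  have -> : a%:C * inner v (u y) = inner v (a%:C *: u y).
    rewrite innerZr; congr (_ * _); rewrite conj_Creal// realE -[0]/(0%:C) !lecR.
    exact: le_total.
  suff -> : (fun x => (a%:C *: K x y) v) = (fun x => a%:C *: K x y v) by [].
  by apply/funext => x; rewrite bopZ.
- by move=> y; apply: cvgZr; exact: c.
- exact: (is_intZ ED a%:C e).
Qed.

Lemma is_mean_bound K u z (S : set (borel X)) (a b : R) : is_mean eta mu K u z ->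
  measurable S -> 0 <= a ->
  (forall x y, S x -> S y -> nrm (K x y) <= a) -> (forall x y, nrm (K x y) <= b) ->
  nrm z <= m ^+ 2 * a + 2 * m * fine (mu (~` S)) * b.
Proof.
move=> [d c e] mS a0 Ka Kb.
have b0 : 0 <= b by rewrite (le_trans _ (Kb point point))// nrm_ge0.
have mC := measurableC mS.
have s0 := fine_measure_ge0 mu S; have t0 := fine_measure_ge0 mu (~` S).
have sm := m_le mS; have tm := m_le mC.
have uS y : S y -> nrm (u y) <= a * m + b * fine (mu (~` S)).
  move=> Sy; apply: (@le_trans _ _ (a * fine (mu S) + b * fine (mu (~` S)))).
    exact: (@mean_nrm _ _ _ _ _ E (fun x => K x y) (u y) S a b mS a0 b0
      (fun x Sx => Ka x y Sx Sy) (fun x _ => Kb x y) (d y)).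
  by rewrite lerD2r ler_wpM2l.
have uT y : nrm (u y) <= b * m.
  exact: (mean_nrm_bounded E b0 (fun x => Kb x y) (d y)).
apply: (@le_trans _ _ ((a * m + b * fine (mu (~` S))) * fine (mu S) + b * m * fine (mu (~` S)))).
  apply: (is_int_bound ED _ _ mS _ _ e) => //.
  - by rewrite addr_ge0 ?mulr_ge0.
  - by rewrite mulr_ge0.
apply: (@le_trans _ _ ((a * m + b * fine (mu (~` S))) * m + b * m * fine (mu (~` S)))).
  by rewrite lerD2r ler_wpM2l// addr_ge0 ?mulr_ge0.
lra.
Qed.

Lemma simple_energy n (x : 'I_n -> X) (A : 'I_n -> set (borel X)) (K : X -> X -> bop H) :
  pd_kernel K ->
  0 <= \sum_(j < n) inner (\sum_(i < n) K (x j) (x i) (eta (A i))) (eta (A j)).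
Proof.
move=> pdK; rewrite (_ : \sum_(j < n) _ = kernel_form K x (fun i => eta (A i))).
  exact: kernel_form_ge0.
by apply: eq_bigr => j _; rewrite inner_suml.
Qed.

(** The double integral is a limit of the quadratic forms of the kernel at the points of
    finer and finer partitions, with the vectors [eta (A i)]. *)
Lemma mean_energy_ge0 K u z : nice_kernel K -> pd_kernel K -> is_mean eta mu K u z -> 0 <= z.
Proof.
move=> [[N KN] cK] pdK [d c ez]; apply: ge0_closed => e e0.
have N0 : 0 <= N by rewrite (le_trans _ (KN point point))// nrm_ge0.
have e20 : 0 < e / 2 by lra.
have [e1 e10 he1] := small_factor e20 (mulr_ge0 (ler0n R 2) (mulr_ge0 m0 m0)).
have [e2 e2_0 he2] := small_factor e20 (mulr_ge0 (ler0n R 2) (mulr_ge0 N0 m0)).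
have [S cS Se] := radon_tight hX (hilbert_measure_radon E) e2_0.
have mS := compact_borel hX cS.
pose V x := [set x' | forall y, S y -> nrm (K x' y - K x y) < e1] `&`
            [set x' | forall y, S y -> nrm (K y x' - K y x) < e1].
have nV x : nbhs x (V x).
  have c0 : continuous (fun z : X * X => z) by exact: continuous_id.
  have c1 : continuous (fun z : X * X => (z.2, z.1)).
    by apply: continuous_pair; [exact: (continuous_pr2 c0)|exact: (continuous_pr1 c0)].
  apply: filterI; first exact: (compact_uniform_near x cS cK e10).
  exact: (compact_uniform_near x cS (continuous_compose c1 cK) e10).
have [n [x [A [Sx mA AV tA AS]]]] := compact_borel_partition hX cS (fun x _ => nV x).
have inA y : S y -> exists i, A i y by rewrite -AS => -[i _]; exists i.
have AinS i y : A i y -> S y by move=> Ay; rewrite -AS; exists i.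
pose w j := \sum_(i < n) K (x j) (x i) (eta (A i)).
exists (\sum_(j < n) inner (w j) (eta (A j))); first exact: simple_energy.
have wP j v : is_dual_int eta mu (fun t => \sum_(i < n) (\1_(A i) t : C) *: K (x i) (x j) v) (inner v (w j)).
  have -> : inner v (w j) = \sum_(i < n) inner (K (x i) (x j) v) (eta (A i)).
    by rewrite inner_sumr; apply: eq_bigr => i _; rewrite kernel_hermitian.
  by apply: (is_int_sum ED) => i; exact: (is_int_indic ED _ (mA i)).
have tP : is_dual_int eta mu (fun t => \sum_(j < n) (\1_(A j) t : C) *: w j)
    (\sum_(j < n) inner (w j) (eta (A j))).
  by apply: (is_int_sum ED) => i; exact: (is_int_indic ED _ (mA i)).
have sumA (B : lmodType C) (b : 'I_n -> B) k t : A k t -> \sum_(i < n) (\1_(A i) t : C) *: b i = b k.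
  move=> Ak; rewrite (bigD1 k)//= indicE mem_set// scale1r big1 ?addr0// => l /eqP lk.
  rewrite indicE memNset ?scale0r// => Al; apply: lk; apply: tA => //; by exists t.
have sumN (B : lmodType C) (b : 'I_n -> B) t : ~ S t -> \sum_(i < n) (\1_(A i) t : C) *: b i = 0.
  move=> nS; rewrite big1// => i _; rewrite indicE memNset ?scale0r// => Ai.
  by apply: nS; exact: AinS Ai.
have near_w j y : A j y -> nrm (u y - w j) <= 2 * e1 * fine (mu S) + N * fine (mu (~` S)).
  move=> Ay; have Sy := AinS _ _ Ay.
  pose F t := K t y - \sum_(i < n) (\1_(A i) t : C) *: K (x i) (x j).
  have F1 t : S t -> nrm (F t) <= 2 * e1.
    move=> St; have [i Ai] := inA t St; rewrite /F (sumA _ _ i)//.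
    rewrite (le_trans (nrm_triangle (K (x i) y) _ _))// mulr_natl mulr2n lerD//.
      by apply: ltW; exact: (AV _ _ Ai).1.
    by apply: ltW; apply: (AV _ _ Ay).2; exact: Sx.
  have F2 t : ~ S t -> nrm (F t) <= N by move=> nS; rewrite /F sumN// subr0.
  have F3 v : is_dual_int eta mu (fun t => F t v) (inner v (u y - w j)).
    have := is_intB ED (d y v) (wP j v); rewrite -innerBr.
    suff -> : (fun t => F t v) =
       (fun t => K t y v - \sum_(i < n) (\1_(A i) t : C) *: K (x i) (x j) v) by [].
    apply/funext => t; rewrite /F bopB bop_sum; by congr (_ - _); apply: eq_bigr => i _.
  have e10' : 0 <= 2 * e1 by rewrite mulr_ge0 ?(ltW e10).
  exact: (@mean_nrm _ _ _ _ _ E F (u y - w j) S (2 * e1) N mS e10' N0 F1 F2 F3).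
have uT y : nrm (u y) <= N * m.
  exact: (mean_nrm_bounded E N0 (fun x => KN x y) (d y)).
have mC := measurableC mS.
have s0 := fine_measure_ge0 mu S; have t0 := fine_measure_ge0 mu (~` S).
have sm := m_le mS; have tm := m_le mC.
have h1 : nrm (z - \sum_(j < n) inner (w j) (eta (A j))) <=
    (2 * e1 * fine (mu S) + N * fine (mu (~` S))) * fine (mu S) + N * m * fine (mu (~` S)).
  apply: (is_int_bound ED _ _ mS _ _ (is_intB ED ez tP)).
  - by rewrite addr_ge0 ?mulr_ge0 ?(ltW e10).
  - by rewrite mulr_ge0.
  - by move=> y Sy; have [j Aj] := inA y Sy; rewrite (sumA _ _ j)//; exact: near_w.
  - by move=> y nS; rewrite sumN// subr0.
apply: (le_trans h1).
apply: (@le_trans _ _ ((2 * e1 * m + N * fine (mu (~` S))) * m + N * m * fine (mu (~` S)))).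
  rewrite lerD2r ler_pM ?addr_ge0 ?mulr_ge0 ?(ltW e10)// lerD2r ler_wpM2l// mulr_ge0// ltW//.
have h2 : N * m * fine (mu (~` S)) <= N * m * e2 by rewrite ler_wpM2l ?mulr_ge0.
lra.
Qed.

Lemma energy_ge0 K : nice_kernel K -> pd_kernel K -> 0 <= energy eta K.
Proof.
move=> nK pK; have [u [z h]] := nice_mean hX sH E nK.
by rewrite (energyE E h); exact: (mean_energy_ge0 nK pK h).
Qed.

Lemma energy_functional : kernel_functional (fun K => complex.Re (energy eta K)).
Proof.
split.
- move=> K1 K2 n1 n2; have [u1 [z1 h1]] := nice_mean hX sH E n1.
  have [u2 [z2 h2]] := nice_mean hX sH E n2.
  by rewrite (energyE E (is_meanD h1 h2)) (energyE E h1) (energyE E h2) raddfD.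
- move=> a K nK; have [u [z h]] := nice_mean hX sH E nK.
  by rewrite (energyE E (is_meanZ a h)) (energyE E h) ReE_mulr.
- by move=> K nK pK; rewrite -ler0c -ge0_Re; exact: energy_ge0.
- move=> e e0; have [e1 e10 he1] := small_factor e0 (mulr_ge0 (ler0n R 2) m0).
  have [S cS Se] := radon_tight hX (hilbert_measure_radon E) e10.
  exists S, (m ^+ 2); split; [by []|exact: sqr_ge0|].
  move=> K a b nK a0 Ka Kb; have [u [z h]] := nice_mean hX sH E nK.
  have b0 : 0 <= b by rewrite (le_trans _ (Kb point point))// nrm_ge0.
  rewrite (energyE E h) (le_trans (Re_abs_nrm _))//.
  have := is_mean_bound h (compact_borel hX cS) a0 Ka Kb => hz.
  rewrite (le_trans hz)// lerD2l ler_wpM2r// (le_trans _ (ltW he1))// mulrC.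
  by rewrite ler_wpM2r// mulr_ge0.
Qed.

End energy_functional.

(** * Projected measures, Dirac measures, integral strict positive definiteness *)

Lemma dominated_measure_radon (R : realType) (X : ptopologicalType) (B : normedModType R[i])
    (nu : set (borel X) -> B) (mu : {finite_measure set (borel X) -> \bar R}) (c : R) :
  hausdorff_space X -> countably_additive nu -> radon mu -> 0 <= c ->
  (forall A, measurable A -> nrm (nu A) <= c * fine (mu A)) ->
  (Defs.variation nu setT < +oo)%E /\ radon (Defs.variation nu).
Proof.
move=> hX ca rmu c0 dom; have vdom := variation_dominated c0 dom.
have fin : (Defs.variation nu setT < +oo)%E by apply: le_lt_trans (vdom _ measurableT) (ltry _).
split => //; have [vm vmE] := variation_measure ca fin.
apply: (eq_radon hX vmE); apply: (radon_dominated hX c0 _ rmu) => A mA.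
by rewrite -lee_fin measure_fineK// vmE// vdom.
Qed.

Section projected_measure.
Variables (R : realType) (H : hilbertType R[i]) (X : ptopologicalType).
Local Notation C := R[i].
Variables (eta : set (borel X) -> H) (mu : {finite_measure set (borel X) -> \bar R}).
Hypotheses (hX : hausdorff_space X) (sH : exists u : nat -> H, dense_seq u).
Hypothesis E : hilbert_measure_data eta mu.
Variable a : H.

Definition proj_measure (A : set (borel X)) : C := inner (eta A) a.

Lemma proj_measure_radon : @radon_vector_measure R X (C : hilbertType C) proj_measure.
Proof.
have ca : @countably_additive R _ (borel X) C proj_measure.
  move=> F mF tF; rewrite (_ : (fun n => _) = (fun n => inner (\sum_(0 <= i < n) eta (F i)) a)).
    by apply: inner_cvgl; exact: (hilbert_measure_ca E).
  by apply/funext => n; rewrite inner_suml.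
have [] := @dominated_measure_radon R X C proj_measure mu (nrm a) hX ca (hilbert_measure_radon E) (nrm_ge0 a).
  move=> A mA; rewrite (le_trans (cauchy_schwarz _ _))// mulrC ler_wpM2l ?nrm_ge0//.
  by rewrite -lee_fin measure_fineK// (hilbert_measure_variation E)// variation_nrm.
by [].
Qed.

Variable nmu : {finite_measure set (borel X) -> \bar R}.
Hypothesis EN : @hilbert_measure_data R (C : hilbertType C) X proj_measure nmu.

(** The same simple functions approximate [f] for the measure [<eta, a>] and, multiplied
    by [a], approximate [f *: a] for [eta]. *)
Lemma proj_dual_int (f : X -> C) (N : R) I : continuous f -> (forall x, nrm (f x) <= N) ->
  @is_dual_int R (C : hilbertType C) X proj_measure nmu f I ->
  is_dual_int eta mu (fun x => f x *: a) I.
Proof.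
move=> cf fN fI; have [s [c sl]] := continuous_simple_limit (complex_dense_seq R) cf fN.
have ND := eta_dominated EN; have ED := eta_dominated E.
have cI := is_int_L1_approx ND fI (simple_limit_L1 nmu sl).
exists (fun n => (fun z : C => z *: a) \o s n).
  apply: (@L1_approx_map _ (borel X) R mu C H (fun z : C => z *: a) (nrm a)).
    by move=> x y; rewrite -scalerBl nrmZ mulrC.
  exact: simple_limit_L1 sl.
rewrite (_ : (fun n => _) = (fun n => simple_int
    (fun A (b : (C : normedModType C)) => (inner (b : (C : hilbertType C)) (proj_measure A) : (C : normedModType C))) (s n)))//.
apply/funext => n; have [fs _ _] := sl.
apply: (@simple_int_map _ (borel X) R C C H C _ _ (fun z : C => z *: a) id ED.1 _ _ (s n) (fs n)).
  by move=> x y.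
by move=> A x mA; rewrite /= innerZl [inner a _]innerC.
Qed.

(** The mean of the product with [rank1 a] is [a] times the mean of [q] against
    [<eta, a>]. *)
Lemma energy_rank1 (q : X -> X -> C) :
  nice_kernel (scalar_kernel q) ->
  energy eta (fun x y => q x y *: rank1 a) = @energy R (C : hilbertType C) X proj_measure (scalar_kernel q).
Proof.
move=> nq; have [k [z h]] := nice_mean hX (complex_dense_seq R) EN nq.
rewrite (energyE EN h).
have [[N qN] cq] := nq.
have qN' x y : nrm (q x y) <= N.
  rewrite (le_trans _ (qN x y))// -[q x y]mulr1.
  by rewrite (le_trans (nrm_bop_le (scalar_kernel q x y) (1 : C)))// nrm_real normr1 mulr1.
have cqy y (b : C) : continuous (fun x => q x y * b).
  exact: (continuous_bop_apply (continuous_slice1 cq) (v := b)).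
apply: (energyE E (u := fun y => k y *: a)); split.
- move=> y v; have d := mean_dual h y (inner v a).
  have -> : inner v (k y *: a) = @inner C (C : hilbertType C) (inner v a) (k y).
    by rewrite innerZr mulrC.
  rewrite (_ : (fun x => (q x y *: rank1 a) v) = (fun x => (q x y * inner v a) *: a)); last first.
    by apply/funext => x; rewrite bopZ /= scalerA.
  have bnd x : nrm (q x y * inner v a) <= N * nrm (inner v a : C).
    by rewrite nrmM ler_wpM2r ?nrm_ge0.
  exact: (@proj_dual_int (fun x => q x y * inner v a) _ _ (cqy y _) bnd d).
- by move=> y; apply: cvgZl; exact: (mean_continuous h).
- have [m_ kP] : exists m_ : R, forall y, nrm (k y) <= m_.
    have N0 : 0 <= N by rewrite (le_trans _ (qN point point))// nrm_ge0.
    exists (N * fine (nmu setT)) => y.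
    exact: (mean_nrm_bounded EN N0 (fun x => qN x y) (mean_dual h y)).
  exact: (@proj_dual_int k m_ z (mean_continuous h) kP (mean_energy h)).
Qed.

End projected_measure.

Lemma nice_scalar_kernel (R : realType) (X : ptopologicalType) (q : X -> X -> R[i]) (M : R) :
  (forall x y, nrm (q x y) <= M) -> continuous (fun z : X * X => q z.1 z.2) ->
  nice_kernel (scalar_kernel q).
Proof.
move=> qM cq; have := @nice_scalar R (R[i] : hilbertType R[i]) X q (mulop 1) M qM cq.
rewrite (_ : (fun x y => q x y *: mulop 1) = scalar_kernel q)//.
apply/funext => x; apply/funext => y; apply/val_inj/funext => c.
by rewrite -[LHS]/(q x y * (1 * c)) mul1r.
Qed.

Section integral_positivity.
Variables (R : realType) (H : hilbertType R[i]) (X Omega : ptopologicalType).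
Local Notation C := R[i].
Variables (p : Omega -> X -> X -> C) (Lam : set (borel Omega) -> bop H) (M : R).
Variables (mu lam : {finite_measure set (borel Omega) -> \bar R}) (G : Omega -> bop H).
Hypothesis D : mixture_data p Lam M mu.
Hypothesis RN : RN_decomposition Lam lam G.

(** The double integral of the product of [p_w] with [rank1 a], against [eta], is the
    one of [p_w] against the scalar measure [<eta, a>]. *)
Lemma mixture_integrally_spd : hausdorff_space X -> (exists u : nat -> H, dense_seq u) ->
  (forall w, integrally_strictly_pd (scalar_kernel (p w))) ->
  pd_op (Lam setT) -> integrally_strictly_pd (mixture_on p Lam mu setT).
Proof.
move=> hX sH pi Lpd; have nP := mixture_on_nice D measurableT.
split; [exact: nP.1|exact: (mixture_on_pd D)|exact: (mixture_RKHS_continuous D)|].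
move=> eta /(radon_vector_measure_data hX)[emu E] [A mA eA].
have e0 := energy_ge0 hX sH E nP (mixture_on_pd D measurableT).
rewrite lt_def e0 andbT; apply/negP => /eqP eE.
have := Lpd _ eA; rewrite lt_def => /andP[/eqP + _]; apply.
have -> : Lam setT (eta A) = 0; last exact: inner0l.
apply: (mixture_vanishing D RN (energy_functional hX sH E)); first by rewrite /energy eE.
move=> w a.
have nw : nice_kernel (scalar_kernel (p w)).
  apply: (@nice_scalar_kernel _ _ _ M) => [x y|]; first exact: (mixture_bounded D).
  exact: (p_continuousr D).
have rN := proj_measure_radon hX E a.
have [nmu EN] := radon_vector_measure_data hX rN.
rewrite (energy_rank1 hX E EN nw) => Q0; apply: contrapT => /eqP ea0.
have [_ _ _ /(_ _ rN)] := pi w; rewrite -/(energy _ _) => /(_ _)/wrap[].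
  by exists A.
by move=> /[dup] /ltW/ge0_Re; rewrite /energy Q0 => ->; rewrite ltxx.
Qed.

End integral_positivity.

Section dirac_measures.
Variables (R : realType) (H : hilbertType R[i]) (X : ptopologicalType).
Local Notation C := R[i].
Hypothesis hX : hausdorff_space X.
Variables (x : X) (v : H).

Definition dirac_vector (A : set (borel X)) : H := (\1_A x : C) *: v.

Lemma borel_point : measurable ([set x] : set (borel X)).
Proof. by apply: (compact_borel hX); exact: compact_set1. Qed.

Let dx : {finite_measure set (borel X) -> \bar R} := @dirac _ (borel X) x R.

Let dxE B : fine (dx B) = \1_B x.
Proof. by []. Qed.

Lemma dirac_radon : radon dx.
Proof.
have dN (e : R) (B : set (borel X)) : 0 < e -> ~ B x -> fine (dx B) <= e.
  by move=> e0 nB; rewrite dxE indicE memNset//= ltW.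
apply/radonP => //; split=> [A e mA e0|U e oU e0].
  have [xA|xA] := pselect (A x).
    by exists setT; split; [exact: openT| |apply: dN => // -[_]; apply].
  exists (~` [set x]); split.
  - by rewrite openC; apply: compact_closed => //; exact: compact_set1.
  - by move=> y Ay xy; apply: xA; rewrite -xy.
  - by apply: dN => // -[+ _]; apply.
have [xU|xU] := pselect (U x).
  exists [set x]; split; [exact: compact_set1|by move=> y ->|].
  by apply: dN => // -[_]; apply.
exists set0; split; [exact: compact0|by []|].
by apply: dN => // -[].
Qed.

Lemma dirac_vector_radon : radon_vector_measure dirac_vector.
Proof.
have ca : countably_additive dirac_vector.
  move=> F mF tF; have [[k _ Fk]|nF] := pselect ((\bigcup_n F n) x); last first.
    rewrite (_ : (fun n => _) = fun=> 0).
      by rewrite /dirac_vector indicE memNset// scale0r; exact: cvg_cst.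
    apply/funext => n; rewrite big1// => i _.
    by rewrite /dirac_vector indicE memNset ?scale0r// => Fi; apply: nF; exists i.
  have -> : dirac_vector (\bigcup_n F n) = v.
    by rewrite /dirac_vector indicE mem_set ?scale1r//; exists k.
  apply/cvg_nrmP => e e0; exists k.+1 => // n /= kn.
  rewrite (bigD1_seq k)/= ?iota_uniq ?mem_index_iota// big1 => [|i ik].
    by rewrite /dirac_vector indicE mem_set// scale1r addr0 subrr nrm0.
  rewrite /dirac_vector indicE memNset ?scale0r// => Fi; move/eqP: ik; apply.
  by apply: tF => //; exists x.
have [] := @dominated_measure_radon R X H dirac_vector dx (nrm v) hX ca dirac_radon (nrm_ge0 v).
  by move=> A mA; rewrite nrmZ nrm_indic mulrC dxE.
by [].
Qed.

(** The complement of [x] is null, so any [F] may be replaced by the constant [F x]. *)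
Lemma dirac_dual_int (mu : {finite_measure set (borel X) -> \bar R}) (F : X -> H) :
  hilbert_measure_data dirac_vector mu -> is_dual_int dirac_vector mu F (inner (F x) v).
Proof.
move=> E; have ED := eta_dominated E.
have mN : measurable (~` [set x] : set (borel X)) by apply: measurableC; exact: borel_point.
have N0 : mu (~` [set x]) = 0%E.
  apply/eqP; rewrite eq_le measure_ge0 andbT (hilbert_measure_variation E)//.
  apply: le_trans (variation_dominated (mu := dx) (nrm_ge0 v) _ mN) _.
    by move=> A mA; rewrite nrmZ nrm_indic mulrC dxE.
  by rewrite dxE indicE memNset ?mulr0//; apply.
have h := is_int_indic ED (F x) measurableT.
have eta1 : dirac_vector setT = v by rewrite /dirac_vector indicT scale1r.
rewrite eta1 in h.
apply: (is_int_ae_eq mN N0 _ h) => y /contrapT ->.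
by rewrite indicT scale1r.
Qed.

Lemma dirac_energy (K : X -> X -> bop H) : pd_kernel K ->
  continuous (fun z : X * X => K z.1 z.2) -> energy dirac_vector K = inner (K x x v) v.
Proof.
move=> pK cK; have [mu E] := radon_vector_measure_data hX dirac_vector_radon.
apply: (energyE E (u := fun y => K y x v)); split.
- by move=> y w; rewrite -(kernel_hermitian _ _ _ _ pK); exact: (@dirac_dual_int mu (fun t => K t y w)).
- exact: (continuous_bop_apply (continuous_slice1 cK)).
- exact: (@dirac_dual_int mu (fun t => K t x v)).
Qed.

End dirac_measures.

(** * Necessity of positivity, and scalar projections *)

Section diagonal.
Variables (R : realType) (H : hilbertType R[i]) (X : ptopologicalType).
Local Notation C := R[i].
Variables (K : X -> X -> bop H) (x : X) (v : H).
Hypothesis v0 : v != 0.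

Lemma strictly_pd_diag : strictly_pd_kernel K -> inner (K x x v) v != 0.
Proof.
move=> [_ spd]; apply: contra v0 => /eqP Kv; apply/eqP.
apply: (spd 1%N (fun=> x) (fun=> v) _ _ ord0) => [i j _|]; first by rewrite (ord1 i) (ord1 j).
by rewrite /kernel_form !big_ord1.
Qed.

(** If [<K(x, x) v, v> = 0], then the section at [x] in the direction [v] is 0, and
    every function [f] of the space has [f x] orthogonal to [v]. *)
Lemma universal_diag : universal K -> inner (K x x v) v != 0.
Proof.
move=> [_ uK]; apply/negP => /eqP Kv; have nv := nrm_gt0 v0.
have [f [F [e <-]] fv] := uK [set x] (fun=> v) (nrm v) (@compact_set1 _ x)
  (continuous_subspaceT (fun y => cvg_cst v)) nv.
have s0 : rkhs_section F x v = 0.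
  by apply: inner_eq0; rewrite rkhs_reproducing rkhs_sectionE innerC Kv conjC0.
have fx : inner v (rkhs_fun F e x) = 0 by rewrite -rkhs_reproducing s0 inner0l.
have hf : nrm (rkhs_fun F e x - v) < nrm v.
  by rewrite -lte_fin; apply: le_lt_trans fv; apply: ereal_sup_ubound; exists x.
have := cauchy_schwarz v (rkhs_fun F e x - v).
rewrite innerBr fx sub0r nrmN inner_nrm nrm_real ger0_norm ?sqr_ge0// expr2 ler_pM2l// => h.
by move: (le_lt_trans h hf); rewrite ltxx.
Qed.

Lemma integrally_spd_diag : hausdorff_space X ->
  continuous (fun z : X * X => K z.1 z.2) -> integrally_strictly_pd K ->
  inner (K x x v) v != 0.
Proof.
move=> hX cK [_ pK _ iK]; have := iK _ (dirac_vector_radon hX x v).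
rewrite -/(energy _ _) dirac_energy// => h.
have {h} : 0 < inner (K x x v) v.
  by apply: h; exists setT => //; rewrite /dirac_vector indicT scale1r.
by rewrite lt_def => /andP[].
Qed.

End diagonal.

Section operator_positivity.
Variables (R : realType) (H : hilbertType R[i]) (X Omega : ptopologicalType).
Local Notation C := R[i].
Variables (p : Omega -> X -> X -> C) (Lam : set (borel Omega) -> bop H) (M : R).
Variables (mu lam : {finite_measure set (borel Omega) -> \bar R}) (G : Omega -> bop H).
Hypothesis D : mixture_data p Lam M mu.
Hypothesis RN : RN_decomposition Lam lam G.

(** By monotonicity and Cauchy-Schwarz all [Lam A] vanish at [v]. *)
Lemma mixture_on_null v x y : inner (Lam setT v) v = 0 -> mixture_on p Lam mu setT x y v = 0.
Proof.
move=> L0; have Lv A : measurable A -> Lam A v = 0.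
  move=> mA; apply: psd_op_ker; first exact: (Lam_psd D mA).
  apply/eqP; rewrite eq_le (Lam_psd D mA) andbT -L0.
  exact: (opmeasure_mono (mixture_opmeasure D)).
have [s [c sl]] := p_simple_limit D x y; have [fs _ _] := sl.
have := mixture_onP D x y measurableT.
rewrite /is_Lint (_ : (fun w => _ * _) = (fun w => p w x y)); last first.
  by apply/funext => w; rewrite indicT mul1r.
move=> /(is_int_L1_approx (Lam_dominated D))/(_ (simple_limit_L1 mu sl)) cs.
have := cvg_comp _ _ cs (@continuous_bop_apply R H _ id v (@continuous_id _) _).
rewrite (_ : _ \o _ = fun=> 0).
  by move=> /(cvg_unique (@norm_hausdorff _ H) (cvg_cst 0)) <-.
apply/funext => n; rewrite /simple_int /= fsbig_finite//=; last exact: (fs n).1.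
by rewrite bop_sum big1// => c' _; rewrite bopZ Lv ?scaler0//; exact: (fs n).2.
Qed.

Lemma pd_op_of_diag x : (forall v, v != 0 -> inner (mixture_on p Lam mu setT x x v) v != 0) ->
  pd_op (Lam setT).
Proof.
move=> h v v0; rewrite lt_def (Lam_psd D measurableT) andbT.
by apply: contra (h v v0) => /eqP/mixture_on_null ->; rewrite inner0l.
Qed.

Lemma strictly_pd_mixtureP : (forall w, strictly_pd_kernel (scalar_kernel (p w))) ->
  strictly_pd_kernel (mixture_on p Lam mu setT) <-> pd_op (Lam setT).
Proof.
move=> ps; split=> [sP|]; last exact: (mixture_strictly_pd D RN ps).
by apply: (@pd_op_of_diag point) => v v0; exact: strictly_pd_diag.
Qed.

Lemma universal_mixtureP : hausdorff_space X -> (forall w, universal (scalar_kernel (p w))) ->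
  universal (mixture_on p Lam mu setT) <-> pd_op (Lam setT).
Proof.
move=> hX pu; split=> [uP|]; last exact: (mixture_universal D hX pu).
by apply: (@pd_op_of_diag point) => v v0; exact: universal_diag.
Qed.

Lemma integrally_spd_mixtureP : hausdorff_space X -> (exists u : nat -> H, dense_seq u) ->
  (forall w, integrally_strictly_pd (scalar_kernel (p w))) ->
  integrally_strictly_pd (mixture_on p Lam mu setT) <-> pd_op (Lam setT).
Proof.
move=> hX sH pi; split=> [iP|]; last exact: (mixture_integrally_spd D RN hX sH pi).
apply: (@pd_op_of_diag point) => v v0; apply: integrally_spd_diag => //.
exact: (mixture_on_continuous D measurableT).
Qed.

End operator_positivity.

Section projections.
Variables (R : realType) (H : hilbertType R[i]) (X Omega : ptopologicalType).
Local Notation C := R[i].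
Local Notation CH := (C : hilbertType C).
Variable v : H.

(** Applied to [Lam] and to [G], this yields the data of which [P_v] is the mixture. *)
Definition proj_op (T : bop H) : bop CH := mulop (inner (T v) v).

Lemma proj_opE (T : bop H) (c : C) : proj_op T c = inner (T v) v * c.
Proof. by []. Qed.

Lemma proj_opB : zmod_morphism proj_op.
Proof.
move=> S T; apply/val_inj/funext => c.
by rewrite -[LHS]/(inner ((S - T) v) v * c) bopB innerBl mulrBl.
Qed.

Lemma proj_op0 : proj_op 0 = 0.
Proof. by have := proj_opB 0 0; rewrite !subrr. Qed.

Lemma proj_opD S T : proj_op (S + T) = proj_op S + proj_op T.
Proof. by rewrite -[T in LHS]opprK proj_opB -[- T]sub0r proj_opB proj_op0 sub0r opprK. Qed.

Lemma proj_opZ (a : C) (T : bop H) : proj_op (a *: T) = a *: proj_op T.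
Proof.
apply/val_inj/funext => c.
by rewrite -[LHS]/(inner ((a *: T) v) v * c) bopZ innerZl -mulrA.
Qed.

Lemma proj_op_nrm (T : bop H) : nrm (proj_op T) <= nrm v ^+ 2 * nrm T.
Proof.
apply: bop_nrm_le => [|c]; first by rewrite mulr_ge0 ?sqr_ge0 ?nrm_ge0.
rewrite proj_opE nrmM ler_wpM2r ?nrm_ge0// (le_trans (cauchy_schwarz _ _))//.
by rewrite expr2 mulrC -mulrA ler_wpM2l ?nrm_ge0// mulrC nrm_bop_le.
Qed.

Lemma proj_op_lipschitz (S T : bop H) : nrm (proj_op S - proj_op T) <= nrm v ^+ 2 * nrm (S - T).
Proof. by rewrite -proj_opB proj_op_nrm. Qed.

Lemma continuous_proj_op : continuous proj_op.
Proof.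
move=> T; apply: (@cvg_nrm_le R (bop CH) (bop H) (nbhs T) _ proj_op _ (fun S => nrm v ^+ 2 * nrm (T - S))).
  by move=> S; exact: proj_op_lipschitz.
by rewrite -(mulr0 (nrm v ^+ 2)); apply: cvgMr; apply: cvg_dist0; exact: cvg_id.
Qed.

Lemma pd_proj_op (T : bop H) : pd_op (proj_op T) <-> 0 < inner (T v) v.
Proof.
have E c : @inner C CH (proj_op T c) c = inner (T v) v * (c * Num.conj c) by rewrite mulrA.
split=> [/(_ 1)|T0 c c0].
  by rewrite E conjC1 !mulr1; apply; exact: oner_neq0.
by rewrite E mulr_gt0// -nrm_sqr -[0]/(0%:C) ltcR exprn_gt0// nrm_gt0.
Qed.

Variables (p : Omega -> X -> X -> C) (Lam : set (borel Omega) -> bop H) (M : R).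
Variables (mu lam : {finite_measure set (borel Omega) -> \bar R}) (G : Omega -> bop H).
Hypothesis D : mixture_data p Lam M mu.
Hypothesis RN : RN_decomposition Lam lam G.

Let lam_dom := @bochner_dominated _ (borel Omega) R (bop CH) lam.

Lemma proj_bochner f I : is_bochner_integral lam f I ->
  is_bochner_integral lam (proj_op \o f) (proj_op I).
Proof.
rewrite !is_bochner_intE => h.
apply: (is_int_map lam_dom.1 proj_op_lipschitz proj_opB continuous_proj_op _ h).
by move=> A T _; rewrite proj_opZ.
Qed.

Lemma proj_mixture_data : exists nu : {finite_measure set (borel Omega) -> \bar R},
  mixture_data p (fun A => proj_op (Lam A)) M nu.
Proof.
have [ca _ psd _] := mixture_opmeasure D; have hO := mixture_hausdorff D.
have pca : countably_additive (fun A => proj_op (Lam A)).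
  move=> F mF tF; have := cvg_comp _ _ (ca F mF tF) (@continuous_proj_op _).
  rewrite (_ : _ \o _ = (fun n => \sum_(0 <= i < n) proj_op (Lam (F i))))//.
  by apply/funext => n; exact: (big_morph _ proj_opD proj_op0).
have dom A : measurable A -> nrm (proj_op (Lam A)) <= nrm v ^+ 2 * fine (mu A).
  move=> mA; rewrite (le_trans (proj_op_nrm _))// ler_wpM2l ?sqr_ge0//.
  by rewrite -lee_fin measure_fineK// (mixture_variation D)// variation_nrm.
have [fin rad] := dominated_measure_radon hO pca (mixture_radon D) (sqr_ge0 (nrm v)) dom.
have [nu nuE] := variation_measure pca fin.
exists nu; split => //.
- exact: (mixture_bounded D).
- exact: (mixture_continuous D).
- exact: (mixture_pd D).
- split => // A mA c.
  rewrite proj_opE -[inner _ _]/(inner (Lam A v) v * c * Num.conj c) -mulrA -nrm_sqr.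
  by rewrite mulr_ge0 ?psd// ler0c sqr_ge0.
- by apply: (eq_radon hO _ rad) => A mA; rewrite nuE.
Qed.

Lemma proj_RN : RN_decomposition (fun A => proj_op (Lam A)) lam (fun w => proj_op (G w)).
Proof.
have [[s Gs] _] := RN; split.
  exists (fun n => proj_op \o s n).
  exact: (L1_approx_map proj_op_lipschitz Gs).
move=> A mA; have := proj_bochner (bochner_indic RN mA).
have -> : proj_op \o (fun w : borel Omega => (\1_A w : C) *: G w) =
    (fun w => (\1_A w : C) *: proj_op (G w)).
  by apply/funext => w; exact: proj_opZ.
move=> h; apply: (bochner_unique h); exact: (bochner_integral_is h).
Qed.

Lemma proj_kernelE : proj_kernel (mixture p lam G) v = mixture p lam (fun w => proj_op (G w)).
Proof.
apply/funext => x; apply/funext => y; rewrite (mixtureE D RN).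
have := proj_bochner (mixture_bochner D RN x y).
have -> : proj_op \o (fun w : borel Omega => p w x y *: G w) =
    (fun w => p w x y *: proj_op (G w)).
  by apply/funext => w; exact: proj_opZ.
move=> h; apply: (bochner_unique h); exact: (bochner_integral_is h).
Qed.

End projections.

(** * The theorem *)

Theorem theorem3p7 (R : realType) (H : hilbertType R[i])
    (X Omega : ptopologicalType)
    (p : Omega -> X -> X -> R[i])
    (Lam : set (borel Omega) -> bop H)
    (lam : {finite_measure set (borel Omega) -> \bar R})
    (G : Omega -> bop H) :
  separable_space H ->
  hausdorff_space X ->
  hausdorff_space Omega ->
  locally_compact [set: Omega] ->
  (exists M : R, forall w x y, nrm (p w x y) <= M) ->
  continuous (fun t : Omega * X * X => p t.1.1 t.1.2 t.2) ->
  (forall w, pd_kernel (scalar_kernel (p w))) ->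
  radon_nonneg_opmeasure Lam ->
  RN_decomposition Lam lam G ->
  let P : X -> X -> bop H := mixture p lam G in
  let P_ (v : H) : X -> X -> bop R[i] := proj_kernel P v in
  (* Lambda_v is a nonnegative finite Radon measure *)
  (forall v : H, v != 0 ->
    exists2 Lam_v : {finite_measure set (borel Omega) -> \bar R},
      forall A : set (borel Omega), measurable A ->
        inner (Lam A v) v = (fine (Lam_v A))%:C &
      radon (Lam_v : set (borel Omega) -> \bar R)) /\
  (* (i) *)
  [/\ forall x y, exists! T : bop H,
        is_bochner_integral lam
          (fun w : borel Omega => p w x y *: G w) T,
      pd_kernel P &
      forall v : H, v != 0 -> pd_kernel (P_ v)] /\
  (* (ii) *)
  [/\ bounded_kernel P,
      continuous (fun z : X * X => P z.1 z.2) &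
      RKHS_continuous P] /\
  (* (iii) *)
  ((forall w, strictly_pd_kernel (scalar_kernel (p w))) ->
    (strictly_pd_kernel P <->
      forall v : H, v != 0 -> strictly_pd_kernel (P_ v)) /\
    (strictly_pd_kernel P <-> pd_op (Lam setT))) /\
  (* (iv) *)
  ((forall w, universal (scalar_kernel (p w))) ->
    (universal P <-> forall v : H, v != 0 -> universal (P_ v)) /\
    (universal P <-> pd_op (Lam setT))) /\
  (* (v) *)
  (locally_compact [set: X] ->
   (forall w, integrally_strictly_pd (scalar_kernel (p w))) ->
    (integrally_strictly_pd P <->
      forall v : H, v != 0 -> integrally_strictly_pd (P_ v)) /\
    (integrally_strictly_pd P <-> pd_op (Lam setT))).
Proof.
move=> sH hX hO _ [M pM] pc ppd LamR RN P P_.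
have [mu muE mu_radon] := opmeasure_variation LamR hO.
have D : mixture_data p Lam M mu by [].
have PE : P = mixture_on p Lam mu setT by exact: (mixtureE D RN).
have dH := separable_dense_seq sH.
have proj v : exists nu, mixture_data p (fun A => proj_op v (Lam A)) M nu /\
    P_ v = mixture_on p (fun A => proj_op v (Lam A)) nu setT.
  have [nu Dv] := proj_mixture_data v D; exists nu; split => //.
  by rewrite /P_ /P (proj_kernelE v D RN); exact: (mixtureE Dv (proj_RN v RN)).
(* Positive definiteness of [Lam Omega] says that every scalar [<Lam Omega v, v>] is
   positive, and each of these scalars decides the property of [P_v]. *)
have pd_all (A : Prop) (C : H -> Prop) : (A <-> pd_op (Lam setT)) ->
    (forall v, v != 0 -> C v <-> 0 < inner (Lam setT v) v) ->
    (A <-> forall v, v != 0 -> C v) /\ (A <-> pd_op (Lam setT)).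
  move=> AP CP; split => //; rewrite AP; split=> [pL v v0|h v v0].
    by apply/CP => //; exact: pL.
  by apply/CP => //; exact: h.
split; first by move=> v _; exact: (opmeasure_scalar LamR hO v).
split; [split|split; [split|split; [|split]]].
- move=> x y; exists (mixture_on p Lam mu setT x y); split; first exact: (mixture_bochner D RN x y).
  move=> T; apply: bochner_unique; exact: (mixture_bochner D RN x y).
- by rewrite PE; exact: (mixture_on_pd D measurableT).
- by move=> v _; have [nu [Dv ->]] := proj v; exact: (mixture_on_pd Dv measurableT).
- by rewrite PE; exact: (mixture_on_nice D measurableT).1.
- by rewrite PE; exact: (mixture_on_continuous D measurableT).
- by rewrite PE; exact: (mixture_RKHS_continuous D measurableT).
- move=> ps; apply: pd_all; first by rewrite PE; exact: (strictly_pd_mixtureP D RN ps).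
  move=> v v0; have [nu [Dv ->]] := proj v.
  by rewrite (strictly_pd_mixtureP Dv (proj_RN v RN) ps) pd_proj_op.
- move=> pu; apply: pd_all; first by rewrite PE; exact: (universal_mixtureP D hX pu).
  move=> v v0; have [nu [Dv ->]] := proj v.
  by rewrite (universal_mixtureP Dv hX pu) pd_proj_op.
- move=> _ pi; apply: pd_all; first by rewrite PE; exact: (integrally_spd_mixtureP D RN hX dH pi).
  move=> v v0; have [nu [Dv ->]] := proj v.
  by rewrite (integrally_spd_mixtureP Dv (proj_RN v RN) hX (complex_dense_seq R) pi) pd_proj_op.
Qed.
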